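(* There exists a universal constant $C\in(0,\infty)$ such that for all $d\in\mathbb{N}$ and $p\in[2,\infty)$ we have $$\|M^d_{*,\mathcal{D}}f\|_{\ell^p(\mathbb{Z}^d)}\le C\,\|f\|_{\ell^p(\mathbb{Z}^d)},\qquad f\in\ell^p(\mathbb{Z}^d).$$
   Context: $\mathbb{N}=\{1,2,\dots\}$ and $\mathcal{D}=\{2^n:n\in\mathbb{N}\}$. For $R\ge0$ let $B_R^d=\{x\in\mathbb{R}^d:|x_1|+\dots+|x_d|\le R\}$. For $f:\mathbb{Z}^d\to\mathbb{R}$ put $M_R^df(x)=\frac{1}{|B_R^d\cap\mathbb{Z}^d|}\sum_{y\in B_R^d\cap\mathbb{Z}^d}f(x-y)$, $x\in\mathbb{Z}^d$, where $|\cdot|$ of a finite set is its cardinality. For $E\subseteq[0,\infty)$ let $M^d_{*,E}f(x)=\sup_{R\in E}|M_R^df(x)|$. *)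

(* Defs.v *)
From mathcomp Require Import all_boot all_order all_algebra finmap.
From mathcomp Require Import all_classical all_reals all_analysis.

Set Implicit Arguments.
Unset Strict Implicit.
Unset Printing Implicit Defensive.

Import Order.TTheory GRing.Theory Num.Theory.

Local Open Scope classical_set_scope.
Local Open Scope ring_scope.

Section HardyLittlewood.
Context {R : realType}.
Implicit Types (d : nat) (r p : R) (E : set R).

Definition dyadic : set R := [set r | exists2 n : nat, (0 < n)%N & r = 2 ^+ n].

Definition l1ball d r : set 'rV[R]_d := [set x | \sum_(i < d) `|x 0 i| <= r].

Definition lattice_l1ball d r : set 'rV[int]_d :=
  [set y | l1ball r (map_mx (intr : int -> R) y)].

(* Both [\sum_(y \in A)] and [fset_set A] take a junk value when A is infinite;
   this lemma rules that case out in [HLavg]. *)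
Lemma finite_lattice_l1ball d r : finite_set (@lattice_l1ball d r).
Proof.
pose n := `|Num.ceil r|%N.
pose g (u : 'rV['I_(n + n).+1]_d) : 'rV[int]_d :=
  \row_i ((u 0 i : nat)%:Z - n%:Z).
apply: (@sub_finite_set _ _ (g @` setT)); last first.
  by apply: finite_image; exact: finite_finset.
move=> y /= yr.
have yn i : `|y 0 i| <= n%:Z.
  rewrite -(ler_int R) intr_norm; apply: (@le_trans _ _ r).
    apply: le_trans yr; rewrite (bigD1 i)//= mxE lerDl.
    by apply: sumr_ge0 => j _.
  apply: le_trans (ceil_ge r) _; rewrite ler_int /n abszE; exact: ler_norm.
exists (\row_i inord `|(y 0 i + n%:Z)%R|%N) => //.
apply/rowP => i; rewrite !mxE.
have := yn i; rewrite ler_norml => /andP[h1 h2].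
have y0 : 0 <= y 0 i + n%:Z by rewrite -lerBlDr sub0r.
rewrite inordK; first by rewrite gez0_abs// addrK.
by rewrite ltnS -lez_nat gez0_abs// PoszD lerD2r.
Qed.

Definition HLavg d r (f : 'rV[int]_d -> R) (x : 'rV[int]_d) : R :=
  (#|` fset_set (@lattice_l1ball d r)|%:R)^-1 *
  \sum_(y \in @lattice_l1ball d r) f (x - y).

(* The supremum is taken in [\bar R], so that no boundedness is presupposed. *)
Definition HLmax d E (f : 'rV[int]_d -> R) (x : 'rV[int]_d) : \bar R :=
  ereal_sup [set `|HLavg r f x|%:E | r in E].

Definition lpnorm d p (g : 'rV[int]_d -> \bar R) : \bar R :=
  poweR (\esum_(x in [set: 'rV[int]_d]) poweR `|g x|%E p) p^-1.

Definition in_lp d p (f : 'rV[int]_d -> R) : Prop :=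
  (lpnorm p (EFin \o f) < +oo)%E.

End HardyLittlewood.

(* Main.v *)
Require Import Defs.
From mathcomp Require Import all_boot all_order all_algebra all_fingroup.
From mathcomp Require Import polyrcf.
From mathcomp Require Import reals sequences exp trigo.
From mathcomp Require Import ring lra zify.
Set Implicit Arguments.
Unset Strict Implicit.
Unset Printing Implicit Defensive.
Import Order.TTheory GRing.Theory Num.Theory.
Local Open Scope ring_scope.

(* Jensen's inequality, (M_R f)^(p/2) <= M_R (f^(p/2)) for f >= 0, reduces the bound to p = 2.  A choice
of radius at finitely many lattice points only sees finitely many values of f, so it suffices to work on
a large discrete torus, where M_R is diagonal in the Fourier basis: its multiplier at xi is the average
of prod_i cos(n_i xi_i).  Put x = (1/d) sum_i sin^2(xi_i/2).

Each M_R, R = 2^n, is compared with a power of a Markov operator: the simple random walk (multiplier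
1 - 2x) run for time R when 8R <= d, and the lazy walk (multiplier 1 - x) run for an even time about
2R^2/d when R >= d; the at most three remaining radii are estimated by brute force.  The maximal function
of the even powers is bounded by a dual form of Rota's argument.  The difference of the multipliers at
scale R is controlled by min(q, 1/q) with q a geometric progression in R, so that the square function of
the differences is bounded on l^2 uniformly in d.

For small q this is a second moment computation.  The decay for large q has two sources.  If R >= d, then
either one frequency is large, and the Dirichlet kernel in that coordinate suffices, or many coordinates
of size about R/d contribute, and a permutation average together with Maclaurin's inequality gives
the decay.  If 8R <= d, then a typical point of the sphere has at least R/2 coordinates equal to +-1;
conditionally on the others, the multiplier is a normalised elementary symmetric mean of cosines,
and the normalised means q_j = e_j / binomial(n, j) satisfy q_j^2 <= (j q_1^2 - (j-1) q_2)^j by Rolle's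
theorem and AM-GM, which makes them exponentially small. *)

(** * Newton and Maclaurin inequalities via Rolle *)

(** All points of an $\ell^1$ sphere of radius R have coordinate sums of the parity of R. For even R
    the sphere multiplier is therefore invariant under xi -> pi - xi, that is x -> 1 - x, and is
    close to 1 again near x = 1. A lazy walk would miss this second peak, so for 8R <= d the model
    is the simple random walk at even times; this is where radii 2^n with n >= 1 matter. For R >= d
    the ball mixes both parities, the peak at x = 1 is gone, and laziness is right.

    The times come from matching second moments: a coordinate has mean square about R/d when R is
    small against d, and (R/d)^2 when R >= d; one step of either walk moves it by about 1/d. Even
    powers are forced by Rota's argument, which factors T^(2t) as T^t T^t.

    The comparison takes place on the dual side: after the supremum is linearised by a choice of
    radius at each point, the estimate concerns sums of M_n g_n with g_n >= 0. These are linear in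
    M_n, so each M_n may be split into a Markov power and a diagonal error, and Cauchy-Schwarz in n
    at each frequency handles the errors. *)

Section RealRooted.
Variable F : rcfType.
Implicit Types (s t u v : seq F) (p : {poly F}).

Let Pi s : {poly F} := \prod_(x <- s) ('X - x%:P).

(** Rolle zeros lie strictly between consecutive roots. The last clause keeps them apart from the
    zeros that the derivative inherits from multiple roots, so that both kinds can be counted
    together. *)
Lemma rolle_path (p : {poly F}) (x : F) u :
  path <%R x u -> all (root p) (x :: u) ->
  exists t, [/\ size t = size u, path <%R x t, all (root p^`()) t
    & all (fun y => y \notin x :: u) t].
Proof.
elim: u x => [|y u IHu] x /=; first by move=> _ _; exists [::].
move=> /andP[xy yu] /and3P[px py pu].
have [|c cxy c0] := @poly_rolle _ x y p xy.
  by rewrite (rootP px) (rootP py).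
have [|t [st yt rt nt]] := IHu y yu; first by rewrite /= py.
move: cxy; rewrite in_itv /= => /andP[xc cy].
have gt_y z : z \in u -> y < z by move=> zu; have /allP := order_path_min lt_trans yu; apply.
have gt_t z : z \in t -> y < z by move=> zu; have /allP := order_path_min lt_trans yt; apply.
exists (c :: t); split => /=.
- by rewrite st.
- rewrite xc /=; case: t yt {st rt nt gt_t} => //= a t /andP[ya ->].
  by rewrite (lt_trans cy ya).
- by rewrite /root c0 eqxx.
- apply/andP; split.
    rewrite !inE !negb_or gt_eqF // lt_eqF //=.
    by apply/negP => /gt_y; rewrite ltNge (ltW cy).
  apply/allP => z zt; rewrite inE negb_or (allP nt) // andbT.
  by rewrite gt_eqF // (lt_trans xy) // gt_t.
Qed.

(** Each term of the derivative lacks one factor ['X - a], which [p] supplies. This replaces an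
    argument with root multiplicities. *)
Lemma dvdp_mul_deriv_prod (p : {poly F}) v :
  all (root p) v -> Pi v %| p * (Pi v)^`().
Proof.
rewrite /Pi; elim: v => [|a v IHv] /=; first by rewrite big_nil dvd1p.
move=> /andP[pa /IHv dv]; rewrite big_cons derivM derivXsubC mul1r mulrDr.
rewrite dvdp_add //; first by rewrite dvdp_mul // dvdp_XsubCl.
by rewrite mulrCA dvdp_mul.
Qed.

(** Split [s] into its distinct values [u] and the surplus copies [v]. The derivative is divisible
    by [Pi v], and the cofactor has degree at most [size u - 1], so the Rolle zeros exhaust it. The
    clause on lower bounds carries nonnegative roots through to Maclaurin's inequality. *)
Lemma deriv_prod_XsubC s : exists s', [/\ size s' = (size s).-1,
  (Pi s)^`() = (size s)%:R *: Pi s'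
  & forall m : F, all (>= m) s -> all (>= m) s'].
Proof.
have [->|s0] := eqVneq s [::].
  by exists [::]; split => //; rewrite /Pi !big_nil scale0r derivC.
have [v /= sv] := perm_to_subseq (undup_subseq s).
pose u := sort <=%R (undup s).
have {}sv : perm_eq s (u ++ v).
  by apply: (perm_trans sv); rewrite perm_cat2r perm_sym perm_sort.
have vu : {subset v <= u}.
  by move=> y yv; rewrite mem_sort mem_undup (perm_mem sv) mem_cat yv orbT.
have su : {subset u <= s} by move=> y; rewrite mem_sort mem_undup.
have uu : uniq u by rewrite sort_uniq undup_uniq.
have suS : sorted <%R u.
  by rewrite lt_sorted_uniq_le uu sort_le_sorted.
have u0 : u != [::].
  case: s s0 @u sv vu su uu suS => [|a s] // _ u _ _ _ _ _.
  by apply/eqP => u0; have: a \in u; [rewrite mem_sort mem_undup inE eqxx | rewrite u0].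
case Eu : u u0 => [//|x w] _.
have defP : Pi s = Pi u * Pi v by rewrite /Pi (perm_big _ sv) big_cat.
have mP y : (Pi y) \is monic by apply: monic_prod_XsubC.
have szP y : size (Pi y) = (size y).+1 by rewrite size_prod_XsubC.
have [H PH] : exists H, (Pi s)^`() = H * Pi v.
  have /dvdpP[H ->] : Pi v %| (Pi s)^`(); last by exists H.
  rewrite defP derivM; apply: dvdp_add; first by apply: dvdp_mull.
  apply: dvdp_mul_deriv_prod.
  by apply/allP => y /vu; rewrite root_prod_XsubC.
have [||t [st xt rt nt]] := @rolle_path (Pi s) x w.
- by move: suS; rewrite Eu.
- by rewrite -Eu; apply/allP => y /su; rewrite root_prod_XsubC.
have szs : size s = (size w + size v).+1.
  by rewrite (perm_size sv) size_cat Eu.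
have ds : ((Pi s)^`())`_(size s).-1 = (size s)%:R.
  rewrite coef_deriv prednK ?lt0n ?size_eq0 //.
  by have /monicP := mP s; rewrite lead_coefE szP /= => ->.
have dn0 : (Pi s)^`() != 0.
  apply: contraNneq (_ : ((Pi s)^`())`_(size s).-1 != 0); first by move=> ->; rewrite coef0.
  by rewrite ds pnatr_eq0 size_eq0.
have H0 : H != 0 by apply: contraNneq dn0; rewrite PH => ->; rewrite mul0r.
have szd : (size ((Pi s)^`()) <= size s)%N.
  by have := lt_size_deriv (_ : Pi s != 0); rewrite szP ltnS; apply; rewrite monic_neq0.
have szH : (size H <= (size t).+1)%N.
  by move: szd; rewrite PH size_Mmonic // szP szs st addnS /= -addSn leq_add2r.
have tH : all (root H) t.
  apply/allP => y yt; have /rootP := allP rt _ yt; rewrite PH hornerM => /eqP.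
  rewrite mulf_eq0 => /orP[//|/eqP/rootP]; rewrite root_prod_XsubC => /vu.
  by rewrite Eu (negPf (allP nt _ yt)).
have ut : uniq t.
  by have := path_sorted xt; rewrite lt_sorted_uniq_le => /andP[].
have szH' : size H = (size t).+1.
  apply/eqP; rewrite eqn_leq szH /= max_poly_roots //.
have HE : H = lead_coef H *: Pi t.
  by apply: all_roots_prod_XsubC; rewrite // uniq_rootsE.
exists (t ++ v); split.
- by rewrite size_cat szs st.
- have E : (Pi s)^`() = lead_coef H *: Pi (t ++ v).
    by rewrite PH {1}HE -scalerAl /Pi big_cat.
  rewrite E; congr (_ *: _); rewrite -ds E coefZ.
  have /monicP := mP (t ++ v); rewrite lead_coefE szP /= size_cat st szs /= => ->.
  by rewrite mulr1.
- move=> m /allP ms; apply/allP => y; rewrite mem_cat => /orP[yt|/vu/su/ms //].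
  have mx : m <= x by apply/ms/su; rewrite Eu inE eqxx.
  by have /allP /(_ _ yt) := order_path_min lt_trans xt => /ltW; apply: le_trans.
Qed.

(* [(-1)^i] times the [i]-th elementary symmetric mean of [s]. *)
Definition esmean s i : F := (Pi s)`_(size s - i) / 'C(size s, i)%:R.

(** Differentiation multiplies the coefficients by factors that the binomial normalisation absorbs
    exactly, so the critical points have the same symmetric means as the roots. *)
Lemma esmean_deriv s n : size s = n.+1 -> exists s', [/\ size s' = n,
  forall i, (i <= n)%N -> esmean s' i = esmean s i
  & forall m : F, all (>= m) s -> all (>= m) s'].
Proof.
move=> sn; have [s' [ss' ds ms]] := deriv_prod_XsubC s.
have s'n : size s' = n by rewrite ss' sn.
exists s'; split => // i lein; rewrite /esmean s'n sn.
have := congr1 (fun p : {poly F} => p`_(n - i)) ds.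
rewrite coef_deriv coefZ -subSn // sn => E.
have b1 : ('C(n, i)%:R : F) != 0 by rewrite pnatr_eq0 -lt0n bin_gt0.
have b2 : ('C(n.+1, i)%:R : F) != 0 by rewrite pnatr_eq0 -lt0n bin_gt0 leqW.
apply/eqP; rewrite eqr_div //.
have n1 : (n.+1%:R : F) != 0 by rewrite pnatr_eq0.
apply/eqP/(mulfI n1); rewrite [LHS]mulrA -E -[_ *+ _]mulr_natr.
rewrite -[LHS]mulrA [RHS]mulrCA; congr (_ * _).
by rewrite -!natrM -(mul_bin_down n.+1).
Qed.

(** With only [j] numbers left, the mean of index [j] is their product up to sign, and inequalities
    between means become AM-GM. *)
Lemma esmean_reduce s j : (j <= size s)%N -> exists s', [/\ size s' = j,
  forall i, (i <= j)%N -> esmean s' i = esmean s i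
  & forall m : F, all (>= m) s -> all (>= m) s'].
Proof.
move=> js; have [k] : exists k, size s = (k + j)%N by exists (size s - j)%N; rewrite subnK.
elim: k s {js} => [|k IHk] s sk; first by exists s; split.
have [s1 [ss1 e1 m1]] := esmean_deriv sk.
have [s2 [ss2 e2 m2]] := IHk _ ss1.
exists s2; split => // [i ij|m /m1/m2 //].
by rewrite e2 // e1 // (leq_trans ij) // leq_addl.
Qed.

Lemma esmean1 s : s != [::] -> esmean s 1 = - (\sum_(x <- s) x) / (size s)%:R.
Proof. by move=> s0; rewrite /esmean bin1 subn1 coefPn_prod_XsubC // size_eq0. Qed.

Lemma coef_prod_XsubC2 s : (1 < size s)%N ->
  (Pi s)`_(size s - 2) *+ 2 = (\sum_(x <- s) x) ^+ 2 - \sum_(x <- s) x ^+ 2.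
Proof.
elim: s => [//|a s IHs] /=; rewrite ltnS => s0.
rewrite subn2 /= /Pi big_cons !big_cons mulrBl coefB coefXM coefCM.
have [s1|s1] := ltnP 1 (size s).
  have -> : ((size s).-1 == 0)%N = false by case: (size s) s1 => [|[]].
  have := IHs s1; rewrite subn2 => E; rewrite mulrnBl E.
  rewrite coefPn_prod_XsubC ?size_eq0 -?size_eq0 -?lt0n //.
  ring.
have {s0 s1} : size s = 1%N by apply/eqP; rewrite eqn_leq s0 s1.
case: s {IHs} => [//|b [|//]] _ /=.
by rewrite !big_seq1 /= coefD coefX coefN coefC /=; ring.
Qed.

Lemma prod_seq_AGM t : all (>= 0) t -> t != [::] ->
  \prod_(x <- t) x <= ((\sum_(x <- t) x) / (size t)%:R) ^+ size t.
Proof.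
move=> /allP t0 _; rewrite !(big_nth (0 : F)) !big_mkord.
have := @leif_AGM F 'I_(size t) predT (fun i => nth 0 t i).
rewrite cardT size_enum_ord => /(_ _) H; apply: H => i _.
by apply/t0/mem_nth.
Qed.

Lemma esmean_self s : `|esmean s (size s)| = \prod_(x <- s) `|x|.
Proof.
rewrite /esmean subnn binn divr1 coef0_prod_XsubC normrM normrX normrN1 expr1n.
by rewrite mul1r normr_prod.
Qed.

(** On the [j] reduced numbers, AM-GM applies to the squares; their mean (e_1^2 - 2 e_2) / j is the
    base on the right. *)
Lemma esmean_sqr_le s j : (0 < j <= size s)%N ->
  esmean s j ^+ 2 <= (j%:R * esmean s 1 ^+ 2 - (j%:R - 1) * esmean s 2) ^+ j.
Proof.
move=> /andP[j0 js]; have [t [tj te _]] := esmean_reduce js.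
have t0 : t != [::] by rewrite -size_eq0 tj -lt0n.
have jR : (j%:R : F) != 0 by rewrite pnatr_eq0 -lt0n.
rewrite -te // -te //.
(* The mean of index 2 only makes sense for [j >= 2]; at [j = 1] its coefficient vanishes. *)
have [j1|j1] := eqVneq j 1%N; first by rewrite j1 subrr mul0r subr0 mul1r expr1.
have j2 : (2 <= j)%N by lia.
rewrite -te //.
have -> : esmean t j ^+ 2 = \prod_(x <- [seq x ^+ 2 | x <- t]) x.
  rewrite -(real_normK (num_real _)) -tj esmean_self -prodrXl big_map.
  by apply: eq_bigr => x _; rewrite real_normK // num_real.
apply: le_trans (prod_seq_AGM _ _) _.
- by apply/allP => _ /mapP[x _ ->]; rewrite sqr_ge0.
- by rewrite -size_eq0 size_map size_eq0.
rewrite size_map tj big_map le_eqVlt; apply/orP; left; apply/eqP; congr (_ ^+ _).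
rewrite esmean1 // /esmean tj.
have := @coef_prod_XsubC2 t; rewrite tj => /(_ j2) E.
have -> : \sum_(x <- t) x ^+ 2 = (\sum_(x <- t) x) ^+ 2 - (Pi t)`_(j - 2) *+ 2.
  by rewrite E; ring.
have E2 : 'C(j, 2)%:R = j%:R * (j%:R - 1) / 2 :> F.
  have := mul_bin_left j 1; rewrite bin1 => /(congr1 (fun n => n%:R : F)).
  rewrite !natrM natrB // => E2; apply: (mulfI (_ : (2 : F) != 0)).
    by rewrite pnatr_eq0.
  by rewrite E2; field.
have j1R : (j%:R - 1 : F) != 0 by rewrite subr_eq0 pnatr_eq1.
by rewrite E2; field; rewrite jR j1R.
Qed.

Lemma maclaurin s j : all (>= 0) s -> (0 < j <= size s)%N ->
  `|esmean s j| <= ((\sum_(x <- s) x) / (size s)%:R) ^+ j.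
Proof.
move=> s_ge0 /andP[j0 js]; have [t [tj te tm]] := esmean_reduce js.
have t0 : t != [::] by rewrite -size_eq0 tj -lt0n.
have s0 : s != [::] by rewrite -size_eq0 -lt0n (leq_trans j0).
have t_ge0 := tm 0 s_ge0.
have -> : (\sum_(x <- s) x) / (size s)%:R = (\sum_(x <- t) x) / (size t)%:R.
  by apply: oppr_inj; rewrite -!mulNr -!esmean1 // te.
rewrite -te // -{1}tj esmean_self big_seq (eq_bigr id).
  by rewrite -big_seq -tj; apply: prod_seq_AGM.
by move=> x xt; rewrite ger0_norm //; exact: (allP t_ge0).
Qed.

Variable I : finType.
Implicit Types (C A T : {set I}) (c b : I -> F).

Lemma coef_prod_set C c j : (j <= #|C|)%N ->
  (\prod_(i in C) ('X - (c i)%:P))`_(#|C| - j) =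
  (-1) ^+ j * \sum_(A : {set I} | (A \subset C) && (#|A| == j)) \prod_(i in A) c i.
Proof.
move=> jC.
pose f i : {poly F} := if i \in C then - (c i)%:P else 0.
pose g i : {poly F} := if i \in C then 'X else 1.
have -> : \prod_(i in C) ('X - (c i)%:P) = \prod_i (f i + g i).
  rewrite big_mkcond; apply: eq_bigr => i _; rewrite /f /g.
  by case: ifP => _; rewrite ?add0r // addrC.
rewrite bigA_distr coef_sum mulr_sumr.
rewrite [RHS]big_mkcond; apply: eq_bigr => A _ /=.
have [AC|/subsetPn[i iA iC]] := boolP (A \subset C); last first.
  by rewrite (bigD1 i) //= iA /f (negPf iC) mul0r coef0.
have -> : \prod_i (if i \in A then f i else g i) =
    ((-1) ^+ #|A| * \prod_(i in A) c i)%:P * 'X^(#|C| - #|A|).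
  rewrite (bigID (mem A)) /=; congr (_ * _).
    rewrite -prodrN rmorph_prod; apply: eq_bigr => i iA.
    by rewrite iA /f (subsetP AC) // raddfN.
  rewrite -(cardsID A C) (setIidPr AC) addKn.
  rewrite (eq_bigr g); last by move=> i /negPf ->.
  rewrite -prodr_const [RHS]big_mkcond [LHS]big_mkcond; apply: eq_bigr => i _.
  by rewrite /g inE; case: (i \in A); case: (i \in C).
rewrite coefCM coefXn.
have AC' := subset_leq_card AC.
have -> : (#|C| - j == #|C| - #|A|)%N = (#|A| == j) by apply/eqP/eqP; lia.
by case: eqP => [->|_]; rewrite ?mulr1 ?mulr0.
Qed.

Lemma esmean_set C c j : (j <= #|C|)%N ->
  `|\sum_(A : {set I} | (A \subset C) && (#|A| == j)) \prod_(i in A) c i| =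
  'C(#|C|, j)%:R * `|esmean [seq c i | i <- enum C] j|.
Proof.
move=> jC; have sC : size [seq c i | i <- enum C] = #|C| by rewrite size_map cardE.
rewrite /esmean sC /Pi big_map big_enum /= coef_prod_set // normrM normrM normrX.
rewrite normrN1 expr1n mul1r normfV normr_nat mulrCA mulfV ?mulr1 //.
by rewrite pnatr_eq0 -lt0n bin_gt0.
Qed.

Lemma esym_nonneg_le T b j : (forall i, 0 <= b i) -> (0 < j <= #|T|)%N ->
  \sum_(A : {set I} | (A \subset T) && (#|A| == j)) \prod_(i in A) b i <=
  'C(#|T|, j)%:R * ((\sum_(i in T) b i) / #|T|%:R) ^+ j.
Proof.
move=> b0 /andP[j0 jT]; apply: le_trans (ler_norm _) _; rewrite esmean_set //.
apply: ler_wpM2l => //.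
have := @maclaurin [seq b i | i <- enum T] j.
rewrite size_map -cardE j0 jT big_map big_enum /=; apply => //.
by apply/allP => _ /mapP[i _ ->].
Qed.

(** Let n be the size of [C] and m the mean of [c]. Since the squares sum to at most n, the base of
    [esmean_sqr_le] is at most a convex combination of m^2 and 1 in which 1 has weight (j - 1)/(n -
    1). This is at most 1/2 because 2j <= n. *)
Lemma esym_sqr_le C c j : (forall i, `|c i| <= 1) -> (0 < j)%N -> (j.*2 <= #|C|)%N ->
  (\sum_(A : {set I} | (A \subset C) && (#|A| == j)) \prod_(i in A) c i) ^+ 2 <=
  'C(#|C|, j)%:R ^+ 2 *
    (1 - (1 - ((\sum_(i in C) c i) / #|C|%:R) ^+ 2) / 2) ^+ j.
Proof.
move=> c1 j0 jC; have jC' : (j <= #|C|)%N by lia.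
have n2 : (2 <= #|C|)%N by lia.
rewrite -(real_normK (num_real (\sum_(_ | _) _))) esmean_set // exprMn real_normK ?num_real //.
apply: ler_wpM2l; first exact: sqr_ge0.
set s := [seq _ | _ <- _]; have sC : size s = #|C| by rewrite size_map cardE.
have s0 : s != [::] by rewrite -size_eq0 sC -lt0n; lia.
apply: le_trans (esmean_sqr_le _) _; first by rewrite sC j0 jC'.
set m := _ / #|C|%:R.
have e1 : esmean s 1 = - m by rewrite esmean1 // sC big_map big_enum mulNr.
have nR : 2 <= #|C|%:R :> F by rewrite ler_nat.
have jR : 2 * j%:R <= #|C|%:R :> F by rewrite -natrM ler_nat mul2n.
have j1R : 1 <= j%:R :> F by rewrite ler1n.
have e2 : esmean s 2 = ((#|C|%:R * m) ^+ 2 - \sum_(i in C) c i ^+ 2) / (#|C|%:R * (#|C|%:R - 1)).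
  have := coef_prod_XsubC2 (s := s); rewrite sC => /(_ n2).
  rewrite /esmean sC !big_map !big_enum /= => E.
  have -> : #|C|%:R * m = \sum_(i in C) c i by rewrite /m mulrC divfK // gt_eqF //; lra.
  rewrite -E.
  have := mul_bin_left #|C| 1; rewrite bin1 => /(congr1 (fun n => n%:R : F)).
  rewrite !natrM natrB ?(leq_trans _ n2) // => E2.
  have -> : #|C|%:R * (#|C|%:R - 1) = 2 * 'C(#|C|, 2)%:R :> F by rewrite E2 mulrC.
  have : 'C(#|C|, 2)%:R != 0 :> F by rewrite pnatr_eq0 -lt0n bin_gt0.
  by move=> ?; field.
have c2 : \sum_(i in C) c i ^+ 2 <= #|C|%:R.
  rewrite -sumr_const; apply: ler_sum => i _.
  by rewrite -(real_normK (num_real _)) expr_le1.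
rewrite e1 e2; set S := \sum_(i in C) c i ^+ 2 in c2 *.
set n := #|C|%:R in nR jR c2 *; set J := j%:R in jR j1R *.
have S0 : 0 <= S by apply: sumr_ge0 => i _; rewrite sqr_ge0.
have m1 : m ^+ 2 <= 1.
  rewrite -(real_normK (num_real _)) expr_le1 // /m normrM normfV normr_nat //.
  rewrite ler_pdivrMr ?mul1r; last by rewrite -/n; lra.
  apply: le_trans (ler_norm_sum _ _ _) _; rewrite -sumr_const; exact: ler_sum.
have m0 := sqr_ge0 m.
clear e1 e2; clearbody n J S m; clear jC jC' n2 sC.
have BE : J * (- m) ^+ 2 - (J - 1) * (((n * m) ^+ 2 - S) / (n * (n - 1))) =
    (n * m ^+ 2 * (n - J) + (J - 1) * S) / (n * (n - 1)).
  have n_neq0 : n != 0 by rewrite gt_eqF //; lra.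
  have n1_neq0 : n - 1 != 0 by rewrite gt_eqF //; lra.
  by field; rewrite n_neq0 n1_neq0.
have nn : 0 < n * (n - 1) by apply: mulr_gt0; lra.
rewrite BE; apply: lerXn2r; rewrite ?nnegrE //.
- apply: divr_ge0; last exact: ltW.
  have h3 : 0 <= n * m ^+ 2 * (n - J) by do 2?apply: mulr_ge0; lra.
  have h4 : 0 <= (J - 1) * S by apply: mulr_ge0; lra.
  exact: addr_ge0.
- lra.
rewrite ler_pdivrMr //.
have h1 : (J - 1) * S <= (J - 1) * n by apply: ler_wpM2l; lra.
have h2 : 0 <= n * (1 - m ^+ 2) * (n - 2 * J + 1) by apply: mulr_ge0; [apply: mulr_ge0|]; lra.
nra.
Qed.

End RealRooted.

(** * Averages of products over permutations *)

Section PermutationAverage.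
Variables (F : rcfType) (I : finType).
Implicit Types (A T : {set I}) (b : I -> F).

Lemma perm_set_trans (A B : {set I}) : #|A| = #|B| -> exists s : {perm I}, s @: A = B.
Proof.
move=> AB.
have CAB : #|~: A| = #|~: B| by have := cardsC A; have := cardsC B; lia.
pose eA := enum A ++ enum (~: A); pose eB := enum B ++ enum (~: B).
have szE (X : {set I}) : size (enum X ++ enum (~: X)) = #|I|.
  by rewrite size_cat -!cardE cardsC.
have mE (X : {set I}) (x : I) : x \in enum X ++ enum (~: X).
  by rewrite mem_cat !mem_enum inE orbN.
have uE (X : {set I}) : uniq (enum X ++ enum (~: X)).
  rewrite cat_uniq !enum_uniq andbT /=; apply/hasPn => x.
  by rewrite !mem_enum inE.
pose f x := nth x eB (index x eA).
have fi : injective f.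
  move=> x y; rewrite /f => E.
  have ix z : (index z eA < size eB)%N by rewrite szE -(szE A) index_mem mE.
  apply: (index_inj x (mE A x) (mE A y)); apply/eqP.
  by rewrite -(nth_uniq x _ _ (uE B)) ?ix // E; apply/eqP; exact: set_nth_default.
exists (perm fi); apply/eqP; rewrite eqEcard card_imset ?AB ?leqnn ?andbT; last exact: perm_inj.
apply/subsetP => _ /imsetP[x xA ->]; rewrite permE /f /eA index_cat mem_enum xA.
have ix : (index x (enum A) < size (enum B))%N by rewrite -cardE -AB cardE index_mem mem_enum.
by rewrite nth_cat ix -mem_enum mem_nth.
Qed.

(** Every set of the size of [T] is the image of [T] under equally many permutations, so the average
    is an elementary symmetric mean and Maclaurin's inequality applies. *)
Lemma perm_avg_le (T : {set I}) b : (forall i, 0 <= b i) ->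
  \sum_(s : {perm I}) \prod_(i in T) b (s i) <=
  #|{perm I}|%:R * ((\sum_i b i) / #|I|%:R) ^+ #|T|.
Proof.
move=> b0.
have [->|T0] := eqVneq T set0.
  rewrite cards0 expr0 mulr1 -sum1_card natr_sum le_eqVlt.
  by apply/orP; left; apply/eqP/eq_bigr => s _; rewrite big_set0.
pose G (A : {set I}) := \prod_(i in A) b i.
pose K A := #|[set s : {perm I} | s @: T == A]|.
have KE A : #|A| = #|T| -> K A = K T.
  have mE (s r : {perm I}) : (s * r)%g @: T = r @: (s @: T).
    by rewrite -imset_comp; apply: eq_imset => x /=; rewrite permM.
  move=> AT; have [r rE] := perm_set_trans AT.
  rewrite /K -[RHS](card_imset _ (@mulIg _ r^-1)%g); apply: eq_card => s.
  apply/idP/imsetP => [|[q]]; rewrite !inE => /eqP sE.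
    by exists (s * r)%g; rewrite ?inE ?mulgK // mE sE rE.
  move=> ->; rewrite mE sE -rE -imset_comp -[X in _ == X]imset_id.
  by apply/eqP; apply: eq_imset => x /=; rewrite permK.
have sumE (H : {set I} -> F) : \sum_(s : {perm I}) H (s @: T) =
    (K T)%:R * \sum_(A : {set I} | #|A| == #|T|) H A.
  rewrite (partition_big (fun s : {perm I} => s @: T) (fun A => #|A| == #|T|)) /=.
    rewrite mulr_sumr; apply: eq_bigr => A /eqP AT.
    rewrite (eq_bigr (fun=> H A)) => [|s /eqP-> //].
    rewrite sumr_const -(KE A) // mulr_natl; congr (_ *+ _).
    by apply: eq_card => s; rewrite !inE.
  by move=> s _; rewrite card_imset //; exact: perm_inj.
have -> : \sum_(s : {perm I}) \prod_(i in T) b (s i) = \sum_(s : {perm I}) G (s @: T).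
  by apply: eq_bigr => s _; rewrite /G big_imset //= => x y _ _; apply: perm_inj.
have cardE' : #|{perm I}|%:R = (K T)%:R * 'C(#|I|, #|T|)%:R :> F.
  have := sumE (fun=> 1); rewrite !sumr_const => ->; congr (_ * _%:R).
  by rewrite -card_draws; apply: eq_card => A; rewrite !inE.
rewrite sumE cardE' -mulrA; apply: ler_wpM2l => //.
have := @esym_nonneg_le F I [set: I] b #|T| b0; rewrite cardsT max_card card_gt0 T0.
move=> /(_ isT).
rewrite (eq_bigl (fun A : {set I} => #|A| == #|T|)); last first.
  by move=> A; rewrite subsetT.
suff -> : \sum_(i in [set: I]) b i = \sum_i b i by [].
by apply: eq_bigl => i; rewrite inE.
Qed.

End PermutationAverage.

(** * Counting lattice points of cross-polytopes *)

Section Counting.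
Variables (R : realType) (d K : nat).
Local Notation point := {ffun 'I_d -> 'I_K.+1}.
Implicit Types (n : point) (i : 'I_d) (h : nat -> R).

(* A point [n] stands for the [weight n] lattice points [y] with [|y_i| = n_i]. *)
Definition wt (u : nat) : R := if u == 0%N then 1 else 2.
Definition weight (n : point) : R := \prod_i wt (n i).
Definition norm1 (n : point) : nat := (\sum_i n i)%N.
Definition set_coord (n : point) i (u : 'I_K.+1) : point := [ffun j => if j == i then u else n j].
Definition sphere_mass k : R := \sum_(n : point | norm1 n == k) weight n.
Definition ball_mass k : R := \sum_(n : point | (norm1 n <= k)%N) weight n.
Definition slice_mass i k : R := \sum_(n : point | (n i == ord0) && (norm1 n <= k)%N) weight n.

Lemma wt_ge1 u : 1 <= wt u. Proof. by rewrite /wt; case: ifP => _; lra. Qed.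

Lemma weight_ge1 n : 1 <= weight n.
Proof.
rewrite /weight; elim/big_ind: _ => // [x y x1 y1|i _]; last exact: wt_ge1.
by rewrite -[1]mulr1 ler_pM.
Qed.

Lemma weight_ge0 n : 0 <= weight n.
Proof. by have := weight_ge1 n; lra. Qed.

Lemma ball_ge0 k : 0 <= ball_mass k.
Proof. by apply: sumr_ge0 => n _; apply: weight_ge0. Qed.

Lemma sphere_ge0 k : 0 <= sphere_mass k.
Proof. by apply: sumr_ge0 => n _; apply: weight_ge0. Qed.

Lemma ball_ge1 k : 1 <= ball_mass k.
Proof.
rewrite /ball_mass (bigD1 [ffun=> ord0]) /=; last first.
  by rewrite /norm1 big1 // => i _; rewrite ffunE.
rewrite -[1]addr0; apply: lerD; first exact: weight_ge1.
by apply: sumr_ge0 => n _; apply: weight_ge0.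
Qed.

Lemma set_coordE n i u : set_coord n i u i = u.
Proof. by rewrite ffunE eqxx. Qed.

Lemma set_coord_id n i : set_coord n i (n i) = n.
Proof. by apply/ffunP => j; rewrite ffunE; case: eqP => // ->. Qed.

Lemma set_coord_set_coord n i u v : set_coord (set_coord n i u) i v = set_coord n i v.
Proof. by apply/ffunP => j; rewrite !ffunE; case: eqP. Qed.

Lemma norm1_set_coord n i u : n i = ord0 -> norm1 (set_coord n i u) = (norm1 n + u)%N.
Proof.
move=> ni; rewrite /norm1 (bigD1 i) //= (bigD1 (P := xpredT) i) //= ni set_coordE add0n addnC.
congr (_ + _)%N; apply: eq_bigr => j ji; by rewrite ffunE (negPf ji).
Qed.

Lemma weight_set_coord n i u : n i = ord0 -> weight (set_coord n i u) = weight n * wt u.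
Proof.
move=> ni; rewrite /weight (bigD1 i) //= [in RHS](bigD1 i) //= ni set_coordE mul1r mulrC.
congr (_ * _); apply: eq_bigr => j ji; by rewrite ffunE (negPf ji).
Qed.

Lemma coord_split i (G : point -> R) :
  \sum_(n : point) G n = \sum_(n : point | n i == ord0) \sum_u G (set_coord n i u).
Proof.
rewrite (partition_big (fun n => set_coord n i ord0) (fun n => n i == ord0)) /=; last first.
  by move=> n _; rewrite set_coordE.
apply: eq_bigr => n /eqP ni.
rewrite (reindex_onto (fun u => set_coord n i u) (fun m => m i)) /=.
  apply: eq_bigl => u; rewrite set_coordE eqxx andbT set_coord_set_coord.
  by apply/eqP; rewrite -{2}(set_coord_id n i) ni.
by move=> m /eqP <-; rewrite set_coord_set_coord set_coord_id.
Qed.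

(** A line in direction [i] meets the sphere at the single absolute value [k - norm1 n]; the bound
    [k <= K] keeps [inord] away from its default. *)
Lemma sphere_split i k (H : point -> R) : (k <= K)%N ->
  \sum_(n : point | norm1 n == k) weight n * H n =
  \sum_(n : point | (n i == ord0) && (norm1 n <= k)%N)
     weight n * (wt (k - norm1 n) * H (set_coord n i (inord (k - norm1 n)))).
Proof.
move=> kK; rewrite big_mkcond /= (coord_split i) [RHS]big_mkcondr /=.
apply: eq_bigr => n /eqP ni.
have [lk|lk] := leqP (norm1 n) k; last first.
  by rewrite big1 // => u _; rewrite norm1_set_coord //; case: eqP => // E; lia.
have ik : (inord (k - norm1 n) : 'I_K.+1) = (k - norm1 n)%N :> nat by rewrite inordK //; lia.
rewrite (bigD1 (inord (k - norm1 n))) //= norm1_set_coord // ik subnKC // eqxx weight_set_coord // ik mulrA.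
rewrite big1 ?addr0 // => u uk; rewrite norm1_set_coord //; case: eqP => // E.
by case/eqP: uk; apply: val_inj; rewrite /= ik; lia.
Qed.

Lemma ball_split i k (H : point -> R) :
  \sum_(n : point | (norm1 n <= k)%N) weight n * H n =
  \sum_(n : point | (n i == ord0) && (norm1 n <= k)%N)
     weight n * \sum_(u : 'I_K.+1 | (u <= k - norm1 n)%N) wt u * H (set_coord n i u).
Proof.
rewrite big_mkcond /= (coord_split i) [RHS]big_mkcondr /=.
apply: eq_bigr => n /eqP ni.
have [lk|lk] := leqP (norm1 n) k; last first.
  by rewrite big1 // => u _; rewrite norm1_set_coord //; case: leqP => // E; lia.
rewrite mulr_sumr [RHS]big_mkcond /=; apply: eq_bigr => u _.
rewrite norm1_set_coord // weight_set_coord // -leq_subRL //.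
by case: ifP; rewrite ?mulrA.
Qed.

Lemma sphere_coord i k h : (k <= K)%N ->
  \sum_(n : point | norm1 n == k) weight n * h (n i) =
  \sum_(n : point | (n i == ord0) && (norm1 n <= k)%N)
     weight n * (wt (k - norm1 n) * h (k - norm1 n)%N).
Proof.
move=> kK; rewrite (sphere_split i) //; apply: eq_bigr => n _.
by rewrite set_coordE inordK //; lia.
Qed.

Lemma ball_coord i k h :
  \sum_(n : point | (norm1 n <= k)%N) weight n * h (n i) =
  \sum_(n : point | (n i == ord0) && (norm1 n <= k)%N)
     weight n * \sum_(u : 'I_K.+1 | (u <= k - norm1 n)%N) wt u * h u.
Proof.
by rewrite (ball_split i); apply: eq_bigr => n _; under eq_bigr do rewrite set_coordE.
Qed.

Lemma slice_le_sphere i k : (k <= K)%N -> slice_mass i k <= sphere_mass k.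
Proof.
move=> kK; have := sphere_coord i (fun=> 1) kK; under eq_bigr do rewrite mulr1.
rewrite /sphere_mass => ->; apply: ler_sum => n _.
by rewrite mulr1 ler_peMr ?wt_ge1 // weight_ge0.
Qed.

Lemma sum_wt q : (q <= K)%N ->
  \sum_(u : 'I_K.+1 | (u <= q)%N) wt u = 1 + 2 * q%:R.
Proof.
move=> qK; transitivity (\sum_(0 <= u < q.+1) wt u).
  rewrite big_mkord (big_ord_widen_cond K.+1 xpredT (fun u => wt u)) //.
rewrite big_nat_recl // {1}/wt eqxx; congr (_ + _).
rewrite (eq_bigr (fun=> 2)) // big_const_nat subn0 iter_addr_0.
by rewrite mulr_natr.
Qed.

(** Checked on each line in direction [i] with remaining radius q: the ball has 1 + 2q points there,
    of which 2q is the first moment on the sphere and 1 is the point of the slice. *)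
Lemma ball_first_moment i k : (k <= K)%N ->
  ball_mass k = \sum_(n : point | norm1 n == k) weight n * (n i)%:R + slice_mass i k.
Proof.
move=> kK; have := ball_coord i k (fun=> 1); under eq_bigr do rewrite mulr1.
rewrite /ball_mass => ->; rewrite (sphere_coord i (fun u => u%:R)) // -big_split /=.
apply: eq_bigr => n /andP[_ nk]; under eq_bigr do rewrite mulr1.
rewrite sum_wt; last by lia.
by rewrite /wt; case: eqP => [->|_]; ring.
Qed.

Lemma sum_coord_norm1 n : \sum_i (n i)%:R = (norm1 n)%:R :> R.
Proof. by rewrite /norm1 natr_sum. Qed.

Lemma ball_sphere_sum k : (k <= K)%N ->
  d%:R * ball_mass k = k%:R * sphere_mass k + \sum_i slice_mass i k.
Proof.
move=> kK.
have -> : d%:R * ball_mass k = \sum_(i < d) ball_mass k by rewrite sumr_const card_ord mulr_natl.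
rewrite (eq_bigr _ (fun i _ => ball_first_moment i kK)) big_split /=; congr (_ + _).
rewrite exchange_big /= /sphere_mass mulr_sumr; apply: eq_bigr => n /eqP <-.
by rewrite -mulr_sumr sum_coord_norm1 mulrC.
Qed.

Lemma slice_ge0 i k : 0 <= slice_mass i k.
Proof. by apply: sumr_ge0 => n _; apply: weight_ge0. Qed.

Lemma sphere_le_ball k : (k <= K)%N -> k%:R * sphere_mass k <= d%:R * ball_mass k.
Proof.
by move=> kK; rewrite ball_sphere_sum // lerDl; apply: sumr_ge0 => i _; apply: slice_ge0.
Qed.

Lemma ball_le_sphere k : (k <= K)%N -> d%:R * ball_mass k <= (k + d)%:R * sphere_mass k.
Proof.
move=> kK; rewrite ball_sphere_sum // natrD mulrDl lerD2l.
rewrite -[d in d%:R]card_ord mulr_natl -sumr_const; apply: ler_sum => i _.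
exact: slice_le_sphere.
Qed.

(** Raising a positive coordinate by one is a weight-preserving bijection between the two index
    sets. The step from 0 to 1 doubles the weight instead and is treated in [sphere_ones]. *)
Lemma sphere_shift i k h : (k < K)%N ->
  \sum_(n : point | norm1 n == k.+1) weight n * (if (1 < n i)%N then h (n i) else 0) =
  \sum_(n : point | norm1 n == k) weight n * (if (0 < n i)%N then h (n i).+1 else 0).
Proof.
move=> kK; rewrite (sphere_coord i (fun u => if (1 < u)%N then h u else 0)) //.
rewrite (sphere_coord i (fun u => if (0 < u)%N then h u.+1 else 0)) ?(ltnW kK) //.
rewrite big_mkcondr [RHS]big_mkcondr /=; apply: eq_bigr => n _.
have [lk|lk] := leqP (norm1 n) k; last first.
  by case: ifP => // lk'; rewrite (_ : (k.+1 - norm1 n) = 0)%N ?mulr0 //; lia.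
rewrite (leqW lk) subSn // ltnS.
have [->|] := eqVneq (k - norm1 n)%N 0%N; first by rewrite !mulr0.
by rewrite /wt => /negPf->.
Qed.

Lemma sphere_ones i k : (k < K)%N ->
  \sum_(n : point | norm1 n == k.+1) weight n * (n i == 1 :> nat)%:R =
  2 * \sum_(n : point | norm1 n == k) weight n * (n i == 0 :> nat)%:R.
Proof.
move=> kK; rewrite (sphere_coord i (fun u => (u == 1)%N%:R)) //.
rewrite (sphere_coord i (fun u => (u == 0)%N%:R)) ?(ltnW kK) // mulr_sumr.
rewrite big_mkcondr [RHS]big_mkcondr /=; apply: eq_bigr => n _.
have [lk|lk] := leqP (norm1 n) k; last first.
  by case: ifP => // lk'; rewrite (_ : (k.+1 - norm1 n) = 0)%N ?mulr0 //; lia.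
rewrite (leqW lk) subSn // eqSS /wt /=.
by case: eqP => _; rewrite ?mulr0 //; ring.
Qed.

Lemma ball_coord_eq_le i k (u : nat) :
  \sum_(n : point | (norm1 n <= k)%N) weight n * (n i == u :> nat)%:R <= 2 * slice_mass i k.
Proof.
rewrite (ball_coord i k (fun v => (v == u)%:R)) /slice_mass mulr_sumr; apply: ler_sum => n _.
rewrite mulrC; apply: ler_wpM2r; first exact: weight_ge0.
have [uK|uK] := ltnP u K.+1; last first.
  rewrite big1 // => v _; rewrite (_ : (v == u :> nat) = false) ?mulr0 //.
  by apply/eqP => E; move: (ltn_ord v); rewrite E ltnNge uK.
rewrite big_mkcond (bigD1 (Ordinal uK)) //= eqxx mulr1 big1 ?addr0.
  by case: ifP => _ //; rewrite /wt; case: ifP => _; lra.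
move=> v vu; rewrite (_ : (v == u :> nat) = false) ?mulr0 ?if_same //.
by apply/eqP => E; case/eqP: vu; apply: val_inj.
Qed.

End Counting.

(** * Multipliers *)

Section Trigonometry.
Variable R : realType.
Implicit Types (x t : R) (m q : nat).

Lemma norm_sin_mul m t : `|sin (m%:R * t)| <= m%:R * `|sin t|.
Proof.
elim: m => [|m IHm]; first by rewrite !mul0r sin0 normr0.
rewrite -natr1 !mulrDl !mul1r sinD; apply: le_trans (ler_normD _ _) _.
rewrite !normrM; apply: lerD.
  apply: le_trans IHm; rewrite ler_piMr // cos_max //.
by rewrite ler_piMl // cos_max.
Qed.

Lemma cosE_half x : cos x = 1 - 2 * sin (x / 2) ^+ 2.
Proof.
have {1}-> : x = (x / 2) *+ 2 by rewrite -mulr_natr; field.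
by rewrite cos_mulr2n cos2sin2; ring.
Qed.

Lemma cos_mulE m x : cos (m%:R * x) = 1 - 2 * sin (m%:R * (x / 2)) ^+ 2.
Proof. by rewrite cosE_half mulrA. Qed.

Lemma sin_mul_sqr_le m t : sin (m%:R * t) ^+ 2 <= m%:R ^+ 2 * sin t ^+ 2.
Proof.
rewrite -(real_normK (num_real (sin (_ * _)))) -(real_normK (num_real (sin t))) -exprMn.
by apply: lerXn2r; rewrite ?nnegrE ?mulr_ge0 // norm_sin_mul.
Qed.

Lemma sin_mul_sqr_rec m t : sin (m.+2%:R * t) ^+ 2 =
  2 * (1 - 2 * sin t ^+ 2) * sin (m.+1%:R * t) ^+ 2 - sin (m%:R * t) ^+ 2 + 2 * sin t ^+ 2.
Proof.
have -> : m.+2%:R * t = m.+1%:R * t + t by rewrite -(natr1 m.+1); ring.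
have -> : m%:R * t = m.+1%:R * t - t by rewrite -(natr1 m); ring.
rewrite sinD sinB; have := cos2sin2 (m.+1%:R * t); have := cos2sin2 t.
set a := sin t; set b := cos t; set c := sin _; set e := cos _ => h1 h2.
transitivity (2 * (c ^+ 2 * b ^+ 2 + e ^+ 2 * a ^+ 2) - (c * b - e * a) ^+ 2); first by ring.
by rewrite h1 h2; ring.
Qed.

(** By the recurrence for E k = sin(kt)^2, consecutive increments of E differ by 2s - 4 s E(k+1),
    where s = sin(t)^2. This is at least s while E <= 1/4, so E grows at least like k(k+1)s/2. *)
Lemma sin_mul_sqr_ge m t : m%:R ^+ 2 * sin t ^+ 2 <= 4^-1 ->
  m%:R ^+ 2 * sin t ^+ 2 / 2 <= sin (m%:R * t) ^+ 2.
Proof.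
move=> mt; set s := sin t ^+ 2 in mt *.
have s0 : 0 <= s by apply: sqr_ge0.
pose E k := sin (k%:R * t) ^+ 2.
have inc k : (k < m)%N -> (k.+1)%:R * s <= E k.+1 - E k.
  elim: k => [|k IHk] km.
    by rewrite /E mul0r sin0 expr0n subr0 !mul1r.
  rewrite /E sin_mul_sqr_rec -/s -/(E k.+1) -/(E k).
  have le_E : E k.+1 <= 4^-1.
    apply: le_trans (sin_mul_sqr_le _ _) _; apply: le_trans mt; apply: ler_wpM2r => //.
    by apply: lerXn2r; rewrite ?nnegrE // ler_nat ltnW.
  have := IHk (ltnW km); rewrite -(natr1 k.+1).
  have : s * E k.+1 <= s * 4^-1 by apply: ler_wpM2l.
  lra.
have {}inc k : (k <= m)%N -> k%:R * (k%:R + 1) / 2 * s <= E k.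
  elim: k => [|k IHk] km; first by rewrite !mul0r /E mul0r sin0 expr0n.
  have := inc k km; have := IHk (ltnW km); rewrite -(natr1 k); lra.
apply: le_trans (inc m (leqnn _)); rewrite mulrAC; apply: ler_wpM2r => //.
have : 0 <= m%:R :> R by []; nra.
Qed.

Lemma norm_cos_mul_le m x : m%:R ^+ 2 * sin (x / 2) ^+ 2 <= 4^-1 ->
  `|cos (m%:R * x)| <= expR (- (m%:R ^+ 2 * sin (x / 2) ^+ 2)).
Proof.
move=> mx; have := sin_mul_sqr_ge mx; have := sin_mul_sqr_le m (x / 2).
rewrite cos_mulE => h1 h2; apply: le_trans (expR_ge1Dx _).
rewrite ger0_norm; lra.
Qed.

Lemma dirichlet_sum q x :
  sin (x / 2) * (1 + 2 * \sum_(0 <= u < q) cos (u.+1%:R * x)) = sin ((q%:R + 2^-1) * x).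
Proof.
elim: q => [|q IHq]; first by rewrite big_nil mulr0 addr0 mulr1 add0r mulrC.
rewrite big_nat_recr //= [X in _ * X](_ : _ =
  1 + 2 * (\sum_(0 <= u < q) cos (u.+1%:R * x)) + 2 * cos (q.+1%:R * x)); last by ring.
rewrite mulrDr IHq.
have -> : (q.+1%:R + 2^-1) * x = q.+1%:R * x + x / 2 by field.
have -> : (q%:R + 2^-1) * x = q.+1%:R * x - x / 2 by rewrite -(natr1 q); field.
by rewrite sinB sinD; ring.
Qed.

Lemma expR_opp_le x : 0 <= x <= 1 -> expR (- x) <= 1 - x / 2.
Proof.
move=> /andP[x0 x1]; have e := expR_ge1Dx x.
rewrite expRN -div1r ler_pdivrMr ?expR_gt0 //.
have : 0 <= 1 - x / 2 by lra.
move=> h; apply: le_trans (ler_wpM2l h e); nra.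
Qed.

Lemma expR_opp_le_inv x : 0 < x -> expR (- x) <= x^-1.
Proof.
move=> x0; rewrite expRN lef_pV2 ?posrE ?expR_gt0 //.
by have := expR_ge1Dx x; lra.
Qed.

End Trigonometry.

Lemma norm_prod_sub1_le (R : numDomainType) (I : finType) (c : I -> R) :
  (forall i, `|c i| <= 1) -> `|1 - \prod_i c i| <= \sum_i `|1 - c i|.
Proof.
move=> c1.
suff [_ //] : `|\prod_i c i| <= 1 /\ `|1 - \prod_i c i| <= \sum_i `|1 - c i|.
elim/big_rec2: _ => [|i x y _ [y1 IH]]; first by rewrite subrr normr0 normr1.
split; first by rewrite normrM -[1]mulr1 ler_pM.
have -> : 1 - c i * y = (1 - c i) * y + (1 - y) by ring.
apply: le_trans (ler_normD _ _) _; apply: lerD => //.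
by rewrite normrM ler_piMr.
Qed.

(** * Products of cosines and exchangeability of the coordinates *)

Section Symbols.
Variables (R : realType) (d K : nat).
Local Notation point := {ffun 'I_d -> 'I_K.+1}.
Implicit Types (n : point) (i : 'I_d) (xi : 'I_d -> R).
Local Notation weight := (@weight R d K).
Local Notation ball_mass := (@ball_mass R d K).
Local Notation sphere_mass := (@sphere_mass R d K).
Local Notation slice_mass := (@slice_mass R d K).

Definition symbol xi n : R := \prod_i cos ((n i)%:R * xi i).
Definition hsin xi i : R := sin (xi i / 2) ^+ 2.

Lemma hsin_ge0 xi i : 0 <= hsin xi i. Proof. exact: sqr_ge0. Qed.

Lemma hsin_le1 xi i : hsin xi i <= 1.
Proof. by rewrite /hsin sin2cos2; have := sqr_ge0 (cos (xi i / 2)); lra. Qed.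

Lemma norm_symbol_le1 xi n : `|symbol xi n| <= 1.
Proof.
rewrite /symbol; elim/big_ind: _ => [|x y x1 y1|i _]; last exact: cos_max.
  by rewrite normr1.
by rewrite normrM -[1]mulr1 ler_pM.
Qed.

Lemma symbol_sub1_le xi n : `|1 - symbol xi n| <= \sum_i 2 * hsin xi i * (n i)%:R ^+ 2.
Proof.
have := @norm_prod_sub1_le _ _ (fun i => cos ((n i)%:R * xi i)) (fun i => cos_max _).
move=> h; apply: le_trans h _.
apply: ler_sum => i _; rewrite cos_mulE opprB addrCA subrr addr0.
have := sin_mul_sqr_le (n i) (xi i / 2); rewrite -/(hsin _ _) ger0_norm; first lra.
by have := sqr_ge0 (sin ((n i)%:R * (xi i / 2))); lra.
Qed.

Lemma sum_symbol_sub1_le (P : pred point) xi :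
  `|\sum_(n | P n) weight n - \sum_(n | P n) weight n * symbol xi n| <=
  2 * \sum_i hsin xi i * \sum_(n | P n) weight n * (n i)%:R ^+ 2.
Proof.
rewrite -sumrB; apply: le_trans (ler_norm_sum _ _ _) _.
have -> : \sum_i hsin xi i * \sum_(n | P n) weight n * (n i)%:R ^+ 2 =
    \sum_(n | P n) \sum_i hsin xi i * (weight n * (n i)%:R ^+ 2).
  by under eq_bigr do rewrite mulr_sumr; rewrite exchange_big.
rewrite mulr_sumr; apply: ler_sum => n _.
have -> : weight n - weight n * symbol xi n = weight n * (1 - symbol xi n) by ring.
rewrite normrM ger0_norm ?weight_ge0 //.
apply: le_trans (ler_wpM2l (weight_ge0 _ _) (symbol_sub1_le xi n)) _.
rewrite mulr_sumr mulr_sumr le_eqVlt; apply/orP; left; apply/eqP.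
by apply: eq_bigr => i _; ring.
Qed.

Lemma norm_sum_symbol_le (P : pred point) xi :
  `|\sum_(n | P n) weight n * symbol xi n| <= \sum_(n | P n) weight n.
Proof.
apply: le_trans (ler_norm_sum _ _ _) _; apply: ler_sum => n _.
by rewrite normrM ger0_norm ?weight_ge0 // ler_piMr ?weight_ge0 // norm_symbol_le1.
Qed.

(** Summing along a line in direction [i] produces a Dirichlet kernel, which the factor
    [sin (xi i / 2)] turns into a sine; each line, indexed by a point of the slice, thus contributes
    at most its weight. *)
Lemma ball_symbol_dirichlet xi i k : (k <= K)%N ->
  `|sin (xi i / 2)| * `|\sum_(n : point | (norm1 n <= k)%N) weight n * symbol xi n| <= slice_mass i k.
Proof.
move=> kK; rewrite (ball_split i) -normrM mulr_sumr.
apply: le_trans (ler_norm_sum _ _ _) _; apply: ler_sum => n /andP[/eqP ni nk].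
rewrite mulrCA normrM ger0_norm ?weight_ge0 // ler_piMr ?weight_ge0 //.
have symE (u : 'I_K.+1) : symbol xi (set_coord n i u) = cos (u%:R * xi i) * symbol xi n.
  rewrite /symbol (bigD1 i) //= [in RHS](bigD1 i) //= set_coordE ni mul0r cos0 mul1r; congr (_ * _).
  by apply: eq_bigr => j ji; rewrite ffunE (negPf ji).
under eq_bigr do rewrite symE mulrA.
rewrite -mulr_suml mulrA normrM -[leRHS]mulr1 ler_pM // ?norm_symbol_le1 //.
have -> : \sum_(u : 'I_K.+1 | (u <= k - norm1 n)%N) wt R u * cos (u%:R * xi i) =
  1 + 2 * \sum_(0 <= u < k - norm1 n) cos (u.+1%:R * xi i).
  transitivity (\sum_(0 <= u < (k - norm1 n).+1) wt R u * cos (u%:R * xi i)).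
    rewrite big_mkord (big_ord_widen_cond K.+1 xpredT (fun u => wt R u * cos (u%:R * xi i))) //.
    by lia.
  rewrite big_nat_recl // {1}/wt eqxx !mul0r cos0 mul1r mulr_sumr; congr (_ + _).
by rewrite dirichlet_sum sin_max.
Qed.

Definition permn n (s : {perm 'I_d}) : point := [ffun i => n (s i)].

Lemma permnK s : cancel (permn^~ s) (permn^~ s^-1%g).
Proof. by move=> n; apply/ffunP => i; rewrite !ffunE permKV. Qed.

Lemma permnKV s : cancel (permn^~ s^-1%g) (permn^~ s).
Proof. by move=> n; apply/ffunP => i; rewrite !ffunE permK. Qed.

Lemma weight_permn n s : weight (permn n s) = weight n.
Proof.
rewrite /weight [RHS](reindex_inj (@perm_inj _ s)).
by apply: eq_bigr => i _; rewrite ffunE.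
Qed.

Lemma norm1_permn n s : norm1 (permn n s) = norm1 n.
Proof.
rewrite /norm1 [RHS](reindex_inj (@perm_inj _ s)).
by apply: eq_bigr => i _; rewrite ffunE.
Qed.

(** Only the number of coordinates satisfying [q] survives: invariance of weight and [P] allows
    averaging over all permutations, and [perm_avg_le] replaces each factor by the mean of [b]. *)
Lemma exchangeable_sum_le (P : pred point) (q : pred nat) (b : 'I_d -> R) :
  (forall n s, P (permn n s) = P n) -> (forall i, 0 <= b i) ->
  \sum_(n | P n) weight n * \prod_(i | q (n i)) b i <=
  \sum_(n | P n) weight n * ((\sum_i b i) / d%:R) ^+ #|[set i | q (n i)]|.
Proof.
move=> Pp b0.
have c0 : 0 < #|{perm 'I_d}|%:R :> R.
  by rewrite ltr0n; apply/card_gt0P; exists 1%g.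
rewrite -(ler_pM2l c0).
have -> : #|{perm 'I_d}|%:R * \sum_(n | P n) weight n * \prod_(i | q (n i)) b i =
    \sum_(s : {perm 'I_d}) \sum_(n | P n) weight n * \prod_(i | q (n i)) b (s i).
  rewrite mulr_natl -sumr_const; apply: eq_bigr => s _.
  rewrite (reindex (permn^~ s^-1%g)) /=; last first.
    by exists (permn^~ s) => n _; [apply: permnKV|apply: permnK].
  apply: eq_big => [n|n _]; first exact: Pp.
  rewrite weight_permn; congr (_ * _).
  rewrite (reindex_inj (@perm_inj _ s)) /=; apply: eq_bigl => i.
  by rewrite ffunE permK.
rewrite exchange_big mulr_sumr; apply: ler_sum => n _.
rewrite -mulr_sumr mulrCA; apply: ler_wpM2l; first exact: weight_ge0.
have := perm_avg_le [set i | q (n i)] b0; rewrite card_ord.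
apply: le_trans; rewrite le_eqVlt; apply/orP; left; apply/eqP.
by apply: eq_bigr => s _; apply: eq_bigl => i; rewrite inE.
Qed.

End Symbols.

(** * Moments of the coordinates on balls and spheres *)

Section Moments.
Variables (R : realType) (d K : nat).
Local Notation point := {ffun 'I_d -> 'I_K.+1}.
Implicit Types (n : point) (i : 'I_d).
Local Notation weight := (@weight R d K).
Local Notation ball_mass := (@ball_mass R d K).
Local Notation sphere_mass := (@sphere_mass R d K).
Local Notation slice_mass := (@slice_mass R d K).

Lemma ball_sum_sphere k (H : point -> R) :
  \sum_(n : point | (norm1 n <= k)%N) H n = \sum_(j < k.+1) \sum_(n : point | norm1 n == j) H n.
Proof.
rewrite (partition_big (fun n => inord (norm1 n) : 'I_k.+1) xpredT) //=.
apply: eq_bigr => j _; apply: eq_bigl => n; apply/andP/eqP => [[nk /eqP <-]|nj].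
  by rewrite inordK.
have nk : (norm1 n <= k)%N by rewrite nj -ltnS.
by split=> //; apply/eqP/val_inj; rewrite /= inordK.
Qed.

Lemma sphere_sub_ball k : sphere_mass k <= ball_mass k.
Proof.
rewrite /ball_mass ball_sum_sphere big_ord_recr /= lerDr.
by apply: sumr_ge0 => j _; apply: sphere_ge0.
Qed.

Lemma sphere_first_moment_le i k : (k <= K)%N ->
  \sum_(n : point | norm1 n == k) weight n * (n i)%:R <= ball_mass k.
Proof. by move=> kK; rewrite (ball_first_moment R i kK) lerDl slice_ge0. Qed.

Definition sphere_moment2 i k : R := \sum_(n : point | norm1 n == k) weight n * (n i)%:R ^+ 2.

Lemma sphere_moment2_rec i k : (k < K)%N -> sphere_moment2 i k.+1 =
  2 * \sum_(n : point | norm1 n == k) weight n * (n i == 0 :> nat)%:R +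
  \sum_(n : point | norm1 n == k) weight n * (if (0 < n i)%N then (n i).+1%:R ^+ 2 else 0).
Proof.
move=> kK; rewrite -sphere_ones // -(sphere_shift i (fun u => u%:R ^+ 2)) // -big_split /=.
apply: eq_bigr => n _; rewrite -mulrDr; congr (_ * _).
by case: (nat_of_ord (n i)) => [|[|u]] /=; rewrite ?expr0n ?expr1n ?add0r ?addr0.
Qed.

Lemma sphere_zero_le i k :
  \sum_(n : point | norm1 n == k) weight n * (n i == 0 :> nat)%:R <= sphere_mass k.
Proof.
apply: ler_sum => n _; rewrite ler_piMr ?weight_ge0 //.
by case: eqP.
Qed.

Lemma sphere_moment2_0 i : sphere_moment2 i 0 = 0.
Proof.
rewrite /sphere_moment2 big1 // => n; rewrite /norm1 sum_nat_eq0 => /forallP/(_ i)/eqP->.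
by rewrite expr0n mulr0.
Qed.

(** New ones cost 2. Raising u >= 1 to u + 1 adds at most 3u to the square, and the first moment on
    the sphere is at most the mass of the ball. *)
Lemma sphere_moment2_step i k : (k < K)%N -> sphere_moment2 i k.+1 <= sphere_moment2 i k + 5 * ball_mass k.
Proof.
move=> kK; rewrite sphere_moment2_rec //.
have h1 := sphere_zero_le i k; have h2 := sphere_sub_ball k.
have h3 := sphere_first_moment_le i (ltnW kK).
have : \sum_(n : point | norm1 n == k) weight n * (if (0 < n i)%N then (n i).+1%:R ^+ 2 else 0) <=
    sphere_moment2 i k + 3 * \sum_(n : point | norm1 n == k) weight n * (n i)%:R.
  rewrite mulr_sumr -big_split /=; apply: ler_sum => n _.
  rewrite [leRHS](_ : _ = weight n * ((n i)%:R ^+ 2 + 3 * (n i)%:R)); last by ring.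
  apply: ler_wpM2l; first exact: weight_ge0.
  case: ltnP => [n0|_]; last by have : 0 <= (n i)%:R :> R by []; nra.
  have : 1 <= (n i)%:R :> R by rewrite ler1n.
  rewrite -(natr1 (n i)); nra.
lra.
Qed.

Lemma sum_ball_le k : (k <= K)%N ->
  d%:R * \sum_(j < k.+1) ball_mass j <= (K + d)%:R * ball_mass k.
Proof.
move=> kK; rewrite {2}/ball_mass ball_sum_sphere !mulr_sumr; apply: ler_sum => j _.
have jK : (j <= K)%N by rewrite (leq_trans _ kK) // -ltnS.
apply: le_trans (ball_le_sphere _ _ jK) _; apply: ler_wpM2r; first exact: sphere_ge0.
by rewrite ler_nat leq_add2r.
Qed.

Lemma sphere_moment2_le i k : (k <= K)%N -> d%:R * sphere_moment2 i k <= 5 * (K + d)%:R * ball_mass k.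
Proof.
move=> kK; have : sphere_moment2 i k <= 5 * \sum_(j < k) ball_mass j.
  elim: k kK => [|k IHk] kK; first by rewrite sphere_moment2_0 big_ord0 mulr0.
  apply: le_trans (sphere_moment2_step _ kK) _; rewrite big_ord_recr /= mulrDr lerD2r.
  exact/IHk/ltnW.
move=> h; have h2 := sum_ball_le kK; rewrite big_ord_recr /= in h2.
have d0 : 0 <= d%:R :> R by [].
have h3 := ler_wpM2l d0 h; have h4 := mulr_ge0 d0 (ball_ge0 R d K k).
rewrite -mulrA; rewrite mulrDr in h2; rewrite mulrCA in h3; lra.
Qed.

Lemma ball_second_moment_le i : (0 < d)%N ->
  \sum_(n : point | (norm1 n <= K)%N) weight n * (n i)%:R ^+ 2 <=
  5 * ((K + d)%:R / d%:R) ^+ 2 * ball_mass K.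
Proof.
move=> d0; have dR : 0 < d%:R :> R by rewrite ltr0n.
rewrite ball_sum_sphere.
have h : d%:R * \sum_(j < K.+1) sphere_moment2 i j <= 5 * (K + d)%:R * \sum_(j < K.+1) ball_mass j.
  by rewrite !mulr_sumr; apply: ler_sum => j _; apply: sphere_moment2_le; rewrite -ltnS.
have h2 := sum_ball_le (leqnn K).
have -> : 5 * ((K + d)%:R / d%:R) ^+ 2 * ball_mass K =
    (5 * (K + d)%:R * ((K + d)%:R * ball_mass K)) / d%:R ^+ 2 by field; rewrite gt_eqF.
rewrite ler_pdivlMr ?exprn_gt0 // [leLHS](_ : _ = d%:R * (d%:R * \sum_(j < K.+1) sphere_moment2 i j)).
  apply: le_trans (ler_wpM2l (ltW dR) h) _; rewrite mulrCA; apply: ler_wpM2l => //.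
  by rewrite mulr_ge0.
by rewrite /sphere_moment2; ring.
Qed.

Hypothesis dK : (8 * K <= d)%N.

(** Count the coordinates equal to 1 on the larger sphere: there are at most k + 1 per point, and by
    [sphere_ones] their total is twice that of the zeros on the smaller sphere, where each point has
    at least d - k >= d/2 zeros. *)
Lemma sphere_growth k : (k < K)%N -> d%:R * sphere_mass k <= k.+1%:R * sphere_mass k.+1.
Proof.
move=> kK.
have : 2 * \sum_i \sum_(n : point | norm1 n == k) weight n * (n i == 0 :> nat)%:R <= k.+1%:R * sphere_mass k.+1.
  rewrite mulr_sumr (eq_bigr _ (fun i _ => esym (sphere_ones R i kK))) exchange_big /=.
  rewrite mulr_sumr; apply: ler_sum => n /eqP nk; rewrite -mulr_sumr mulrC.
  apply: ler_wpM2r; first exact: weight_ge0.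
  rewrite -nk -(sum_coord_norm1 R); apply: ler_sum => i _.
  by case: (nat_of_ord (n i)) => [|[|u]] //=.
apply: le_trans; rewrite exchange_big /= mulr_sumr mulr_sumr; apply: ler_sum => n /eqP nk.
rewrite -mulr_sumr mulrCA mulrC; apply: ler_wpM2l; first exact: weight_ge0.
have : d%:R - k%:R <= \sum_i (n i == 0 :> nat)%:R :> R.
  rewrite lerBlDr -nk -(sum_coord_norm1 R) -big_split /=.
  rewrite -[d in d%:R]card_ord -sumr_const; apply: ler_sum => i _.
  by case: (nat_of_ord (n i)) => [|u] /=; rewrite ?addr0 // add0r ler1n.
have : 8 * k%:R <= d%:R :> R by rewrite -natrM ler_nat; lia.
have : 0 <= k%:R :> R by [].
lra.
Qed.

Lemma sphere_growth8 k : (k < K)%N -> 8 * sphere_mass k <= sphere_mass k.+1.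
Proof.
move=> kK; have d0 : 0 < d%:R :> R by rewrite ltr0n; lia.
rewrite -(ler_pM2l d0) mulrCA; apply: le_trans (ler_wpM2l _ (sphere_growth kK)) _ => //.
rewrite mulrA; apply: ler_wpM2r; first exact: sphere_ge0.
by rewrite -natrM ler_nat; lia.
Qed.

Lemma ball_le2_sphere k : (k <= K)%N -> ball_mass k <= 2 * sphere_mass k.
Proof.
elim: k => [|k IHk] kK.
  rewrite /ball_mass ball_sum_sphere big_ord1 /=; have := sphere_ge0 R d K 0; rewrite /sphere_mass; lra.
have -> : ball_mass k.+1 = ball_mass k + sphere_mass k.+1.
  by rewrite /ball_mass !ball_sum_sphere big_ord_recr.
have := IHk (ltnW kK); have := sphere_growth8 kK; have := sphere_ge0 R d K k; lra.
Qed.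

Lemma ball_pred_le : (0 < K)%N -> d%:R * ball_mass K.-1 <= 2 * K%:R * sphere_mass K.
Proof.
move=> K0; have kK : (K.-1 < K)%N by lia.
have := sphere_growth kK; rewrite prednK // => h.
have := ball_le2_sphere (ltnW kK) => h2.
have d0 : 0 <= d%:R :> R by [].
have := ler_wpM2l d0 h2; lra.
Qed.

(** The crude bound (u + 1)^2 <= 4 u^2 is affordable because the sphere mass grows by a factor 8 at
    each step. *)
Lemma sphere_moment2_sparse i k : (k <= K)%N -> d%:R * sphere_moment2 i k <= 4 * k%:R * sphere_mass k.
Proof.
elim: k => [|k IHk] kK; first by rewrite sphere_moment2_0 mulr0 mulr0 mul0r.
have h1 := sphere_zero_le i k; have h2 := sphere_growth kK; have h3 := IHk (ltnW kK).
have h4 := sphere_growth8 kK.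
have h5 : sphere_moment2 i k.+1 <= 2 * sphere_mass k + 4 * sphere_moment2 i k.
  rewrite sphere_moment2_rec //; apply: lerD; first by rewrite ler_pM2l.
  rewrite mulr_sumr; apply: ler_sum => n _.
  rewrite mulrCA; apply: ler_wpM2l; first exact: weight_ge0.
  case: ltnP => [n0|_]; last by rewrite mulr_ge0 // sqr_ge0.
  have : 1 <= (n i)%:R :> R by rewrite ler1n.
  rewrite -(natr1 (n i)); nra.
have d0 : 0 <= d%:R :> R by [].
have := ler_wpM2l d0 h5.
have k0 : 0 <= k%:R :> R by [].
have := ler_wpM2l k0 h4; have := sphere_ge0 R d K k.+1; move: h2; rewrite -(natr1 k); lra.
Qed.

(** Lowering by one each coordinate above 1 turns its excess into a coordinate of a point of the
    smaller sphere, and these sum to [k]. *)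
Lemma sphere_excess k : (k < K)%N ->
  \sum_(n : point | norm1 n == k.+1) weight n * \sum_i ((n i).-1)%:R = k%:R * sphere_mass k.
Proof.
move=> kK; transitivity (\sum_i \sum_(n : point | norm1 n == k.+1)
    weight n * (if (1 < n i)%N then (n i).-1%:R else 0)).
  rewrite exchange_big /=; apply: eq_bigr => n _; rewrite mulr_sumr.
  by apply: eq_bigr => i _; case: (nat_of_ord (n i)) => [|[|u]].
rewrite (eq_bigr _ (fun i _ => sphere_shift i (fun u => u.-1%:R) kK)) exchange_big /=.
rewrite /sphere_mass mulr_sumr; apply: eq_bigr => n /eqP <-.
rewrite -mulr_sumr mulrC -(sum_coord_norm1 R); congr (_ * _); apply: eq_bigr => i _ /=.
by case: (nat_of_ord (n i)).
Qed.

End Moments.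

(** * Estimates of the multiplier for R >= d *)

Section SymbolEstimates.
Variables (R : realType) (d K : nat).
Local Notation point := {ffun 'I_d -> 'I_K.+1}.
Implicit Types (n w : point) (i : 'I_d) (xi : 'I_d -> R).
Local Notation weight := (@weight R d K).
Local Notation ball_mass := (@ball_mass R d K).
Local Notation sphere_mass := (@sphere_mass R d K).
Local Notation slice_mass := (@slice_mass R d K).
Local Notation symbol := (@symbol R d K).

Definition ball_symbol xi : R :=
  (\sum_(n : point | (norm1 n <= K)%N) weight n * symbol xi n) / ball_mass K.
Definition sphere_symbol xi : R :=
  (\sum_(n : point | norm1 n == K) weight n * symbol xi n) / sphere_mass K.

Lemma ball_gt0 k : 0 < ball_mass k.
Proof. by have := ball_ge1 R d K k; lra. Qed.

Lemma norm_ball_symbol_le1 xi : `|ball_symbol xi| <= 1.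
Proof.
rewrite /ball_symbol normrM normfV (gtr0_norm (ball_gt0 K)).
by rewrite ler_pdivrMr ?ball_gt0 // mul1r norm_sum_symbol_le.
Qed.

Lemma dense_symbol_sub1 xi : (0 < d <= K)%N ->
  `|1 - ball_symbol xi| <= 40 * ((K%:R / d%:R) ^+ 2 * \sum_i hsin xi i).
Proof.
move=> /andP[d0 dK]; have dR : 0 < d%:R :> R by rewrite ltr0n.
have b0 := ball_gt0 K.
have -> : 1 - ball_symbol xi =
    (ball_mass K - \sum_(n : point | (norm1 n <= K)%N) weight n * symbol xi n) / ball_mass K.
  by rewrite /ball_symbol mulrBl divff ?gt_eqF.
rewrite normrM normfV (gtr0_norm b0) ler_pdivrMr //.
apply: le_trans (sum_symbol_sub1_le _ xi) _.
(* As [d <= K], the factor 5 (K + d)^2 is at most 20 K^2; [sum_symbol_sub1_le] doubles it to 40. *)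
have h : \sum_i hsin xi i * (\sum_(n : point | (norm1 n <= K)%N) weight n * (n i)%:R ^+ 2) <=
    \sum_i hsin xi i * (20 * (K%:R / d%:R) ^+ 2 * ball_mass K).
  apply: ler_sum => i _; apply: ler_wpM2l; first exact: hsin_ge0.
  apply: le_trans (ball_second_moment_le R K i d0) _; apply: ler_wpM2r; first exact: ltW.
  have -> : 20 * (K%:R / d%:R) ^+ 2 = 5 * (2 * (K%:R / d%:R)) ^+ 2 :> R by ring.
  apply: ler_wpM2l => //; apply: lerXn2r; rewrite ?nnegrE ?mulr_ge0 ?invr_ge0 //.
  rewrite mulrA ler_pM2r ?invr_gt0 // natrD.
  have : d%:R <= K%:R :> R by rewrite ler_nat.
  lra.
rewrite -mulr_suml in h; lra.
Qed.

Lemma dense_symbol_dirichlet xi i : (0 < d <= K)%N ->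
  K%:R / d%:R * `|sin (xi i / 2)| * `|ball_symbol xi| <= 1.
Proof.
move=> /andP[d0 dK]; have dR : 0 < d%:R :> R by rewrite ltr0n.
have b0 := ball_gt0 K.
rewrite /ball_symbol normrM normfV (gtr0_norm b0) mulrA ler_pdivrMr // mul1r.
have h := ball_symbol_dirichlet xi i (leqnn K).
have h2 := slice_le_sphere R i (leqnn K); have h3 := sphere_le_ball R d (leqnn K).
have k0 : 0 <= K%:R / d%:R :> R by rewrite divr_ge0.
rewrite -mulrA; apply: le_trans (ler_wpM2l k0 (le_trans h h2)) _.
by rewrite mulrAC ler_pdivrMr // [leRHS]mulrC.
Qed.

Lemma geom_le_expR (x : R) t : 0 <= x -> x ^+ t <= expR (- (t%:R * (1 - x))).
Proof.
move=> x0; rewrite -mulrN expRM_natl; apply: lerXn2r; rewrite ?nnegrE ?expR_ge0 //.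
by apply: le_trans (expR_ge1Dx _); lra.
Qed.

Lemma norm_symbol_le_prod xi n (q : pred nat) (b : 'I_d -> R) :
  (forall i, q (n i) -> `|cos ((n i)%:R * xi i)| <= b i) ->
  `|symbol xi n| <= \prod_(i | q (n i)) b i.
Proof.
move=> qb; rewrite normr_prod [leRHS]big_mkcond /=; apply: ler_prod => i _.
by rewrite normr_ge0 /=; case: ifP => [/qb //|_]; apply: cos_max.
Qed.

Lemma ball_low_coords_le (a : nat) :
  \sum_(n : point | (norm1 n <= K)%N) weight n * #|[set i | (n i < a)%N]|%:R <=
  2 * a%:R * d%:R * sphere_mass K.
Proof.
have E n : #|[set i | (n i < a)%N]|%:R = \sum_i \sum_(u < a) (n i == u :> nat)%:R :> R.
  rewrite -sum1_card natr_sum big_mkcond /=; apply: eq_bigr => i _; rewrite inE.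
  case: ltnP => ia.
    rewrite (bigD1 (Ordinal ia)) //= eqxx big1 ?addr0 // => u ui.
    by case: eqP => // E; case/eqP: ui; apply: val_inj.
  by rewrite big1 // => u _; case: eqP => // E; move: (ltn_ord u); rewrite -E ltnNge ia.
apply: (@le_trans _ _ (\sum_i \sum_(u < a) \sum_(n : point | (norm1 n <= K)%N)
    weight n * (n i == u :> nat)%:R)).
  rewrite le_eqVlt; apply/orP; left; apply/eqP.
  under [RHS]eq_bigr do rewrite exchange_big.
  rewrite [RHS]exchange_big /=; apply: eq_bigr => n _; rewrite E mulr_sumr.
  by apply: eq_bigr => i _; rewrite mulr_sumr.
have -> : 2 * a%:R * d%:R * sphere_mass K = \sum_(i < d) \sum_(u < a) 2 * sphere_mass K.
  by rewrite !sumr_const !card_ord -mulrnA -[RHS]mulr_natr natrM; ring.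
apply: ler_sum => i _; apply: ler_sum => u _.
by apply: le_trans (@ball_coord_eq_le R d K i K u) _; rewrite ler_pM2l // slice_le_sphere.

Qed.

Lemma avg_expR_le (c : R) (s : 'I_d -> R) : (0 < d)%N -> (forall i, 0 <= s i) ->
  0 <= c -> (forall i, c * s i <= 1) ->
  1 - (\sum_i expR (- (c * s i))) / d%:R >= c * (\sum_i s i) / (2 * d%:R).
Proof.
move=> d0 s0 c0 cs; have dR : 0 < d%:R :> R by rewrite ltr0n.
have : \sum_i expR (- (c * s i)) <= \sum_(i < d) (1 - c * s i / 2).
  by apply: ler_sum => i _; apply: expR_opp_le; rewrite mulr_ge0 //= cs.
rewrite sumrB sumr_const card_ord -mulr_suml -mulr_sumr => h.
rewrite lerBrDr -lerBrDl ler_pdivrMr //; apply: le_trans h _.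
rewrite le_eqVlt; apply/orP; left; apply/eqP; field; by rewrite gt_eqF.
Qed.

(** Points with more than half of their coordinates below [a] are rare by Markov's inequality and
    give the first term. On the others at least d/4 coordinates lie between [a] and 4K/d, small
    enough for the Gaussian bound on the cosine and large enough for decay. *)
Lemma dense_symbol_decay xi (a : nat) : (0 < d <= K)%N -> (0 < a)%N ->
  a%:R <= 2 * (K%:R / d%:R) :> R ->
  (forall i, (K%:R / d%:R) ^+ 2 * hsin xi i <= 64^-1) ->
  `|ball_symbol xi| <= 4 * a%:R * (d%:R / K%:R) +
     expR (- (a%:R ^+ 2 * (\sum_i hsin xi i) / 8)).
Proof.
move=> /andP[d0 dK] a0 aK xiK; have dR : 0 < d%:R :> R by rewrite ltr0n.
have K0 : (0 < K)%N by lia.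
have KR : 0 < K%:R :> R by rewrite ltr0n.
have b0 := ball_gt0 K; set S := \sum_i hsin xi i.
set E := expR _.
have r0 : 0 <= K%:R / d%:R :> R by rewrite divr_ge0.
rewrite /ball_symbol normrM normfV (gtr0_norm b0) ler_pdivrMr //.
pose P n := (2 * #|[set i | (n i < a)%N]| <= d)%N.
pose q (u : nat) := (a <= u)%N && (u * d <= 4 * K)%N.
pose b i := expR (- (a%:R ^+ 2 * hsin xi i)).
have good : \sum_(n : point | (norm1 n <= K)%N && P n) weight n * `|symbol xi n| <= E * ball_mass K.
  apply: (@le_trans _ _ (\sum_(n : point | (norm1 n <= K)%N && P n) weight n * \prod_(i | q (n i)) b i)).
    apply: ler_sum => n _; apply: ler_wpM2l; first exact: weight_ge0.
    apply: norm_symbol_le_prod => i /andP[ai iK].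
    have niK : (n i)%:R <= 4 * (K%:R / d%:R) :> R.
      by rewrite mulrA ler_pdivlMr // -!natrM ler_nat.
    (* The hypothesis with [64^-1] is made for this: 4^2/64 is the 1/4 allowed in
       [norm_cos_mul_le]. *)
    apply: le_trans (norm_cos_mul_le _) _.
      rewrite -/(hsin xi i).
      have h : (n i)%:R ^+ 2 <= (4 * (K%:R / d%:R)) ^+ 2 :> R.
        by apply: lerXn2r => //; rewrite nnegrE ?mulr_ge0 ?invr_ge0.
      apply: le_trans (ler_wpM2r (hsin_ge0 _ _) h) _.
      have := xiK i; lra.
    rewrite ler_expR lerN2; apply: ler_wpM2r; first exact: hsin_ge0.
    by apply: lerXn2r; rewrite ?nnegrE // ler_nat.
  apply: le_trans (@exchangeable_sum_le R d K _ q b _ _) _.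
  - move=> n s; rewrite norm1_permn /P; congr (_ && (2 * _ <= d)%N).
    rewrite -(card_imset _ (@perm_inj _ s)); apply: eq_card => i.
    apply/imsetP/idP => [[j]|]; rewrite !inE ?ffunE; first by move=> ? ->.
    by move=> h; exists (s^-1%g i); rewrite ?inE ?ffunE permKV.
  - by move=> i; apply: expR_ge0.
  rewrite [leRHS]mulrC /ball_mass [leRHS]mulr_suml [leRHS](bigID P) /= -[leLHS]addr0; apply: lerD; last first.
    by apply: sumr_ge0 => n _; rewrite mulr_ge0 ?weight_ge0 ?expR_ge0.
  apply: ler_sum => n /andP[nK nP]; apply: ler_wpM2l; first exact: weight_ge0.
  (* At most d/4 coordinates exceed 4K/d, since they sum to at most [K], and at most d/2 are below
     [a]. *)
  have cT : (d <= 4 * #|[set i | q (n i)]|)%N.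
    have h1 : (4 * #|[set i | (4 * K < n i * d)%N]| <= d)%N.
      rewrite -(leq_pmul2l K0) mulnCA mulnA -sum1_card.
      apply: (@leq_trans (norm1 n * d)); last by rewrite leq_mul2r nK orbT.
      rewrite big_distrr /norm1 big_distrl /= big_mkcond /=; apply: leq_sum => i _.
      by rewrite inE muln1; case: ltnP => // /ltnW.
    have : (d <= #|[set i | (n i < a)%N]| + #|[set i | q (n i)]| + #|[set i | (4 * K < n i * d)%N]|)%N.
      rewrite -{1}[d]card_ord -cardsT.
      apply: (@leq_trans #|[set i | (n i < a)%N] :|: [set i | q (n i)] :|: [set i | (4 * K < n i * d)%N]|).
        apply: subset_leq_card; apply/subsetP => i _; rewrite !inE /q.
        by case: (ltnP (n i) a) => //= _; case: ltnP.
      apply: leq_trans (leq_card_setU _ _) _; rewrite leq_add2r; exact: leq_card_setU.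
    rewrite /P in nP; lia.
  apply: le_trans (geom_le_expR _ _) _.
    by rewrite divr_ge0 //; apply: sumr_ge0 => i _; apply: expR_ge0.
  rewrite ler_expR lerN2.
  have a2 : a%:R ^+ 2 <= 4 * (K%:R / d%:R) ^+ 2 :> R.
    have -> : 4 * (K%:R / d%:R) ^+ 2 = (2 * (K%:R / d%:R)) ^+ 2 :> R by ring.
    by apply: lerXn2r; rewrite ?nnegrE ?mulr_ge0 ?invr_ge0.
  have := @avg_expR_le (a%:R ^+ 2) (hsin xi) d0 (hsin_ge0 xi) (sqr_ge0 _).
  rewrite -/S => h.
  have {}h := h (fun i => le_trans (ler_wpM2r (hsin_ge0 xi i) a2) _).
  have {}h : a%:R ^+ 2 * S / (2 * d%:R) <= 1 - (\sum_i b i) / d%:R.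
    by apply: h => i; have := xiK i; lra.
  have S0 : 0 <= a%:R ^+ 2 * S / (2 * d%:R).
    by rewrite divr_ge0 ?mulr_ge0 ?sqr_ge0 ?sumr_ge0 // => i _; apply: hsin_ge0.
  have cT' : d%:R / 4 <= #|[set i | q (n i)]|%:R :> R.
    by rewrite ler_pdivrMr // mulrC -natrM ler_nat.
  (* At least d/4 factors, each with a gain of a^2 S/(2d), give the exponent a^2 S/8. *)
  have := ler_pM _ S0 cT' h; rewrite divr_ge0 // => /(_ isT); apply: le_trans.
  by rewrite le_eqVlt; apply/orP; left; apply/eqP; field; rewrite gt_eqF.
have bad : \sum_(n : point | (norm1 n <= K)%N && ~~ P n) weight n * `|symbol xi n| <=
    4 * a%:R * (d%:R / K%:R) * ball_mass K.
  apply: (@le_trans _ _ (4 * a%:R * sphere_mass K)); last first.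
    rewrite -[leRHS]mulrA; apply: ler_wpM2l; first by rewrite mulr_ge0.
    by rewrite mulrAC ler_pdivlMr // mulrC sphere_le_ball.
  rewrite -(ler_pM2l dR).
  have -> : d%:R * (4 * a%:R * sphere_mass K) = 2 * (2 * a%:R * d%:R * sphere_mass K) by ring.
  apply: le_trans (ler_wpM2l _ (ball_low_coords_le a)) => //.
  rewrite !mulr_sumr [leRHS](bigID P) /= -[leLHS]add0r; apply: lerD.
    by apply: sumr_ge0 => n _; rewrite !mulr_ge0 ?weight_ge0.
  apply: ler_sum => n /andP[_]; rewrite /P -ltnNge => /ltnW nP.
  rewrite [leRHS](_ : _ = (2 * #|[set i | (n i < a)%N]|%:R) * weight n); last by ring.
  apply: ler_pM; rewrite ?mulr_ge0 ?weight_ge0 //.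
    by rewrite -natrM ler_nat.
  by rewrite ler_piMr ?weight_ge0 // norm_symbol_le1.
rewrite mulrDl addrC; apply: le_trans (lerD good bad).
apply: le_trans (ler_norm_sum _ _ _) _; rewrite [leLHS](bigID P) /=.
by apply: lerD; apply: ler_sum => n _; rewrite normrM ger0_norm ?weight_ge0.
Qed.

End SymbolEstimates.

(** * Estimates of the multiplier for 8R <= d *)

Section SparseEstimates.
Variables (R : realType) (d K : nat).
Local Notation point := {ffun 'I_d -> 'I_K.+1}.
Implicit Types (n w : point) (i : 'I_d) (xi : 'I_d -> R).
Local Notation weight := (@weight R d K).
Local Notation ball_mass := (@ball_mass R d K).
Local Notation sphere_mass := (@sphere_mass R d K).
Local Notation symbol := (@symbol R d K).
Local Notation ball_symbol := (@ball_symbol R d K).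
Local Notation sphere_symbol := (@sphere_symbol R d K).

Hypotheses (K0 : (0 < K)%N) (dK : (8 * K <= d)%N).

Let d_gt0 : 0 < d%:R :> R. Proof. by rewrite ltr0n; lia. Qed.

Lemma ball_succ (H : point -> R) k :
  \sum_(n : point | (norm1 n <= k.+1)%N) H n =
  \sum_(n : point | (norm1 n <= k)%N) H n + \sum_(n : point | norm1 n == k.+1) H n.
Proof. by rewrite !ball_sum_sphere big_ord_recr. Qed.

Lemma sphere_gt0 : 0 < sphere_mass K.
Proof.
have := ball_le2_sphere R dK (leqnn K); have := ball_gt0 R d K K; lra.
Qed.

Lemma norm_sphere_symbol_le1 xi : `|sphere_symbol xi| <= 1.
Proof.
rewrite /sphere_symbol normrM normfV (gtr0_norm sphere_gt0).
by rewrite ler_pdivrMr ?sphere_gt0 // mul1r norm_sum_symbol_le.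
Qed.

(** Almost all of the ball lies on its outermost sphere: the inner ball has relative mass at most
    2K/d, and both symbols are bounded by 1. The error is geometric in the radius, hence summable
    over dyadic scales. *)
Lemma ball_symbol_sphere_symbol xi :
  `|ball_symbol xi - sphere_symbol xi| <= 4 * (K%:R / d%:R).
Proof.
have s0 := sphere_gt0; have b0 := ball_gt0 R d K K.
have bE : ball_mass K = ball_mass K.-1 + sphere_mass K.
  by have := ball_succ weight K.-1; rewrite prednK.
set B := \sum_(n : point | (norm1 n <= K.-1)%N) weight n * symbol xi n.
have BE : \sum_(n : point | (norm1 n <= K)%N) weight n * symbol xi n =
    B + sphere_symbol xi * sphere_mass K.
  rewrite /sphere_symbol divfK ?gt_eqF //.
  by have := ball_succ (fun n => weight n * symbol xi n) K.-1; rewrite prednK.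
have nB : `|B| <= ball_mass K.-1 by apply: norm_sum_symbol_le.
have -> : ball_symbol xi - sphere_symbol xi = (B - sphere_symbol xi * ball_mass K.-1) / ball_mass K.
  by rewrite /ball_symbol BE bE; field; rewrite -bE gt_eqF.
rewrite normrM normfV (gtr0_norm b0) ler_pdivrMr //.
have h1 := ball_pred_le R dK K0.
have h2 : 4 * (K%:R / d%:R) * sphere_mass K <= 4 * (K%:R / d%:R) * ball_mass K.
  by apply: ler_wpM2l; rewrite ?mulr_ge0 ?invr_ge0 // sphere_sub_ball.
apply: le_trans h2; apply: (@le_trans _ _ (2 * ball_mass K.-1)).
  apply: le_trans (ler_normB _ _) _.
  have := ler_wpM2r (ball_ge0 R d K K.-1) (norm_sphere_symbol_le1 xi).
  rewrite [`|_ * ball_mass _|]normrM (ger0_norm (ball_ge0 R d K K.-1)); lra.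
by rewrite mulrA mulrAC ler_pdivlMr // mulrC; lra.
Qed.

Lemma sphere_symbol_sub1 xi :
  `|1 - sphere_symbol xi| <= 8 * (K%:R * ((\sum_i hsin xi i) / d%:R)).
Proof.
have s0 := sphere_gt0.
have -> : 1 - sphere_symbol xi =
    (sphere_mass K - \sum_(n : point | norm1 n == K) weight n * symbol xi n) / sphere_mass K.
  by rewrite /sphere_symbol mulrBl divff ?gt_eqF.
rewrite normrM normfV (gtr0_norm s0) ler_pdivrMr //.
apply: le_trans (sum_symbol_sub1_le _ xi) _.
have h : \sum_i hsin xi i * (\sum_(n : point | norm1 n == K) weight n * (n i)%:R ^+ 2) <=
    \sum_i hsin xi i * (4 * K%:R * sphere_mass K / d%:R).
  apply: ler_sum => i _; apply: ler_wpM2l; first exact: hsin_ge0.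
  by rewrite ler_pdivlMr // mulrC; exact: (sphere_moment2_sparse R dK i (leqnn K)).
by rewrite -mulr_suml in h; lra.
Qed.

(** The parity symmetry: each cosine acquires the sign (-1)^(n_i), and these signs cancel on a
    sphere of even radius. *)
Definition reflect_pi xi i : R := pi - xi i.

Lemma hsin_reflect xi i : hsin (reflect_pi xi) i = 1 - hsin xi i.
Proof.
rewrite /hsin /reflect_pi mulrBl sinB cos_pihalf sin_pihalf mul1r mul0r subr0.
by rewrite cos2sin2.
Qed.

Lemma cos_mul_sub_pi (m : nat) (t : R) : cos (m%:R * (pi - t)) = (-1) ^+ m * cos (m%:R * t).
Proof.
elim: m {-2}m (leqnn m) => [|k IHk] [|[|m]] // mk.
- by rewrite !mul0r cos0 expr0 mul1r.
- by rewrite !mul0r cos0 expr0 mul1r.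
- by rewrite !mul1r cosB cospi sinpi mul0r addr0 expr1.
have E (s : R) : cos (m.+2%:R * s) = 2 * cos s * cos (m.+1%:R * s) - cos (m%:R * s).
  have -> : m.+2%:R * s = m.+1%:R * s + s by rewrite -(natr1 m.+1); ring.
  have -> : m%:R * s = m.+1%:R * s - s by rewrite -(natr1 m); ring.
  by rewrite cosB cosD; ring.
rewrite !E !IHk; try lia.
by rewrite cosB cospi sinpi !exprS; ring.
Qed.

Lemma sphere_symbol_reflect xi : ~~ odd K -> sphere_symbol (reflect_pi xi) = sphere_symbol xi.
Proof.
move=> oK; rewrite /sphere_symbol; congr (_ / _); apply: eq_bigr => n /eqP nK.
congr (_ * _); rewrite /symbol /reflect_pi (eq_bigr _ (fun i _ => cos_mul_sub_pi (n i) (xi i))).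
rewrite big_split /= -expr_sum -/(norm1 n) nK.
by rewrite -signr_odd (negPf oK) expr0 mul1r.
Qed.

(** With fewer than K/2 ones, the excess of the coordinates over 1 is more than K/4, because u <=
    2(u - 1) for u >= 2. Markov's inequality and [sphere_excess] bound the mass of such points. *)
Lemma sphere_few_ones_le :
  \sum_(n : point | (norm1 n == K) && (2 * #|[set i | n i == 1 :> nat]| < K)%N) weight n <=
  4 * (K%:R / d%:R) * sphere_mass K.
Proof.
have KR : 0 < K%:R :> R by rewrite ltr0n.
have kK : (K.-1 < K)%N by lia.
have h1 := sphere_excess R d kK; have h2 := sphere_growth R dK kK.
rewrite prednK // in h1 h2.
apply: (@le_trans _ _ (4 / K%:R * \sum_(n : point | norm1 n == K) weight n * \sum_i (n i).-1%:R)).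
  rewrite mulr_sumr [leRHS](bigID (fun n => (2 * #|[set i | n i == 1 :> nat]| < K)%N)) /=.
  rewrite -[leLHS]addr0; apply: lerD; last first.
    apply: sumr_ge0 => n _; rewrite mulr_ge0 ?divr_ge0 // mulr_ge0 ?weight_ge0 //.
    by apply: sumr_ge0.
  apply: ler_sum => n /andP[/eqP nK nj].
  rewrite mulrCA ler_peMr ?weight_ge0 // mulrAC ler_pdivlMr // mul1r.
  have : (K <= #|[set i | n i == 1 :> nat]| + 2 * \sum_i (n i).-1)%N.
    rewrite -[leqLHS]nK /norm1 -sum1_card big_distrr /= [X in (_ <= X + _)%N]big_mkcond -big_split /=.
    apply: leq_sum => i _; rewrite inE; case: (nat_of_ord (n i)) => [|[|u]] //=; lia.
  rewrite -natr_sum -natrM ler_nat; move: nj; set j := #|_|; set e := (\sum_i _)%N; move: j e => j e; lia.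
rewrite h1 [leLHS](_ : _ = 4 * (K.-1%:R * sphere_mass K.-1) / K%:R); last by ring.
rewrite ler_pdivrMr //.
have : K.-1%:R <= K%:R :> R by rewrite ler_nat leq_pred.
move=> h; have := ler_wpM2r (sphere_ge0 R d K K.-1) h => h3.
have h4 : sphere_mass K.-1 <= K%:R / d%:R * sphere_mass K by rewrite mulrAC ler_pdivlMr // mulrC.
have := ler_wpM2l (ltW KR) h4; lra.
Qed.

(** Erasing the ones fibres the sphere. The fibre over [w] consists of all sets of ones of a fixed
    size among the zeros of [w]; the weight is constant on it, and the symbol sums to an elementary
    symmetric polynomial in the cosines. *)
Definition skeleton n : point := [ffun i => if n i == 1 :> nat then ord0 else n i].
Definition ones n : {set 'I_d} := [set i | n i == 1 :> nat].
Definition add_ones w (A : {set 'I_d}) : point := [ffun i => if i \in A then inord 1 else w i].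

Lemma inord1 : (inord 1 : 'I_K.+1) = 1%N :> nat.
Proof. by rewrite inordK. Qed.

Section Fiber.
Variable w : point.
Hypothesis w1 : forall i, w i != 1 :> nat.
Let C := [set i | w i == 0 :> nat].

Lemma ones_add A : ones (add_ones w A) = A.
Proof.
apply/setP => i; rewrite inE ffunE; case: ifP => iA; first by rewrite inord1.
by apply/negbTE; exact: w1.
Qed.

Lemma add_ones_fiber A :
  (norm1 (add_ones w A) == K) && (skeleton (add_ones w A) == w) =
  (A \subset C) && (norm1 w + #|A| == K)%N.
Proof.
have [AC|AC] := boolP (A \subset C); last first.
  apply/negbTE/negP => /andP[_ /eqP/ffunP E].
  case/subsetPn: AC => i iA; rewrite inE; have := E i.
  by rewrite !ffunE iA inord1 eqxx => <-.
have -> : skeleton (add_ones w A) == w.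
  apply/eqP/ffunP => i; rewrite !ffunE; have [iA|iA] := boolP (i \in A).
    have := subsetP AC _ iA; rewrite inE inord1 eqxx => /eqP wi.
    exact/val_inj.
  by rewrite (negPf (w1 i)).
rewrite andbT /norm1 -[#|A|]sum1_card [(\sum_(i in A) 1)%N]big_mkcond -big_split /=.
congr (_ == _); apply: eq_bigr => i _; rewrite ffunE; case: ifP => iA; last by rewrite addn0.
by have := subsetP AC _ iA; rewrite inE inord1 => /eqP ->.
Qed.

Lemma weight_add_ones (A : {set 'I_d}) : A \subset C -> weight (add_ones w A) = weight w * 2 ^+ #|A|.
Proof.
move=> AC; rewrite /weight -prodr_const [X in _ * X]big_mkcond -big_split /=.
apply: eq_bigr => i _; rewrite ffunE; case: ifP => iA; last by rewrite mulr1.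
by have := subsetP AC _ iA; rewrite inE inord1 /wt /= => ->; rewrite mul1r.
Qed.

Lemma symbol_add_ones xi (A : {set 'I_d}) : A \subset C ->
  symbol xi (add_ones w A) = symbol xi w * \prod_(i in A) cos (xi i).
Proof.
move=> AC; rewrite /symbol [X in _ * X]big_mkcond -big_split /=.
apply: eq_bigr => i _; rewrite ffunE; case: ifP => iA; last by rewrite mulr1.
by have := subsetP AC _ iA; rewrite inE inord1 => /eqP->; rewrite mul0r cos0 !mul1r.
Qed.

Lemma fiber_sum (H : point -> R) :
  \sum_(n : point | (norm1 n == K) && (skeleton n == w)) H n =
  \sum_(A : {set 'I_d} | (A \subset C) && (norm1 w + #|A| == K)%N) H (add_ones w A).
Proof.
rewrite (reindex_onto (add_ones w) ones) /=.
  by apply: eq_bigl => A; rewrite add_ones_fiber ones_add eqxx andbT.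
move=> n /andP[_ /eqP E]; apply/ffunP => i; rewrite ffunE inE -E ffunE.
by case: eqP => // ni; apply: val_inj; rewrite /= inord1.
Qed.

Lemma le1_add_ones (A : {set 'I_d}) i : A \subset C -> (add_ones w A i <= 1)%N = (i \in C).
Proof.
move=> AC; rewrite ffunE; have [iA|iA] := boolP (i \in A).
  by rewrite inord1 (subsetP AC).
by rewrite inE; have := w1 i; case: (nat_of_ord (w i)) => [|[|u]].
Qed.

Lemma card_fiber_zeros : (norm1 w <= K)%N -> (d <= #|C| + K)%N.
Proof.
move=> wK; apply: (@leq_trans (#|C| + norm1 w)); last by rewrite leq_add2l.
rewrite -sum1_card /norm1 [X in (X + _)%N]big_mkcond -big_split /=.
rewrite -[leqLHS]card_ord -sum1_card; apply: leq_sum => i _; rewrite inE.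
by case: (nat_of_ord (w i)).
Qed.

(** If X is the mean of [hsin] over [C], the mean cosine is 1 - 2X and the base in [esym_sqr_le] is
    1 - 2X(1 - X). Since X(1 - X) is at least half of X or of 1 - X, one of two exponentials
    dominates. They are written as products over [C] because [C] varies with the skeleton; in this
    form permutations can still average them. *)
Lemma norm_esym_le xi (j : nat) : (norm1 w <= K)%N -> (j <= K)%N -> (K <= 2 * j)%N ->
  `|\sum_(A : {set 'I_d} | (A \subset C) && (#|A| == j)) \prod_(i in A) cos (xi i)| <=
  'C(#|C|, j)%:R * (\prod_(i in C) expR (- (K%:R / (4 * d%:R) * hsin xi i)) +
                    \prod_(i in C) expR (- (K%:R / (4 * d%:R) * (1 - hsin xi i)))).
Proof.
move=> wK jK Kj; have cC := card_fiber_zeros wK.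
have j0 : (0 < j)%N by lia.
have jC : (j.*2 <= #|C|)%N by lia.
have nR : 0 < #|C|%:R :> R by rewrite ltr0n; lia.
have nd : #|C|%:R <= d%:R :> R.
  by rewrite ler_nat; have := max_card (mem C); rewrite card_ord.
have jR : K%:R / 2 <= j%:R :> R by rewrite ler_pdivrMr // mulrC -natrM ler_nat.
have KR : 0 <= K%:R :> R by [].
set X := (\sum_(i in C) hsin xi i) / #|C|%:R.
have X0 : 0 <= X by rewrite divr_ge0 // sumr_ge0 // => i _; apply: hsin_ge0.
have mE : (\sum_(i in C) cos (xi i)) / #|C|%:R = 1 - 2 * X.
  under eq_bigr do rewrite cosE_half -/(hsin xi _).
  by rewrite sumrB sumr_const -mulr_sumr mulrBl divff ?gt_eqF // mulrA.
have XE : (\sum_(i in C) (1 - hsin xi i)) / #|C|%:R = 1 - X.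
  by rewrite sumrB sumr_const mulrBl divff ?gt_eqF.
have X1 : 0 <= 1 - X.
  by rewrite -XE divr_ge0 // sumr_ge0 // => i _; rewrite subr_ge0 hsin_le1.
have expP (s : 'I_d -> R) (Y : R) : (\sum_(i in C) s i) / #|C|%:R = Y -> 0 <= Y ->
    expR (- (K%:R / 4 * Y)) <= \prod_(i in C) expR (- (K%:R / (4 * d%:R) * s i)).
  move=> YE Y0; rewrite -expR_sum ler_expR sumrN lerN2 -mulr_sumr.
  have -> : \sum_(i in C) s i = Y * #|C|%:R by rewrite -YE divfK ?gt_eqF.
  have -> : K%:R / (4 * d%:R) * (Y * #|C|%:R) = K%:R / 4 * Y * #|C|%:R / d%:R.
    by field; rewrite gt_eqF.
  rewrite ler_pdivrMr //; apply: ler_wpM2l => //.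
  by rewrite mulr_ge0 // divr_ge0.
have h1 := expP _ _ erefl X0; have h2 := expP _ _ XE X1.
apply: (@le_trans _ _ ('C(#|C|, j)%:R * expR (- (j%:R * (X * (1 - X)))))).
  rewrite -ler_sqr ?nnegrE ?mulr_ge0 ?expR_ge0 // real_normK ?num_real //.
  have := @esym_sqr_le R 'I_d C (fun i => cos (xi i)) j (fun i => cos_max _) j0 jC.
  rewrite mE => h; apply: le_trans h _; rewrite exprMn; apply: ler_wpM2l; first exact: sqr_ge0.
  apply: le_trans (geom_le_expR _ _) _.
    have := sqr_ge0 (1 - 2 * X); lra.
  by rewrite -expRM_natl ler_expR le_eqVlt; apply/orP; left; apply/eqP; field.
apply: ler_wpM2l => //.
have p1 : 0 <= \prod_(i in C) expR (- (K%:R / (4 * d%:R) * hsin xi i)).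
  by apply: prodr_ge0 => i _; apply: expR_ge0.
have p2 : 0 <= \prod_(i in C) expR (- (K%:R / (4 * d%:R) * (1 - hsin xi i))).
  by apply: prodr_ge0 => i _; apply: expR_ge0.
have hj := ler_wpM2r (mulr_ge0 X0 X1) jR.
have [X2|X2] := leP X (2^-1).
  apply: (@le_trans _ _ (expR (- (K%:R / 4 * X)))); last lra.
  have hX : X / 2 <= X * (1 - X) by nra.
  rewrite ler_expR lerN2; have := ler_wpM2l KR hX; lra.
apply: (@le_trans _ _ (expR (- (K%:R / 4 * (1 - X))))); last lra.
have hX : (1 - X) / 2 <= X * (1 - X) by nra.
rewrite ler_expR lerN2; have := ler_wpM2l KR hX; lra.
Qed.

(** A majorant that no longer mentions the skeleton: on a fibre, [C] is recovered as the set of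
    coordinates at most 1. *)
Definition fiber_weight xi n : R :=
  \prod_(i | (n i <= 1)%N) expR (- (K%:R / (4 * d%:R) * hsin xi i)) +
  \prod_(i | (n i <= 1)%N) expR (- (K%:R / (4 * d%:R) * (1 - hsin xi i))) +
  (2 * #|ones n| < K)%N%:R.

Lemma fiber_symbol_le xi :
  `|\sum_(n : point | (norm1 n == K) && (skeleton n == w)) weight n * symbol xi n| <=
  \sum_(n : point | (norm1 n == K) && (skeleton n == w)) weight n * fiber_weight xi n.
Proof.
rewrite !fiber_sum.
have [wK|wK] := leqP (norm1 w) K; last first.
  by rewrite !big_pred0 ?normr0 // => A; apply/negbTE; rewrite negb_and; apply/orP; right; lia.
pose j := (K - norm1 w)%N.
have jE (A : {set 'I_d}) : (norm1 w + #|A| == K)%N = (#|A| == j) by rewrite /j; apply/eqP/eqP; lia.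
rewrite !(eq_bigl _ _ (fun A => congr1 (andb _) (jE A))).
set B := \prod_(i in C) expR (- (K%:R / (4 * d%:R) * hsin xi i)).
set B' := \prod_(i in C) expR (- (K%:R / (4 * d%:R) * (1 - hsin xi i))).
have B0 : 0 <= B by apply: prodr_ge0 => i _; apply: expR_ge0.
have B0' : 0 <= B' by apply: prodr_ge0 => i _; apply: expR_ge0.
have W0 : 0 <= weight w * 2 ^+ j by rewrite mulr_ge0 ?weight_ge0 // exprn_ge0.
have card_draw : \sum_(A : {set 'I_d} | (A \subset C) && (#|A| == j)) 1 = 'C(#|C|, j)%:R :> R.
  by rewrite sumr_const -cards_draws; congr (_ *+ _); apply: eq_card => A; rewrite !inE.
have -> : \sum_(A : {set 'I_d} | (A \subset C) && (#|A| == j))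
      weight (add_ones w A) * fiber_weight xi (add_ones w A) =
    weight w * 2 ^+ j * ('C(#|C|, j)%:R * (B + B' + (2 * j < K)%N%:R)).
  rewrite -card_draw mulr_suml mulr_sumr; apply: eq_bigr => A /andP[AC /eqP Aj].
  rewrite weight_add_ones // Aj mul1r; congr (_ * (_ + _ + _)).
  - by apply: eq_bigl => i; apply: le1_add_ones.
  - by apply: eq_bigl => i; apply: le1_add_ones.
  - by rewrite ones_add Aj.
have -> : \sum_(A : {set 'I_d} | (A \subset C) && (#|A| == j))
      weight (add_ones w A) * symbol xi (add_ones w A) =
    weight w * 2 ^+ j * symbol xi w *
      \sum_(A : {set 'I_d} | (A \subset C) && (#|A| == j)) \prod_(i in A) cos (xi i).
  rewrite mulr_sumr; apply: eq_bigr => A /andP[AC /eqP Aj].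
  by rewrite weight_add_ones // symbol_add_ones // Aj !mulrA.
rewrite normrM normrM (ger0_norm W0) -mulrA; apply: ler_wpM2l => //.
apply: (@le_trans _ _ `|\sum_(A : {set 'I_d} | (A \subset C) && (#|A| == j)) \prod_(i in A) cos (xi i)|).
  by rewrite ler_piMl // norm_symbol_le1.
(* A fibre with fewer than K/2 ones gets the trivial bound, paid for by the indicator in
   [fiber_weight]. *)
have [jK|jK] := ltnP (2 * j) K.
  apply: (@le_trans _ _ ('C(#|C|, j)%:R * 1)); last by apply: ler_wpM2l => //=; lra.
  rewrite mulr1 -card_draw; apply: le_trans (ler_norm_sum _ _ _) _; apply: ler_sum => A _.
  rewrite normr_prod; apply: (@le_trans _ _ (\prod_(i in A) 1)); last by rewrite big1.
  by apply: ler_prod => i _; rewrite normr_ge0 cos_max.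
by rewrite /= addr0; apply: norm_esym_le => //; rewrite /j leq_subr.
Qed.

End Fiber.

(** At least d/2 coordinates are at most 1, and each gains K/(4d) times half the mean of [s]:
    together K/16 times that mean. *)
Lemma sparse_prod_le (s : 'I_d -> R) : (forall i, 0 <= s i <= 1) ->
  \sum_(n : point | norm1 n == K) weight n *
    \prod_(i | (n i <= 1)%N) expR (- (K%:R / (4 * d%:R) * s i)) <=
  expR (- (K%:R * ((\sum_i s i) / d%:R) / 16)) * sphere_mass K.
Proof.
move=> s01.
have KR : 0 <= K%:R :> R by [].
have c0 : 0 <= K%:R / (4 * d%:R) :> R by rewrite divr_ge0 // mulr_ge0.
have c1 : K%:R / (4 * d%:R) <= 1 :> R.
  by rewrite ler_pdivrMr ?mulr_gt0 // mul1r -natrM ler_nat; lia.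
apply: le_trans (@exchangeable_sum_le R d K _ (leq^~ 1%N) _ _ _) _.
- by move=> n p; rewrite norm1_permn.
- by move=> i; apply: expR_ge0.
rewrite [leRHS]mulrC /sphere_mass [leRHS]mulr_suml; apply: ler_sum => n /eqP nK.
apply: ler_wpM2l; first exact: weight_ge0.
apply: le_trans (geom_le_expR _ _) _.
  by rewrite divr_ge0 // sumr_ge0 // => i _; apply: expR_ge0.
rewrite ler_expR lerN2.
have cT : (d <= 2 * #|[set i | (n i <= 1)%N]|)%N.
  have : (d <= #|[set i | (n i <= 1)%N]| + norm1 n)%N.
    rewrite -sum1_card /norm1 [X in (X + _)%N]big_mkcond -big_split /=.
    rewrite -[leqLHS]card_ord -sum1_card; apply: leq_sum => i _; rewrite inE.
    by case: (nat_of_ord (n i)) => [|[|u]].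
  lia.
have h := @avg_expR_le R d (K%:R / (4 * d%:R)) s _ _ c0 _.
have {}h : K%:R / (4 * d%:R) * (\sum_i s i) / (2 * d%:R) <=
    1 - (\sum_i expR (- (K%:R / (4 * d%:R) * s i))) / d%:R.
  apply: h => [|i|i]; first by lia.
    by case/andP: (s01 i).
  by case/andP: (s01 i) => s0 s1; rewrite mulr_ile1.
have S0 : 0 <= \sum_i s i by apply: sumr_ge0 => i _; case/andP: (s01 i).
have cT' : d%:R / 2 <= #|[set i | (n i <= 1)%N]|%:R :> R.
  by rewrite ler_pdivrMr // mulrC -natrM ler_nat.
apply: le_trans (ler_pM _ _ cT' h).
- by rewrite le_eqVlt; apply/orP; left; apply/eqP; field; rewrite gt_eqF.
- by rewrite divr_ge0.
- by apply: divr_ge0; [apply: mulr_ge0 | rewrite mulr_ge0].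
Qed.

Lemma sphere_symbol_decay xi (x : R) : x = (\sum_i hsin xi i) / d%:R ->
  `|sphere_symbol xi| <= 4 * (K%:R / d%:R) + expR (- (K%:R * x / 16)) +
    expR (- (K%:R * (1 - x) / 16)).
Proof.
move=> xE; have s0 := sphere_gt0.
rewrite /sphere_symbol normrM normfV (gtr0_norm s0) ler_pdivrMr //.
rewrite (partition_big skeleton (fun w => [forall i, w i != 1 :> nat])) /=; last first.
  move=> n _; apply/forallP => i; rewrite ffunE.
  by case: ifP => [//|/negbT].
apply: le_trans (ler_norm_sum _ _ _) _.
apply: (@le_trans _ _ (\sum_(n : point | norm1 n == K) weight n * fiber_weight xi n)).
  rewrite [leRHS](partition_big skeleton (fun w => [forall i, w i != 1 :> nat])) /=; last first.
    move=> n _; apply/forallP => i; rewrite ffunE.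
    by case: ifP => [//|/negbT].
  by apply: ler_sum => w /forallP w1; apply: fiber_symbol_le.
rewrite /fiber_weight; under eq_bigr do rewrite !mulrDr.
rewrite !big_split /= [leRHS]mulrDl [X in _ <= X + _]mulrDl [leLHS]addrC addrA.
apply: lerD; last first.
  have E : 1 - x = (\sum_i (1 - hsin xi i)) / d%:R.
    by rewrite sumrB sumr_const card_ord mulrBl divff ?gt_eqF // xE.
  rewrite E; apply: (sparse_prod_le (s := fun i => 1 - hsin xi i)) => i.
  by rewrite subr_ge0 hsin_le1 lerBlDr lerDl hsin_ge0.
rewrite xE; apply: lerD; last first.
  by apply: (sparse_prod_le (s := hsin xi)) => i; rewrite hsin_ge0 hsin_le1.
apply: le_trans _ sphere_few_ones_le.
rewrite [leRHS]big_mkcondr /=; apply: ler_sum => n _.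
by rewrite /ones; case: ifP => _; rewrite ?mulr1 ?mulr0.
Qed.

End SparseEstimates.

(** * Summation over dyadic scales *)

Section DyadicSum.
Variable R : realType.
Implicit Types y z : R.

Definition peak z : R := Num.min z z^-1.

Lemma peak_ge0 z : 0 <= z -> 0 <= peak z.
Proof. by move=> z0; rewrite /peak le_min z0 invr_ge0. Qed.

Lemma peak_small z : 0 <= z <= 1 -> peak z = z.
Proof.
move=> /andP[]; rewrite le_eqVlt => /orP[/eqP <- _|z0 z1].
  (* At 0 the convention that 0 has inverse 0 gives the desired value. *)
  by rewrite /peak invr0 minxx.
by rewrite /peak; apply: min_l; rewrite -[leLHS]mulr1 -ler_pdivlMl // -expr2 exprn_ege1 // invf_ge1.
Qed.

Lemma peak_large z : 1 <= z -> peak z = z^-1.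
Proof.
move=> z1; have z0 : 0 < z by lra.
rewrite /peak; apply: min_r; apply: (@le_trans _ _ 1) => //.
by rewrite invf_le1.
Qed.

(* [6 z / (1 + z)] is a bounded potential whose increment along [z -> 2 z] dominates [peak]. *)
Lemma peak_le_increment z : 0 <= z -> peak z <= 6 * (2 * z) / (1 + 2 * z) - 6 * z / (1 + z).
Proof.
move=> z0; have -> : 6 * (2 * z) / (1 + 2 * z) - 6 * z / (1 + z) =
    6 * z / ((1 + 2 * z) * (1 + z)).
  have h1 : 1 + 2 * z != 0 by rewrite gt_eqF //; lra.
  have h2 : 1 + z != 0 by rewrite gt_eqF //; lra.
  by field; rewrite h1 h2.
have p : 0 < (1 + 2 * z) * (1 + z) by apply: mulr_gt0; lra.
rewrite ler_pdivlMr //.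
have [z1|z1] := leP z 1.
  rewrite peak_small ?z0 // mulrC; apply: ler_wpM2r => //; nra.
have z0' : 0 < z by lra.
rewrite peak_large ?(ltW z1) // mulrC ler_pdivrMr //; nra.
Qed.

Lemma sum_peak_le y (N : nat) : 0 <= y -> \sum_(n < N) peak (y * 2 ^+ n) <= 6.
Proof.
move=> y0; pose P z := 6 * z / (1 + z).
have : \sum_(n < N) peak (y * 2 ^+ n) <= P (y * 2 ^+ N) - P y.
  elim: N => [|N IHN]; first by rewrite big_ord0 expr0 mulr1 subrr.
  rewrite big_ord_recr /=.
  have := @peak_le_increment (y * 2 ^+ N); rewrite mulr_ge0 ?exprn_ge0 // => /(_ isT).
  have -> : 2 * (y * 2 ^+ N) = y * 2 ^+ N.+1 by rewrite exprS; ring.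
  rewrite -/(P _) -/(P (y * 2 ^+ N)); lra.
have y2 : 0 <= y * 2 ^+ N by rewrite mulr_ge0 ?exprn_ge0.
have h1 : P (y * 2 ^+ N) <= 6 by rewrite /P ler_pdivrMr; lra.
have h2 : 0 <= P y by rewrite /P divr_ge0 //; lra.
lra.
Qed.

Lemma sub1_geom_le z (t : nat) : -1 <= z <= 1 -> `|1 - z ^+ t| <= t%:R * (1 - z).
Proof.
move=> /andP[z0 z1]; elim: t => [|t IHt]; first by rewrite expr0 subrr normr0 mul0r.
have nz : `|z| <= 1 by rewrite ler_norml z0 z1.
have -> : 1 - z ^+ t.+1 = (1 - z) + z * (1 - z ^+ t) by rewrite exprS; ring.
apply: le_trans (ler_normD _ _) _; rewrite ger0_norm; last lra.
have h : `|z * (1 - z ^+ t)| <= t%:R * (1 - z).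
  by rewrite normrM; apply: le_trans IHt; rewrite ler_piMl.
rewrite -natr1 mulrDl mul1r; lra.
Qed.

(** Chosen so that time * x is comparable to (K/d)^2 S, with x = S/d. The successor makes it at
    least that large in spite of the rounding. *)
Definition dense_time (d K : nat) : nat := (K ^ 2 %/ d).+1.

Definition approx_symbol (d K : nat) (x : R) : R :=
  if (8 * K <= d)%N then (1 - 2 * x) ^+ K else
  if (d <= K)%N then (1 - x) ^+ (2 * dense_time d K) else 0.

Lemma sqr_le2 (a b c : R) : `|a| <= b + c -> a ^+ 2 <= 2 * b ^+ 2 + 2 * c ^+ 2.
Proof.
move=> h; have : a ^+ 2 <= (b + c) ^+ 2.
  rewrite -(real_normK (num_real a)); apply: lerXn2r; rewrite ?nnegrE //.
  by apply: le_trans h.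
have := sqr_ge0 (b - c); nra.
Qed.

Lemma peak_sqr_le z : 0 <= z -> peak z ^+ 2 <= peak z.
Proof.
move=> z0; have [z1|z1] := leP z 1.
  rewrite peak_small ?z0 //; nra.
have z' : 0 < z by lra.
have : z^-1 <= 1 by rewrite invf_le1 // ltW.
have : 0 <= z^-1 by rewrite invr_ge0.
rewrite peak_large ?(ltW z1) //; nra.
Qed.

Lemma le_peak (e A z : R) : 0 <= A -> 0 <= z -> e <= A * z -> (0 < z -> e <= A / z) -> e <= A * peak z.
Proof.
move=> A0 z0 h1 h2; have [z1|z1] := leP z 1; first by rewrite peak_small ?z0.
by rewrite peak_large ?(ltW z1) // h2 //; lra.
Qed.

(** * The error at a single scale *)

Section Scale.
Variables (d : nat) (xi : 'I_d -> R).
Hypothesis d0 : (0 < d)%N.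
Let S := \sum_i hsin xi i.
Let x := S / d%:R.

Let dR : 0 < d%:R :> R. Proof. by rewrite ltr0n. Qed.
Let S0 : 0 <= S. Proof. by apply: sumr_ge0 => i _; apply: hsin_ge0. Qed.

Lemma havg_ge0 : 0 <= x.
Proof. by rewrite divr_ge0. Qed.

Lemma havg_le1 : x <= 1.
Proof.
rewrite ler_pdivrMr // mul1r -[d in d%:R]card_ord -sumr_const.
by apply: ler_sum => i _; apply: hsin_le1.
Qed.

(** Near x = 0 and near x = 1 both multipliers are close to 1; away from these points both are
    small. The distance min(x, 1 - x) therefore governs the error. *)
Lemma sparse_scale (K : nat) : (0 < K)%N -> ~~ odd K -> (8 * K <= d)%N ->
  `|ball_symbol K xi - (1 - 2 * x) ^+ K| <=
    8 * (K%:R / d%:R) + 33 * peak (Num.min x (1 - x) * K%:R).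
Proof.
move=> K0 oK dK; have x0 := havg_ge0; have x1 := havg_le1.
have KR : 0 <= K%:R :> R by [].
have u0 : 0 <= K%:R / d%:R :> R by rewrite divr_ge0.
have h1 := ball_symbol_sphere_symbol K0 dK xi.
have h2 := sphere_symbol_sub1 K0 dK xi.
have h3 := sphere_symbol_sub1 K0 dK (reflect_pi xi).
rewrite sphere_symbol_reflect // in h3.
have Sr : (\sum_i hsin (reflect_pi xi) i) / d%:R = 1 - x.
  under eq_bigr do rewrite hsin_reflect.
  by rewrite sumrB sumr_const card_ord mulrBl divff ?gt_eqF.
rewrite Sr in h3; rewrite -/S -/x in h2.
have h4 := sphere_symbol_decay K0 dK (erefl x).
have h5 : `|1 - (1 - 2 * x) ^+ K| <= K%:R * (2 * x).
  have := @sub1_geom_le (1 - 2 * x) K; rewrite opprB addrCA subrr addr0; apply; lra.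
have ev : (1 - 2 * x) ^+ K = (1 - 2 * (1 - x)) ^+ K.
  have -> : 1 - 2 * (1 - x) = - (1 - 2 * x) by ring.
  by rewrite exprNn -signr_odd (negPf oK) expr0 mul1r.
have h6 : `|1 - (1 - 2 * x) ^+ K| <= K%:R * (2 * (1 - x)).
  rewrite ev; have := @sub1_geom_le (1 - 2 * (1 - x)) K; rewrite opprB addrCA subrr addr0; apply; lra.
set m := Num.min x (1 - x).
have m0 : 0 <= m by rewrite le_min; lra.
have mle : m <= x /\ m <= 1 - x by split; rewrite ge_min lexx ?orbT.
set z := m * K%:R; have z0 : 0 <= z by rewrite mulr_ge0.
rewrite -lerBlDl; apply: le_peak => //.
- have : `|ball_symbol K xi - (1 - 2 * x) ^+ K| <= 4 * (K%:R / d%:R) +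
     `|1 - sphere_symbol K xi| + `|1 - (1 - 2 * x) ^+ K|.
    have -> : ball_symbol K xi - (1 - 2 * x) ^+ K =
      (ball_symbol K xi - sphere_symbol K xi) - (1 - sphere_symbol K xi) + (1 - (1 - 2 * x) ^+ K) by ring.
    apply: le_trans (ler_normD _ _) _; rewrite lerD2r.
    by apply: le_trans (ler_normB _ _) _; rewrite lerD2r.
  have : `|1 - sphere_symbol K xi| + `|1 - (1 - 2 * x) ^+ K| <= 10 * z.
    rewrite /z /m; case: (leP x (1 - x)) => _; lra.
  lra.
move=> z_gt0.
(* Two exponentials, each at most 16/z, make 32; the random walk adds the last 1 of the constant
   33. *)
have n1 : `|sphere_symbol K xi| <= 4 * (K%:R / d%:R) + 32 / z.
  have e1 : expR (- (K%:R * x / 16)) <= 16 / z.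
    apply: (@le_trans _ _ (expR (- (z / 16)))).
      rewrite ler_expR lerN2 /z; have := ler_wpM2r KR (proj1 mle); lra.
    by apply: le_trans (expR_opp_le_inv _) _; rewrite ?divr_gt0 // invf_div.
  have e2 : expR (- (K%:R * (1 - x) / 16)) <= 16 / z.
    apply: (@le_trans _ _ (expR (- (z / 16)))).
      rewrite ler_expR lerN2 /z; have := ler_wpM2r KR (proj2 mle); lra.
    by apply: le_trans (expR_opp_le_inv _) _; rewrite ?divr_gt0 // invf_div.
  lra.
have n2 : `|(1 - 2 * x) ^+ K| <= 1 / z.
  rewrite normrX; apply: le_trans (geom_le_expR _ _) _ => //.
  apply: (@le_trans _ _ (expR (- z))); last by rewrite mul1r expR_opp_le_inv.
  rewrite ler_expR lerN2 /z mulrC; apply: ler_wpM2l => //.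
  case: mle => mx m1x; have [h|h] := leP 0 (1 - 2 * x).
    by rewrite ger0_norm //; lra.
  by rewrite ltr0_norm //; lra.
have : `|ball_symbol K xi - (1 - 2 * x) ^+ K| <= 4 * (K%:R / d%:R) +
   `|sphere_symbol K xi| + `|(1 - 2 * x) ^+ K|.
  have -> : ball_symbol K xi - (1 - 2 * x) ^+ K =
    (ball_symbol K xi - sphere_symbol K xi) + sphere_symbol K xi - (1 - 2 * x) ^+ K by ring.
  apply: le_trans (ler_normB _ _) _; rewrite lerD2r.
  by apply: le_trans (ler_normD _ _) _; rewrite lerD2r.
lra.
Qed.


Section Dense.
Variable K : nat.
Hypothesis dK : (d <= K)%N.
Let r : R := K%:R / d%:R.
Let Q := r ^+ 2 * S.
Let v := (1 - x) ^+ (2 * dense_time d K).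

Let r1 : 1 <= r. Proof. by rewrite /r ler_pdivlMr // mul1r ler_nat. Qed.
Let Q0 : 0 <= Q. Proof. by rewrite mulr_ge0 ?sqr_ge0. Qed.

Lemma dense_time_bounds : Q <= (dense_time d K)%:R * x <= 2 * Q.
Proof.
have E : Q = K%:R ^+ 2 / d%:R * x by rewrite /Q /r /x; field; rewrite gt_eqF.
rewrite E [2 * _]mulrA.
apply/andP; split; apply: ler_wpM2r; rewrite ?havg_ge0 //.
  rewrite ler_pdivrMr // -natrX -natrM ler_nat /dense_time.
  by have := divn_eq (K ^ 2) d; have := ltn_pmod (K ^ 2) d0; lia.
rewrite /dense_time -natr1.
have h1 : (K ^ 2 %/ d)%:R <= K%:R ^+ 2 / d%:R :> R.
  by rewrite ler_pdivlMr // -natrX -natrM ler_nat leq_trunc_div.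
have h2 : 1 <= K%:R ^+ 2 / d%:R :> R.
  rewrite ler_pdivlMr // mul1r -natrX ler_nat; apply: leq_trans dK _.
  by rewrite expnS expn1 leq_pmulr //; lia.
lra.
Qed.

Lemma dense_approx_sub1 : `|1 - v| <= 4 * Q.
Proof.
have := @sub1_geom_le (1 - x) (2 * dense_time d K); rewrite opprB addrCA subrr addr0.
have x0 := havg_ge0; have x1 := havg_le1; have /andP[_ h] := dense_time_bounds.
move=> h2; apply: le_trans (h2 _) _; first lra.
by rewrite natrM -mulrA; lra.
Qed.

Lemma dense_approx_decay : 0 < Q -> `|v| <= (2 * Q)^-1.
Proof.
move=> Qp; have x0 := havg_ge0; have x1 := havg_le1; have /andP[h _] := dense_time_bounds.
have x1' : 0 <= 1 - x by lra.
rewrite /v ger0_norm ?exprn_ge0 //; apply: le_trans (geom_le_expR _ x1') _.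
apply: (@le_trans _ _ (expR (- (2 * Q)))); last by apply: expR_opp_le_inv; lra.
by rewrite ler_expR lerN2 natrM opprB addrCA subrr addr0 -mulrA; lra.
Qed.

(** No single frequency is large. For q <= 1 both multipliers are within O(q^2) of 1, and 44^2 <
    2000; for q > 1 both decay. *)
Lemma dense_scale_regular : (forall i, r ^+ 2 * hsin xi i <= 64^-1) ->
  (ball_symbol K xi - v) ^+ 2 <= 2000 * peak (r * Num.sqrt S) + 32 * peak r.
Proof.
move=> reg; have r_ge1 := r1; set q := r * Num.sqrt S.
have qQ : q ^+ 2 = Q by rewrite exprMn sqr_sqrtr.
have q0 : 0 <= q by rewrite mulr_ge0 ?sqrtr_ge0 //; lra.
have br := peak_ge0 (le_trans ler01 r1).
have dK' : (0 < d <= K)%N by rewrite d0.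
have [q1|q1] := leP q 1.
  have h1 := dense_symbol_sub1 xi dK'; have h2 := dense_approx_sub1.
  rewrite -/S -/r -/Q in h1.
  have h : `|ball_symbol K xi - v| <= 44 * Q.
    have -> : ball_symbol K xi - v = (1 - v) - (1 - ball_symbol K xi) by ring.
    apply: le_trans (ler_normB _ _) _; lra.
  have : (ball_symbol K xi - v) ^+ 2 <= (44 * Q) ^+ 2.
    by rewrite -(real_normK (num_real (_ - v))); apply: lerXn2r; rewrite ?nnegrE // mulr_ge0.
  rewrite peak_small ?q0 // exprMn -qQ => h3.
  have q2 : q ^+ 2 <= q by rewrite expr2 ler_piMr.
  have q4 : (q ^+ 2) ^+ 2 <= q.
    apply: le_trans q2; rewrite [leLHS]expr2 ler_piMr ?sqr_ge0 // exprn_ile1 //.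
  have := br; lra.
have qp : 0 < q by lra.
(* The threshold [a], about r/w, is chosen so that 4a/r is about 4/w, with square of order 1/q,
   while a^2 S >= q keeps the exponential below 8/w. Rounding [a] up costs 4/r, the source of
   [peak r]. *)
set w := Num.sqrt q.
have w2 : w ^+ 2 = q by rewrite sqr_sqrtr // ltW.
have wp : 0 < w by rewrite sqrtr_gt0.
have w1 : 1 <= w by rewrite -(sqrtr1 R) ler_wsqrtr // ltW.
have wi : 0 < w^-1 by rewrite invr_gt0.
have wi1 : w^-1 <= 1 by rewrite invf_le1.
have rw0 : 0 < r / w by rewrite divr_gt0 //; lra.
set a := (Num.truncn (r / w)).+1.
have /andP[ta tb] : (a%:R - 1 <= r / w < a%:R).
  by have := truncn_itv (ltW rw0); rewrite /a -natr1 addrK.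
have rwr : r / w <= r by rewrite ler_piMr //; lra.
have h1 := @dense_symbol_decay R d K xi a dK' isT.
have {}h1 : `|ball_symbol K xi| <= 4 * a%:R * (d%:R / K%:R) + expR (- (a%:R ^+ 2 * S / 8)).
  by apply: h1 => //; rewrite -/r; lra.
have KR : 0 < K%:R :> R by rewrite ltr0n (leq_trans d0 dK).
have drE : d%:R / K%:R = r^-1 :> R by rewrite /r invf_div.
rewrite drE in h1.
have h2 : 4 * a%:R * r^-1 <= 4 / w + 4 / r.
  have rp : 0 < r by lra.
  have -> : 4 / w + 4 / r = 4 * (r / w + 1) * r^-1 by field; rewrite !gt_eqF.
  by rewrite ler_pM2r ?invr_gt0 //; lra.
have aS : q <= a%:R ^+ 2 * S.
  have : (r / w) ^+ 2 <= a%:R ^+ 2 by apply: lerXn2r; rewrite ?nnegrE ?ltW.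
  move=> h; apply: le_trans (ler_wpM2r S0 h).
  rewrite expr_div_n w2 mulrAC ler_pdivlMr // -/Q -qQ expr2 //.
have h3 : expR (- (a%:R ^+ 2 * S / 8)) <= 8 / w.
  apply: (@le_trans _ _ (expR (- (q / 8)))); first by rewrite ler_expR lerN2; lra.
  apply: le_trans (expR_opp_le_inv _) _; first by rewrite divr_gt0.
  rewrite invf_div ler_pM2l // lef_pV2 ?posrE // -w2 expr2 ler_peMr //; lra.
have h4 : `|v| <= 1 / w.
  apply: le_trans (dense_approx_decay _) _; first by rewrite -qQ exprn_gt0.
  rewrite mul1r lef_pV2 ?posrE //; last by rewrite -qQ mulr_gt0 // exprn_gt0.
  by rewrite -qQ -w2; have : 1 <= w ^+ 2; [rewrite exprn_ege1|nra].
have : `|ball_symbol K xi - v| <= 13 / w + 4 / r.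
  apply: le_trans (ler_normB _ _) _; lra.
move/sqr_le2.
have -> : (13 / w) ^+ 2 = 169 / q by rewrite -w2; field; rewrite gt_eqF.
have -> : (4 / r) ^+ 2 = 16 * (1 / r ^+ 2) by field; rewrite gt_eqF //; lra.
move=> h5.
rewrite (peak_large (ltW q1)) (peak_large r1).
have : 1 / r ^+ 2 <= r^-1.
  rewrite mul1r lef_pV2 ?posrE ?exprn_gt0 //; try lra.
  by rewrite expr2 ler_peMr //; lra.
have : 0 < q^-1 by rewrite invr_gt0.
move=> h6 h7; lra.
Qed.

(** One large frequency suffices to make both multipliers small separately. Since q and z exceed
    1/8, the trivial bound 1 is already at most 8 times the peak when they are below 1. *)
Lemma dense_scale_irregular i : 64^-1 < r ^+ 2 * hsin xi i ->
  (ball_symbol K xi - v) ^+ 2 <=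
  16 * peak (r * Num.sqrt S) + 16 * peak (r * `|sin (xi i / 2)|).
Proof.
move=> irr; have r_ge1 := r1; set q := r * Num.sqrt S; set z := r * `|sin (xi i / 2)|.
have qQ : q ^+ 2 = Q by rewrite exprMn sqr_sqrtr.
have q0 : 0 <= q by rewrite mulr_ge0 ?sqrtr_ge0 //; lra.
have dK' : (0 < d <= K)%N by rewrite d0.
have z2 : z ^+ 2 = r ^+ 2 * hsin xi i by rewrite exprMn real_normK // num_real.
have z0 : 0 <= z by rewrite mulr_ge0 //; lra.
have z8 : 8^-1 < z.
  rewrite ltNge; apply/negP => h; move: irr; rewrite -z2; nra.
have v1 : `|v| <= 1.
  have x0 := havg_ge0; have x1 := havg_le1.
  by rewrite normrX exprn_ile1 // ger0_norm; lra.
have hv : v ^+ 2 <= 8 * peak q.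
  have hq : 64^-1 < q ^+ 2.
    rewrite qQ; apply: lt_le_trans irr _; apply: ler_wpM2l; first exact: sqr_ge0.
    by rewrite /S (bigD1 i) //= lerDl sumr_ge0 // => j _; apply: hsin_ge0.
  have [q1|q1] := leP q 1.
    rewrite peak_small ?q0 // -(real_normK (num_real v)); apply: (@le_trans _ _ 1).
      by rewrite exprn_ile1.
    nra.
  have qp : 0 < q by lra.
  rewrite peak_large ?(ltW q1) // -(real_normK (num_real v)).
  have : `|v| <= (2 * Q)^-1 by apply: dense_approx_decay; rewrite -qQ exprn_gt0.
  have : (2 * Q)^-1 <= q^-1.
    rewrite -qQ lef_pV2 ?posrE //; last by rewrite mulr_gt0 // exprn_gt0.
    have := sqr_ge0 (q - 1); lra.
  have : `|v| ^+ 2 <= `|v| by rewrite expr2 ler_piMr.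
  have : 0 < q^-1 by rewrite invr_gt0.
  lra.
have hm : ball_symbol K xi ^+ 2 <= 8 * peak z.
  have m1 := norm_ball_symbol_le1 K xi.
  have hd := dense_symbol_dirichlet xi i dK'; rewrite -/r -/z in hd.
  rewrite -(real_normK (num_real (ball_symbol K xi))).
  have [zs|zl] := leP z 1.
    rewrite peak_small ?z0 //; apply: (@le_trans _ _ 1); last lra.
    by rewrite exprn_ile1.
  have zp : 0 < z by lra.
  have m2 : `|ball_symbol K xi| <= z^-1 by rewrite -[leRHS]mul1r ler_pdivlMr // mulrC.
  rewrite peak_large ?(ltW zl) //.
  have : 0 < z^-1 by rewrite invr_gt0.
  have : `|ball_symbol K xi| ^+ 2 <= `|ball_symbol K xi| by rewrite expr2 ler_piMr.
  lra.
have := sqr_ge0 (ball_symbol K xi + v); rewrite !expr2 in hv hm *; lra.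
Qed.

End Dense.
End Scale.
End DyadicSum.

(** * The square function of the errors *)

Section SquareFunction.
Variables (R : realType) (d : nat) (xi : 'I_d -> R).
Hypothesis d0 : (0 < d)%N.
Let S := \sum_i hsin xi i.
Let x := S / d%:R.

(** Taking [i] to maximise [hsin] makes the dichotomy between regular and irregular a condition on
    one coordinate that does not change with [K]. All four peaks are then evaluated along geometric
    progressions in [K]. *)
Lemma scale_error_le i (K : nat) : (0 < K)%N -> ~~ odd K ->
  (forall j, hsin xi j <= hsin xi i) ->
  (ball_symbol K xi - approx_symbol d K x) ^+ 2 <=
  2200 * (peak (Num.min x (1 - x) * K%:R) + peak (d%:R^-1 * K%:R) +
          peak (Num.sqrt S / d%:R * K%:R) + peak (`|sin (xi i / 2)| / d%:R * K%:R)).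
Proof.
move=> K0 oK imax.
have dR : 0 < d%:R :> R by rewrite ltr0n.
have KR : 0 < K%:R :> R by rewrite ltr0n.
have x0 : 0 <= x := havg_ge0 xi; have x1 : x <= 1 := havg_le1 xi d0.
have b1 : 0 <= peak (Num.min x (1 - x) * K%:R).
  by rewrite peak_ge0 // mulr_ge0 ?(ltW KR) // le_min x0 subr_ge0.
have b2 : 0 <= peak (d%:R^-1 * K%:R : R) by rewrite peak_ge0 // mulr_ge0 ?invr_ge0.
have b3 : 0 <= peak (Num.sqrt S / d%:R * K%:R).
  by rewrite peak_ge0 // mulr_ge0 ?divr_ge0 ?sqrtr_ge0.
have b4 : 0 <= peak (`|sin (xi i / 2)| / d%:R * K%:R).
  by rewrite peak_ge0 // mulr_ge0 ?divr_ge0.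
set B1 := peak _ in b1 *; set B2 := peak _ in b2 *.
set B3 := peak _ in b3 *; set B4 := peak _ in b4 *.
rewrite /approx_symbol; case: leqP => [sp|nsp].
  have u1 : 0 <= (d%:R^-1 * K%:R : R) <= 1.
    rewrite mulr_ge0 ?invr_ge0 //= mulrC ler_pdivrMr // mul1r ler_nat.
    by apply: leq_trans sp; rewrite leq_pmull.
  have := sqr_le2 (sparse_scale xi d0 K0 oK sp); rewrite -/S -/x -/B1 => h.
  have h1 : B1 ^+ 2 <= B1.
    by apply: peak_sqr_le; rewrite mulr_ge0 ?(ltW KR) // le_min x0 subr_ge0.
  have h2 : (K%:R / d%:R) ^+ 2 <= B2.
    rewrite /B2 peak_small // mulrC expr2 ler_piMr //; first by case/andP: u1.
    by case/andP: u1.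
  rewrite !exprMn in h; apply: le_trans h _; rewrite exprMn in h2.
  lra.
case: leqP => [dn|mid].
  pose r := K%:R / d%:R : R.
  have E3 : B3 = peak (r * Num.sqrt S) by congr peak; rewrite /r; ring.
  have E2 : B2 = peak r by congr peak; rewrite /r mulrC.
  have E4 : B4 = peak (r * `|sin (xi i / 2)|) by congr peak; rewrite /r; ring.
  have [irr|reg] := ltP (64^-1) (r ^+ 2 * hsin xi i).
    have := dense_scale_irregular d0 dn irr; rewrite -/r -/S -/x -E3 -E4 => h.
    apply: le_trans h _; lra.
  have {}reg j : r ^+ 2 * hsin xi j <= 64^-1.
    by apply: le_trans reg; apply: ler_wpM2l; rewrite ?sqr_ge0.
  have := dense_scale_regular d0 dn reg; rewrite -/r -/S -/x -E3 -E2 => h.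
  apply: le_trans h _; lra.
(* Intermediate radii d/8 < K < d: here [peak (K/d)] exceeds 1/8 and absorbs the trivial bound. *)
have u1 : 0 <= (d%:R^-1 * K%:R : R) <= 1.
  rewrite mulr_ge0 ?invr_ge0 //= mulrC ler_pdivrMr // mul1r ler_nat; exact: ltnW.
have u2 : 1 <= 8 * (d%:R^-1 * K%:R) :> R.
  rewrite [d%:R^-1 * _]mulrC mulrA ler_pdivlMr // mul1r -natrM ler_nat; exact: ltnW.
rewrite subr0 -(real_normK (num_real _)); apply: (@le_trans _ _ 1).
  by rewrite exprn_ile1 // norm_ball_symbol_le1.
have : B2 = d%:R^-1 * K%:R by rewrite /B2 peak_small.
move=> E; rewrite -E in u2; lra.
Qed.

(** Four progressions of ratio 2, each contributing at most 6. *)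
Lemma square_function_le (N : nat) :
  \sum_(n < N) (ball_symbol (2 ^ n.+1) xi - approx_symbol d (2 ^ n.+1) x) ^+ 2 <= 2200 * 24.
Proof.
pose i0 : 'I_d := [arg max_(i > Ordinal d0) hsin xi i]%O.
have imax j : hsin xi j <= hsin xi i0.
  by rewrite /i0; case: Order.TotalTheory.arg_maxP => // i _; apply.
have dR : 0 < d%:R :> R by rewrite ltr0n.
have x0 : 0 <= x := havg_ge0 xi; have x1 : x <= 1 := havg_le1 xi d0.
have sb y : 0 <= y -> \sum_(n < N) peak (y * (2 ^ n.+1)%:R) <= 6 :> R.
  move=> y0; under eq_bigr do rewrite natrX exprS mulrA.
  by apply: sum_peak_le; rewrite mulr_ge0.
have s1 := sb (Num.min x (1 - x)); have s2 := sb d%:R^-1.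
have s3 := sb (Num.sqrt S / d%:R); have s4 := sb (`|sin (xi i0 / 2)| / d%:R).
rewrite le_min x0 subr_ge0 x1 in s1; rewrite invr_ge0 in s2.
rewrite divr_ge0 ?sqrtr_ge0 // in s3; rewrite divr_ge0 // in s4.
have {}s1 := s1 isT; have {}s2 := s2 (ltW dR); have {}s3 := s3 isT; have {}s4 := s4 isT.
apply: (@le_trans _ _ (\sum_(n < N) 2200 * (peak (Num.min x (1 - x) * (2 ^ n.+1)%:R) +
  peak (d%:R^-1 * (2 ^ n.+1)%:R) + peak (Num.sqrt S / d%:R * (2 ^ n.+1)%:R) +
  peak (`|sin (xi i0 / 2)| / d%:R * (2 ^ n.+1)%:R)))).
  apply: ler_sum => n _; apply: scale_error_le => //; first by rewrite expn_gt0.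
  by rewrite oddX.
rewrite -mulr_sumr !big_split /=; lra.
Qed.

End SquareFunction.

(** * Rota's maximal inequality *)

Section InnerProduct.
Variables (R : realType) (X : finType).
Local Notation V := {ffun X -> R}.
Implicit Types f g h : V.

Definition ip f g : R := \sum_x f x * g x.

Lemma ipC f g : ip f g = ip g f.
Proof. by apply: eq_bigr => x _; rewrite mulrC. Qed.

Lemma ipDl f g h : ip (f + g) h = ip f h + ip g h.
Proof. by rewrite -big_split; apply: eq_bigr => x _; rewrite ffunE mulrDl. Qed.

Lemma ipDr f g h : ip h (f + g) = ip h f + ip h g.
Proof. by rewrite ipC ipDl !(ipC h). Qed.

Lemma ip_suml (I : finType) (P : pred I) (F : I -> V) h :
  ip (\sum_(i | P i) F i) h = \sum_(i | P i) ip (F i) h.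
Proof.
rewrite exchange_big; apply: eq_bigr => x _.
by rewrite sum_ffunE mulr_suml.
Qed.

Lemma ip_sumr (I : finType) (P : pred I) (F : I -> V) h :
  ip h (\sum_(i | P i) F i) = \sum_(i | P i) ip h (F i).
Proof. by rewrite ipC ip_suml; apply: eq_bigr => i _; rewrite ipC. Qed.

Lemma ip_ge0 f : 0 <= ip f f.
Proof. by apply: sumr_ge0 => x _; rewrite -expr2 sqr_ge0. Qed.

Lemma ler_ip f g h : (forall x, 0 <= f x) -> (forall x, g x <= h x) -> ip f g <= ip f h.
Proof. by move=> f0 gh; apply: ler_sum => x _; apply: ler_wpM2l. Qed.

Lemma ip_mono f g : (forall x, 0 <= f x <= g x) -> ip f f <= ip g g.
Proof.
move=> fg; apply: ler_sum => x _; case/andP: (fg x) => f0 fgx.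
by apply: ler_pM.
Qed.

Lemma ip_quad_ge0 (a : R) f g : 0 <= ip f f * a ^+ 2 + 2 * (ip f g * a) + ip g g.
Proof.
have -> : ip f f * a ^+ 2 + 2 * (ip f g * a) + ip g g = \sum_x (f x * a + g x) ^+ 2.
  rewrite /ip !mulr_suml mulr_sumr -!big_split /=; apply: eq_bigr => x _; ring.
by apply: sumr_ge0 => x _; apply: sqr_ge0.
Qed.

Lemma ip_sum_nonneg (N : nat) (g : 'I_N -> V) : (forall n x, 0 <= g n x) ->
  \sum_n ip (g n) (g n) <= ip (\sum_n g n) (\sum_n g n).
Proof.
move=> g0; rewrite exchange_big; apply: ler_sum => x _; rewrite sum_ffunE.
elim: N g g0 => [|N IH] g g0; first by rewrite !big_ord0 mulr0.
rewrite !big_ord_recl.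
have /= h1 := IH (fun i => g (lift ord0 i)) (fun i => g0 _).
have h2 : 0 <= \sum_(i < N) g (lift ord0 i) x by apply: sumr_ge0.
have := mulr_ge0 (g0 ord0 x) h2; rewrite mulrDl !mulrDr; lra.
Qed.

(* Rota's alternating procedure: [T^(2 t_n) = T^(t_n) T^(t_n)] is the compression of the
   [n]-th conditional expectation of a reverse martingale, and the bound below is the dual
   form of Doob's [L^2] inequality. *)
Section Chain.
Variable T : V -> V.
Hypotheses (TD : forall f g, T (f + g) = T f + T g) (T0 : T 0 = 0).
Hypothesis Tge0 : forall f, (forall x, 0 <= f x) -> forall x, 0 <= T f x.
Hypothesis Tsym : forall f g, ip (T f) g = ip f (T g).
Hypothesis Tcontr : forall f, ip (T f) (T f) <= ip f f.

Lemma iterT_sum (I : Type) (r : seq I) (P : pred I) (F : I -> V) k :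
  iter k T (\sum_(i <- r | P i) F i) = \sum_(i <- r | P i) iter k T (F i).
Proof.
apply: (big_morph (iter k T)) => [f g|].
  by elim: k => //= k ->; rewrite TD.
by elim: k => //= k ->; rewrite T0.
Qed.

Lemma iterT_ge0 k f : (forall x, 0 <= f x) -> forall x, 0 <= iter k T f x.
Proof. by move=> f0; elim: k => [//|k IHk] x; rewrite iterS; apply: Tge0. Qed.

Lemma iterT_sym k f g : ip (iter k T f) g = ip f (iter k T g).
Proof. by elim: k f g => [//|k IHk] f g; rewrite iterS Tsym IHk -iterSr. Qed.

Lemma iterT_contr k f : ip (iter k T f) (iter k T f) <= ip f f.
Proof. by elim: k => [//|k IHk]; rewrite iterS; apply: le_trans (Tcontr _) IHk. Qed.

Variables (t : nat -> nat) (N : nat) (g : nat -> V).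
Hypothesis t_mono : {homo t : m n / (m <= n)%N}.
Hypothesis g0 : forall n x, 0 <= g n x.

(** The exponent is such that T^(t k) applied to [u k] gives the terms n >= k of [total]. *)
Let u k : V := \sum_(k <= n < N) iter (2 * t n - t k) T (g n).
Let total : V := \sum_(0 <= n < N) iter (2 * t n) T (g n).

Lemma chain_rec k : (k < N)%N ->
  u k = iter (t k) T (g k) + iter (t k.+1 - t k) T (u k.+1).
Proof.
move=> kN; rewrite /u big_ltn //; congr (_ + _); first by congr iter; lia.
rewrite iterT_sum; apply: eq_big_nat => n /andP[kn _].
rewrite -iterD; congr (iter _ T _).
by have := t_mono (leqnSn k); have := t_mono kn; lia.
Qed.

Lemma chain_telescope k : (k <= N)%N ->
  ip (u k) (u k) <= 2 * \sum_(k <= n < N) ip (iter (t n) T (g n)) (u n).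
Proof.
move=> kN; move: {2}(N - k)%N (erefl (N - k)%N) => j; elim: j k kN => [|j IHj] k kN jE.
  have -> : k = N by lia.
  rewrite big_geq // mulr0 /u big_geq // /ip big1 // => x _; by rewrite ffunE mul0r.
have kN' : (k < N)%N by lia.
have := IHj k.+1 kN' (ltac:(lia)) => IH.
rewrite big_ltn // mulrDr; set a := iter (t k) T (g k).
set b := iter (t k.+1 - t k) T (u k.+1).
have uE : u k = a + b := chain_rec kN'.
have hb : ip b b <= ip (u k.+1) (u k.+1) := iterT_contr _ _.
have ha := ip_ge0 a.
(* The square of [a] has the good sign and is dropped; contraction bounds that of [b] by the square
   of [u k.+1]. *)
have -> : ip (u k) (u k) = 2 * ip a (u k) - ip a a + ip b b.
  by rewrite uE !ipDl !ipDr (ipC b a); ring.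
lra.
Qed.

Lemma chain_maximal :
  ip total total <= 4 * ip (\sum_(0 <= n < N) g n) (\sum_(0 <= n < N) g n).
Proof.
set G := \sum_(0 <= n < N) g n.
have totalE : total = iter (t 0) T (u 0).
  rewrite iterT_sum; apply: eq_big_nat => n _; rewrite -iterD; congr (iter _ T _).
  by have := t_mono (leq0n n); lia.
have h1 : ip total total <= ip (u 0) (u 0) by rewrite totalE; apply: iterT_contr.
have h2 := chain_telescope (leq0n N).
(* By symmetry T^(t n) moves onto [u n] and yields a tail of [total]; positivity allows completing
   the tail. *)
have h3 : \sum_(0 <= n < N) ip (iter (t n) T (g n)) (u n) <= ip G total.
  have -> : ip G total = \sum_(0 <= n < N) ip (g n) total.
    by rewrite /G !big_mkord ip_suml.
  rewrite !big_nat; apply: ler_sum => n /andP[_ nN]; rewrite iterT_sym; apply: ler_ip => // x.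
  have -> : total = \sum_(0 <= m < n) iter (2 * t m) T (g m) + iter (t n) T (u n).
    rewrite /total (@big_cat_nat _ _ _ n) //=; last exact: ltnW.
    congr (_ + _); rewrite iterT_sum; apply: eq_big_nat => m /andP[nm _].
    by rewrite -iterD; congr (iter _ T _); have := t_mono nm; lia.
  rewrite ffunE lerDr big_mkord sum_ffunE; apply: sumr_ge0 => m _.
  exact: iterT_ge0.
(* Now |total|^2 <= 2 <G, total>, and |total - 2G|^2 >= 0 closes the estimate. *)
have := ip_quad_ge0 (- 2) G total; lra.
Qed.

End Chain.
End InnerProduct.

(** * Fourier analysis on the discrete torus *)

Section Characters.
Variables (R : realType) (m : nat).
Local Notation Z := 'I_m.+1.
Implicit Types (k x y : Z) (c : bool) (u : nat).

Definition freq k : R := (pi *+ 2) * k%:R / m.+1%:R.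
(** Real characters. The family is redundant (twice as many functions as points in each coordinate,
    one of them zero), a tight frame rather than a basis; the completeness relation
    [wave_orthogonal] is what Parseval rests on. *)
Definition wave k c x : R := let t := freq k * x%:R in if c then cos t else sin t.

Let M0 : m.+1%:R != 0 :> R. Proof. by rewrite pnatr_eq0. Qed.

Lemma freq_shift k x u : exists j : nat,
  freq k * (x%:R + u%:R) = freq k * (x + inZp u)%R%:R + (pi *+ 2) *+ j.
Proof.
exists (k * ((x + u) %/ m.+1))%N.
have -> : x%:R + u%:R = ((x + u) %/ m.+1)%:R * m.+1%:R + ((x + inZp u)%R : nat)%:R :> R.
  by rewrite -natrD {1}(divn_eq (x + u) m.+1) /= modnDmr natrD natrM.
by rewrite -[_ *+ (k * _)]mulr_natr natrM /freq; field; rewrite nat1r M0.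
Qed.

Lemma wave_shift k c x u : wave k c (x + inZp u) =
  let t := freq k * x%:R + u%:R * freq k in if c then cos t else sin t.
Proof.
have [j jE] := freq_shift k x u; rewrite /wave /=.
have -> : freq k * x%:R + u%:R * freq k = freq k * (x%:R + u%:R) by ring.
rewrite jE; case: c.
  by rewrite (periodicn (@cosD2pi R)).
by rewrite (periodicn (@sinD2pi R)).
Qed.

Lemma wave_avg k c x u :
  wave k c (x + inZp u) + wave k c (x - inZp u) = 2 * (cos (u%:R * freq k) * wave k c x).
Proof.
have h := wave_shift k; have hc := h true (x - inZp u) u; have hs := h false (x - inZp u) u.
rewrite subrK /= in hc hs; rewrite wave_shift /=.
move: hc hs; rewrite /wave /=; set a := freq k * (x - inZp u)%R%:R; set b := freq k * x%:R.
set e := u%:R * freq k.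
have h2 : cos e ^+ 2 + sin e ^+ 2 = 1 by apply: cos2Dsin2.
rewrite cosD sinD => hc hs.
have {}h2 : cos e * cos e + sin e * sin e = 1 by rewrite -!expr2.
case: c; rewrite ?cosD ?sinD hc hs.
  transitivity (2 * (cos e * (cos a * cos e - sin a * sin e)) +
     cos a * (1 - (cos e * cos e + sin e * sin e))); first by ring.
  by rewrite h2 subrr mulr0 addr0.
transitivity (2 * (cos e * (sin a * cos e + cos a * sin e)) +
     sin a * (1 - (cos e * cos e + sin e * sin e))); first by ring.
by rewrite h2 subrr mulr0 addr0.
Qed.

Lemma sum_cos_freq (l : nat) : (0 < l < m.+1)%N -> \sum_k cos (freq k * l%:R) = 0.
Proof.
move=> /andP[l0 lm].
pose a : R := pi *+ 2 * l%:R / m.+1%:R.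
have sa : 0 < sin (a / 2).
  apply: sin_gt0_pi.
  have -> : a / 2 = pi * (l%:R / m.+1%:R) by rewrite /a -mulr_natr; field; rewrite nat1r M0.
  rewrite mulr_gt0 ?pi_gt0 ?divr_gt0 ?ltr0n //= -[ltRHS]mulr1 ltr_pM2l ?pi_gt0 //.
  by rewrite ltr_pdivrMr ?ltr0n // mul1r ltr_nat.
have E : \sum_k cos (freq k * l%:R) = 1 + \sum_(0 <= u < m) cos (u.+1%:R * a).
  rewrite big_ord_recl /= /freq mulr0 mul0r mul0r cos0 big_mkord; congr (_ + _).
  by apply: eq_bigr => i _; congr cos; rewrite lift0 /a; field; rewrite nat1r M0.
have := dirichlet_sum m a.
(* Because (m + 1) a is a multiple of 2 pi, the Dirichlet kernel over a full period is -1, which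
   kills the sum. *)
have -> : (m%:R + 2^-1) * a = - (a / 2) + (pi *+ 2) *+ l.
  by rewrite -[(_ *+ 2) *+ l]mulr_natr /a; field; rewrite nat1r M0.
rewrite (periodicn (@sinD2pi R)) sinN E => /eqP.
rewrite -subr_eq0 opprK -{2}[sin (a / 2)]mulr1 -mulrDr mulf_eq0 gt_eqF //= => /eqP h.
lra.
Qed.

Lemma wave_orthogonal x y :
  \sum_(b : Z * bool) wave b.1 b.2 x * wave b.1 b.2 y = (m.+1 * (x == y))%:R.
Proof.
rewrite -(pair_bigA _ (fun k c => wave k c x * wave k c y)) /=.
transitivity (\sum_k cos (freq k * (x%:R - y%:R))).
  apply: eq_bigr => k _; rewrite big_bool /= mulrBr cosB /wave; ring.
have [->|xy] := eqVneq x y.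
  rewrite muln1; under eq_bigr do rewrite subrr mulr0 cos0.
  by rewrite sumr_const card_ord.
rewrite muln0; case: (ltngtP x y) => [lt|lt|E]; last by case/eqP: xy; apply: val_inj.
  rewrite -[RHS](@sum_cos_freq (y - x)); last by have := ltn_ord y; lia.
  apply: eq_bigr => k _; rewrite natrB ?(ltnW lt) // -cosN; congr cos; ring.
rewrite -[RHS](@sum_cos_freq (x - y)); last by have := ltn_ord x; lia.
by apply: eq_bigr => k _; rewrite natrB ?(ltnW lt).
Qed.

End Characters.

Lemma sqr_sum_mul_le (R : realDomainType) (I : finType) (a b : I -> R) :
  (\sum_i a i * b i) ^+ 2 <= (\sum_i a i ^+ 2) * (\sum_i b i ^+ 2).
Proof.
have : 0 <= \sum_i \sum_j (a i * b j - a j * b i) ^+ 2.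
  by apply: sumr_ge0 => i _; apply: sumr_ge0 => j _; apply: sqr_ge0.
have -> : \sum_i \sum_j (a i * b j - a j * b i) ^+ 2 =
    \sum_i \sum_j (a i ^+ 2 * b j ^+ 2 + a j ^+ 2 * b i ^+ 2 - 2 * (a i * b i) * (a j * b j)).
  by apply: eq_bigr => i _; apply: eq_bigr => j _; ring.
have E : \sum_i \sum_j a j ^+ 2 * b i ^+ 2 = (\sum_i a i ^+ 2) * (\sum_i b i ^+ 2).
  rewrite mulr_sumr; apply: eq_bigr => i _; by rewrite mulr_suml.
have E' : \sum_i \sum_j a i ^+ 2 * b j ^+ 2 = (\sum_i a i ^+ 2) * (\sum_i b i ^+ 2).
  by rewrite mulr_suml; apply: eq_bigr => i _; rewrite mulr_sumr.
have E2 : \sum_i \sum_j 2 * (a i * b i) * (a j * b j) = 2 * (\sum_i a i * b i) ^+ 2.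
  rewrite expr2 mulrA [2 * \sum_i a i * b i]mulr_sumr mulr_suml.
  by apply: eq_bigr => i _; rewrite mulr_sumr.
under eq_bigr do rewrite sumrB big_split /=.
by rewrite sumrB big_split /= E E' E2; lra.
Qed.

(** * Parseval's identity and diagonal operators *)

Section Torus.
Variables (R : realType) (d m : nat).
Local Notation Z := 'I_m.+1.
Local Notation X := {ffun 'I_d -> Z}.
Local Notation V := {ffun X -> R}.
Local Notation mode := {ffun 'I_d -> Z * bool}.
Implicit Types (x y : X) (f g h : V) (b : mode) (T : V -> V).

Definition Phi b : V := [ffun x : X => \prod_i wave R (b i).1 (b i).2 (x i)].

Lemma Phi_orthogonal x y : \sum_b Phi b x * Phi b y = (m.+1 ^ d * (x == y))%:R.
Proof.
under eq_bigr do rewrite !ffunE -big_split /=.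
rewrite -(bigA_distr_bigA (fun i (c : Z * bool) => wave R c.1 c.2 (x i) * wave R c.1 c.2 (y i))) /=.
under eq_bigr do rewrite wave_orthogonal.
have [->|xy] := eqVneq x y.
  under eq_bigr do rewrite eqxx muln1.
  by rewrite prodr_const card_ord muln1 natrX.
rewrite muln0; have [i xyi] : exists i, x i != y i.
  apply/existsP; rewrite -negb_forall; apply: contra xy => /forallP h.
  by apply/eqP/ffunP => i; apply/eqP/h.
by rewrite (bigD1 i) //= (negPf xyi) muln0 mul0r.
Qed.

Lemma parseval f g : (m.+1 ^ d)%:R * ip f g = \sum_b ip f (Phi b) * ip g (Phi b).
Proof.
have -> : \sum_b ip f (Phi b) * ip g (Phi b) =
    \sum_x \sum_y f x * g y * \sum_b Phi b x * Phi b y.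
  transitivity (\sum_b \sum_x \sum_y f x * g y * (Phi b x * Phi b y)).
    apply: eq_bigr => b _; rewrite mulr_suml; apply: eq_bigr => x _.
    by rewrite mulr_sumr; apply: eq_bigr => y _; ring.
  rewrite exchange_big; apply: eq_bigr => x _; rewrite exchange_big; apply: eq_bigr => y _.
  by rewrite mulr_sumr.
rewrite /ip mulr_sumr; apply: eq_bigr => x _.
rewrite (bigD1 x) //= [X in _ = _ + X]big1 ?addr0.
  by rewrite Phi_orthogonal eqxx muln1 mulrC.
by move=> y yx; rewrite Phi_orthogonal eq_sym (negPf yx) muln0 mulr0.
Qed.

(** A condition on frame coefficients, the form in which [parseval] consumes it. *)
Definition diagonal T (l : mode -> R) := forall f b, ip (T f) (Phi b) = l b * ip f (Phi b).

Lemma diagonal_sym T l : diagonal T l -> forall f g, ip (T f) g = ip f (T g).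
Proof.
move=> Tl f g; have c0 : ((m.+1 ^ d)%:R : R) != 0 by rewrite pnatr_eq0 -lt0n expn_gt0.
apply: (mulfI c0); rewrite !parseval; apply: eq_bigr => b _; rewrite !Tl; ring.
Qed.

Lemma diagonal_contr T l : diagonal T l -> (forall b, `|l b| <= 1) ->
  forall f, ip (T f) (T f) <= ip f f.
Proof.
move=> Tl l1 f; have c0 : 0 < (m.+1 ^ d)%:R :> R by rewrite ltr0n expn_gt0.
rewrite -(ler_pM2l c0) !parseval; apply: ler_sum => b _; rewrite Tl.
have -> : l b * ip f (Phi b) * (l b * ip f (Phi b)) = `|l b| ^+ 2 * ip f (Phi b) ^+ 2.
  by rewrite real_normK ?num_real //; ring.
by rewrite -expr2 ler_piMl ?sqr_ge0 // exprn_ile1.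
Qed.

Lemma diagonal_iter T l k : diagonal T l -> diagonal (iter k T) (fun b => l b ^+ k).
Proof.
move=> Tl f b; elim: k => [|k IHk]; first by rewrite expr0 mul1r.
by rewrite iterS Tl IHk exprS mulrA.
Qed.

(** The dual of a square function estimate: Cauchy-Schwarz in [n] at each mode, then Parseval. *)
Lemma diagonal_square_sum (N : nat) (T T' : 'I_N -> V -> V) (l l' : 'I_N -> mode -> R)
    (C : R) (g : 'I_N -> V) h :
  (forall n, diagonal (T n) (l n)) -> (forall n, diagonal (T' n) (l' n)) ->
  (forall b, \sum_n (l n b - l' n b) ^+ 2 <= C) ->
  h = \sum_n (T n (g n) - T' n (g n)) -> ip h h <= C * \sum_n ip (g n) (g n).
Proof.
move=> Tl Tl' lC hE; have c0 : 0 < (m.+1 ^ d)%:R :> R by rewrite ltr0n expn_gt0.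
rewrite -(ler_pM2l c0) parseval mulrCA mulr_sumr.
under [X in _ <= C * X]eq_bigr do rewrite parseval.
rewrite exchange_big mulr_sumr; apply: ler_sum => b _.
have -> : ip h (Phi b) = \sum_n (l n b - l' n b) * ip (g n) (Phi b).
  rewrite hE ip_suml; apply: eq_bigr => n _.
  have -> : T n (g n) - T' n (g n) = T n (g n) + [ffun x => - T' n (g n) x].
    by apply/ffunP => x; rewrite !ffunE.
  rewrite ipDl Tl.
  have -> : ip [ffun x => - T' n (g n) x] (Phi b) = - ip (T' n (g n)) (Phi b).
    by rewrite /ip -sumrN; apply: eq_bigr => x _; rewrite ffunE mulNr.
  by rewrite Tl'; ring.
have cs : (\sum_n (l n b - l' n b) * ip (g n) (Phi b)) ^+ 2 <=
    (\sum_n (l n b - l' n b) ^+ 2) * \sum_n ip (g n) (Phi b) ^+ 2.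
  exact: sqr_sum_mul_le.
rewrite -expr2; apply: le_trans cs _; rewrite (eq_bigr _ (fun n _ => expr2 (ip (g n) (Phi b)))).
apply: ler_wpM2r; last exact: lC.
by apply: sumr_ge0 => n _; rewrite -expr2 sqr_ge0.
Qed.

End Torus.

(** * The maximal inequality on the discrete torus *)

Section Averages.
Variables (R : realType) (d m : nat).
Local Notation Z := 'I_m.+1.
Local Notation X := {ffun 'I_d -> Z}.
Local Notation V := {ffun X -> R}.
Local Notation mode := {ffun 'I_d -> Z * bool}.
Implicit Types (x y : X) (f g h : V) (b : mode).

Definition sign_shift x (n : 'I_d -> nat) (e : {ffun 'I_d -> bool}) : X :=
  [ffun i => if e i then x i + inZp (n i) else x i - inZp (n i)].

(** All sign patterns are averaged, even where n_i = 0 and both signs agree, so the multiplier is a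
    plain product of cosines; [weight] then accounts for the number of distinct points. *)
Definition sign_avg (n : 'I_d -> nat) f : V := [ffun x => (2 ^+ d)^-1 * \sum_e f (sign_shift x n e)].

Definition neg_sign (e : {ffun 'I_d -> bool}) : {ffun 'I_d -> bool} := [ffun i => ~~ e i].

Lemma neg_signK : involutive neg_sign.
Proof. by move=> e; apply/ffunP => i; rewrite !ffunE negbK. Qed.

Lemma shiftK n e : cancel (fun x => sign_shift x n e) (fun x => sign_shift x n (neg_sign e)).
Proof.
move=> x; apply/ffunP => i; rewrite !ffunE.
by case: (e i) => /=; rewrite ?addrK ?subrK.
Qed.

Definition angles b : 'I_d -> R := fun i => freq R (b i).1.

Lemma sign_avg_diagonal n : diagonal (sign_avg n) (fun b => \prod_i cos ((n i)%:R * angles b i)).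
Proof.
move=> f b; have c2 : 2 ^+ d != 0 :> R by rewrite expf_neq0 // pnatr_eq0.
have PhiE x : \sum_e Phi R b (sign_shift x n e) =
    2 ^+ d * (\prod_i cos ((n i)%:R * angles b i)) * Phi R b x.
  transitivity (\prod_i (2 * (cos ((n i)%:R * angles b i) * wave R (b i).1 (b i).2 (x i)))).
    under [RHS]eq_bigr do rewrite -wave_avg.
    rewrite [RHS](eq_bigr (fun i => \sum_c wave R (b i).1 (b i).2 (if c then x i + inZp (n i) else x i - inZp (n i)))); last first.
      by move=> i _; rewrite big_bool.
    rewrite bigA_distr_bigA; apply: eq_bigr => e _; rewrite ffunE.
    by apply: eq_bigr => i _; rewrite ffunE.
  by rewrite !big_split /= prodr_const card_ord ffunE mulrA.
transitivity ((2 ^+ d)^-1 * \sum_x f x * \sum_e Phi R b (sign_shift x n e)); last first.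
  rewrite [X in _ * X = _](eq_bigr _ (fun x _ => congr1 (GRing.mul (f x)) (PhiE x))).
  rewrite /ip !mulr_sumr; apply: eq_bigr => x _.
  by rewrite -!mulrA [f x * _]mulrCA mulKf //; ring.
transitivity ((2 ^+ d)^-1 * \sum_e \sum_x f (sign_shift x n e) * Phi R b x).
  rewrite /ip exchange_big mulr_sumr; apply: eq_bigr => x _; rewrite ffunE -mulrA; congr (_ * _).
  by rewrite mulr_suml.
congr (_ * _); under [RHS]eq_bigr do rewrite mulr_sumr.
rewrite [RHS]exchange_big (reindex_inj (inv_inj neg_signK)); apply: eq_bigr => e _.
rewrite [RHS](reindex_inj (can_inj (shiftK n (neg_sign e)))); apply: eq_bigr => x _.
by have := shiftK n (neg_sign e) x; rewrite neg_signK => ->.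
Qed.

Section Operator.
Variables (J : finType) (w : J -> R) (n : J -> 'I_d -> nat).

Definition avg_op f : V := [ffun x => \sum_j w j * sign_avg (n j) f x].

Lemma avg_op_diagonal : diagonal avg_op (fun b => \sum_j w j * \prod_i cos ((n j i)%:R * angles b i)).
Proof.
move=> f b; transitivity (\sum_j w j * ip (sign_avg (n j) f) (Phi R b)).
  under [RHS]eq_bigr do rewrite mulr_sumr.
  rewrite exchange_big; apply: eq_bigr => x _; rewrite ffunE mulr_suml.
  by apply: eq_bigr => j _; rewrite mulrA.
by rewrite mulr_suml; apply: eq_bigr => j _; rewrite sign_avg_diagonal mulrA.
Qed.

Lemma avg_opD f g : avg_op (f + g) = avg_op f + avg_op g.
Proof.
apply/ffunP => x; rewrite !ffunE -big_split /=; apply: eq_bigr => j _.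
rewrite !ffunE -!mulrDr -big_split /=; congr (_ * (_ * _)).
by apply: eq_bigr => e _; rewrite ffunE.
Qed.

Lemma avg_op0 : avg_op 0 = 0.
Proof.
apply/ffunP => x; rewrite !ffunE big1 // => j _; rewrite ffunE big1 ?mulr0 // => e _.
by rewrite ffunE.
Qed.

Hypothesis w0 : forall j, 0 <= w j.

Lemma avg_op_ge0 f : (forall x, 0 <= f x) -> forall x, 0 <= avg_op f x.
Proof.
move=> f0 x; rewrite ffunE; apply: sumr_ge0 => j _; rewrite mulr_ge0 // ffunE.
by rewrite mulr_ge0 ?invr_ge0 ?exprn_ge0 // sumr_ge0.
Qed.

End Operator.

Definition walk : V -> V := avg_op (fun=> d%:R^-1) (fun i j => (j == i) : nat).
Definition lazy_walk : V -> V :=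
  avg_op (fun o : option 'I_d => if o is Some _ then (2 * d%:R)^-1 else 2^-1)
     (fun o j => if o is Some i then (j == i) : nat else 0%N).
Definition ball_avg (K : nat) : V -> V :=
  avg_op (fun n : {ffun 'I_d -> 'I_K.+1} =>
    if (norm1 n <= K)%N then weight R n / ball_mass R d K K else 0)
     (fun n i => n i).

Definition havg b : R := (\sum_i hsin (angles b) i) / d%:R.

Hypothesis d0 : (0 < d)%N.
Let dR : 0 < d%:R :> R. Proof. by rewrite ltr0n. Qed.

Lemma prod_cos_delta b i : \prod_j cos (((j == i) : nat)%:R * angles b j) = 1 - 2 * hsin (angles b) i.
Proof.
rewrite (bigD1 i) //= eqxx mul1r big1 ?mulr1; first exact: cosE_half.
by move=> j /negPf->; rewrite mul0r cos0.
Qed.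

Lemma walk_diagonal : diagonal walk (fun b => 1 - 2 * havg b).
Proof.
move=> f b; rewrite avg_op_diagonal; congr (_ * _).
under eq_bigr do rewrite prod_cos_delta.
rewrite -mulr_sumr sumrB sumr_const card_ord -mulr_sumr mulrBr mulVf ?gt_eqF // /havg.
ring.
Qed.

Lemma lazy_walk_diagonal : diagonal lazy_walk (fun b => 1 - havg b).
Proof.
move=> f b; rewrite avg_op_diagonal; congr (_ * _).
rewrite (bigD1 None) //= (reindex_omap Some id) /=; last by case.
rewrite [X in _ + X](eq_bigl xpredT); last by move=> i; rewrite /= eqxx.
under [X in _ + X]eq_bigr do rewrite prod_cos_delta.
rewrite -mulr_sumr sumrB sumr_const card_ord -mulr_sumr big1; last first.
  by move=> i _; rewrite mul0r cos0.
by rewrite /havg; field; rewrite gt_eqF.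
Qed.

Lemma ball_avg_diagonal K : diagonal (ball_avg K) (fun b => ball_symbol K (angles b)).
Proof.
move=> f b; rewrite avg_op_diagonal; congr (_ * _).
rewrite /ball_symbol mulr_suml [RHS]big_mkcond; apply: eq_bigr => n _.
by case: ifP => _; rewrite ?mul0r // mulrAC.
Qed.

Lemma ball_avg_ge0 K f : (forall x, 0 <= f x) -> forall x, 0 <= ball_avg K f x.
Proof.
apply: avg_op_ge0 => n; case: ifP => // _; rewrite divr_ge0 ?weight_ge0 //.
exact: ball_ge0.
Qed.

Lemma havg_01 b : 0 <= havg b <= 1.
Proof. by rewrite havg_ge0 havg_le1. Qed.

Lemma dense_time_mono : {homo (fun n => dense_time d (2 ^ n.+1)) : k l / (k <= l)%N}.
Proof.
move=> k l kl; rewrite /dense_time ltnS leq_div2r // leq_sqr.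
by rewrite leq_exp2l.
Qed.

(** * The dual maximal inequality on the torus *)

Section L2.
Variables (N : nat) (g : nat -> V).
Hypothesis g0 : forall n x, 0 <= g n x.
Let G := \sum_(0 <= n < N) g n.
Let sparse n := (8 * 2 ^ n.+1 <= d)%N.
Let dense n := ~~ sparse n && (d <= 2 ^ n.+1)%N.
Let g1 n : V := if sparse n then g n else 0.
Let g2 n : V := if dense n then g n else 0.

Lemma restricted_sum_le (P : pred nat) :
  ip (\sum_(0 <= n < N) (if P n then g n else 0)) (\sum_(0 <= n < N) (if P n then g n else 0)) <= ip G G.
Proof.
apply: ip_mono => x; rewrite /G !big_mkord !sum_ffunE; apply/andP; split.
  by apply: sumr_ge0 => n _; case: ifP => _; rewrite ?ffunE.
by apply: ler_sum => n _; case: ifP => _; rewrite ?ffunE.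
Qed.

(** Half of the walk time, as [chain_maximal] treats even powers: twice this is the radius
    itself. *)
Let t1 n := (2 ^ n)%N.
Let t2 n := dense_time d (2 ^ n.+1).

Lemma norm_le1_of_itv (z : R) : -1 <= z <= 1 -> `|z| <= 1.
Proof. by rewrite ler_norml. Qed.

Lemma sparse_chain_le (S : V) : S = \sum_(0 <= n < N) iter (2 * t1 n) walk (g1 n) ->
  ip S S <= 4 * ip G G.
Proof.
move=> ->; apply: le_trans (@chain_maximal _ _ walk _ _ _ _ _ t1 N g1 _ _) _.
- by move=> f h; apply: avg_opD.
- exact: avg_op0.
- by move=> f f0; apply: avg_op_ge0 => // i; rewrite invr_ge0.
- exact: (diagonal_sym walk_diagonal).
- apply: (diagonal_contr walk_diagonal) => b; apply: norm_le1_of_itv.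
  by case/andP: (havg_01 b) => h1 h2; lra.
- by move=> k l kl; rewrite /t1 leq_exp2l.
- by move=> n x; rewrite /g1; case: ifP => _; rewrite ?ffunE.
by apply: ler_wpM2l => //; apply: restricted_sum_le.
Qed.

Lemma dense_chain_le (S : V) : S = \sum_(0 <= n < N) iter (2 * t2 n) lazy_walk (g2 n) ->
  ip S S <= 4 * ip G G.
Proof.
move=> ->; apply: le_trans (@chain_maximal _ _ lazy_walk _ _ _ _ _ t2 N g2 _ _) _.
- by move=> f h; apply: avg_opD.
- exact: avg_op0.
- move=> f f0; apply: avg_op_ge0 => // -[i|]; rewrite invr_ge0 // mulr_ge0 //; exact: ltW.
- exact: (diagonal_sym lazy_walk_diagonal).
- apply: (diagonal_contr lazy_walk_diagonal) => b; apply: norm_le1_of_itv.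
  by case/andP: (havg_01 b) => h1 h2; lra.
- exact: dense_time_mono.
- by move=> n x; rewrite /g2; case: ifP => _; rewrite ?ffunE.
by apply: ler_wpM2l => //; apply: restricted_sum_le.
Qed.

Definition approx_op (n : nat) : V -> V :=
  if sparse n then iter (2 * t1 n) walk else
  if (d <= 2 ^ n.+1)%N then iter (2 * t2 n) lazy_walk else fun=> 0.

Lemma approx_op_diagonal n : diagonal (approx_op n) (fun b => approx_symbol d (2 ^ n.+1) (havg b)).
Proof.
move=> f b; rewrite /approx_op /approx_symbol /sparse; case: ifP => _.
  by rewrite (diagonal_iter _ walk_diagonal) /t1 expnS.
case: ifP => _; first by rewrite (diagonal_iter _ lazy_walk_diagonal).
by rewrite mul0r /ip big1 // => x _; rewrite ffunE mul0r.
Qed.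

Lemma approx_opE n : approx_op n (g n) =
  iter (2 * t1 n) walk (g1 n) + iter (2 * t2 n) lazy_walk (g2 n).
Proof.
have w0 k : iter k walk 0 = 0 by elim: k => //= k ->; rewrite /walk avg_op0.
have l0 k : iter k lazy_walk 0 = 0 by elim: k => //= k ->; rewrite /lazy_walk avg_op0.
rewrite /approx_op /g1 /g2 /dense; case: (sparse n).
  by rewrite [~~ true && _]/= l0 addr0.
by rewrite [~~ false && _]/=; case: ifP => _; rewrite w0 ?l0 add0r.
Qed.

Lemma ip_add3_le (a b c : V) : ip (a + b + c) (a + b + c) <= 3 * (ip a a + ip b b + ip c c).
Proof.
rewrite /ip -!big_split /= mulr_sumr; apply: ler_sum => x _; rewrite !ffunE.
have := sqr_ge0 (a x - b x); have := sqr_ge0 (a x - c x); have := sqr_ge0 (b x - c x); lra.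
Qed.

(** 4 from each of the two Markov chains, 2200 * 24 from the square function, and 3 for squaring a
    sum of three terms. *)
Definition l2_constant : R := 3 * (8 + 2200 * 24).

Lemma ball_avg_dual (S : V) : S = \sum_(0 <= n < N) ball_avg (2 ^ n.+1) (g n) ->
  ip S S <= l2_constant * ip G G.
Proof.
move=> SE.
set S1 := \sum_(0 <= n < N) iter (2 * t1 n) walk (g1 n).
set S2 := \sum_(0 <= n < N) iter (2 * t2 n) lazy_walk (g2 n).
set D := \sum_(n < N) (ball_avg (2 ^ n.+1) (g n) - approx_op n (g n)).
have -> : S = S1 + S2 + D.
  rewrite SE /D sumrB /S1 /S2 !big_mkord -big_split /=.
  by under [in RHS]eq_bigr do rewrite -approx_opE; rewrite addrC subrK.
have h1 := sparse_chain_le (erefl S1); have h2 := dense_chain_le (erefl S2).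
have h3 : ip D D <= 2200 * 24 * \sum_(n < N) ip (g n) (g n).
  apply: (@diagonal_square_sum R d m N (fun n => ball_avg (2 ^ n.+1)) (fun n => approx_op n)
    (fun n b => ball_symbol (2 ^ n.+1) (angles b))
    (fun n b => approx_symbol d (2 ^ n.+1) (havg b))) => //.
  - by move=> n; apply: ball_avg_diagonal.
  - by move=> n; apply: approx_op_diagonal.
  - by move=> b; apply: square_function_le.
have h4 : \sum_(n < N) ip (g n) (g n) <= ip G G.
  by rewrite /G big_mkord; apply: (ip_sum_nonneg (g := fun n : 'I_N => g n)).
apply: le_trans (ip_add3_le _ _ _) _; rewrite /l2_constant.
have h5 : 2200 * 24 * \sum_(n < N) ip (g n) (g n) <= 2200 * 24 * ip G G.
  by apply: ler_wpM2l => //; rewrite mulr_ge0.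
lra.
Qed.

End L2.

(** Linearised maximal inequality. Cutting the selected average [h] along the level sets of [c]
    gives nonnegative g_n with sum [h], the input of [ball_avg_dual]. *)
Lemma ball_avg_l2 (N : nat) (f : V) (c : X -> 'I_N) : (forall x, 0 <= f x) ->
  \sum_x ball_avg (2 ^ (c x).+1) f x ^+ 2 <= l2_constant * \sum_x f x ^+ 2.
Proof.
move=> f0; pose h : V := [ffun x => ball_avg (2 ^ (c x).+1) f x].
have h0 x : 0 <= h x by rewrite ffunE; apply: ball_avg_ge0.
pose g (n : nat) : V := [ffun x => if c x == n :> nat then h x else 0].
have g0 n x : 0 <= g n x by rewrite ffunE; case: ifP.
have GE : \sum_(0 <= n < N) g n = h.
  apply/ffunP => x; rewrite big_mkord sum_ffunE (bigD1 (c x)) //= ffunE eqxx big1 ?addr0 //.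
  by move=> n nc; rewrite ffunE; case: eqP => // E; case/eqP: nc; apply: val_inj.
have := ball_avg_dual g0 (erefl (\sum_(0 <= n < N) ball_avg (2 ^ n.+1) (g n))).
set S := \sum_(0 <= n < N) ball_avg _ _; rewrite GE => SS.
(* Self-adjointness moves each average onto [f], where on the level set c = n it equals [h]
   again. *)
have fS : ip f S = ip h h.
  rewrite /S big_mkord ip_sumr -[in RHS]GE big_mkord ip_sumr.
  apply: eq_bigr => n _; rewrite -(diagonal_sym (@ball_avg_diagonal _)).
  rewrite [RHS]ipC ipC; apply: eq_bigr => x _; rewrite ffunE; case: eqP => [E|_]; last by rewrite !mul0r.
  by rewrite -(big_mkord xpredT) GE; congr (_ * _); rewrite [h x]ffunE E.
have hE : \sum_x ball_avg (2 ^ (c x).+1) f x ^+ 2 = ip h h.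
  by apply: eq_bigr => x _; rewrite [h x]ffunE expr2.
have fE : \sum_x f x ^+ 2 = ip f f by apply: eq_bigr => x _; rewrite expr2.
rewrite hE fE; have C0 : 0 < l2_constant by rewrite /l2_constant; lra.
(* Expanding |S - C f|^2 >= 0 with |S|^2 <= C |h|^2 gives |h|^2 <= C |f|^2. *)
have := ip_quad_ge0 (- l2_constant) f S; rewrite fS => q.
rewrite -(ler_pM2l C0).
lra.
Qed.

End Averages.

(** Let c be the weighted mean. Young's inequality for a_i c^(q-1), summed with the weights, has c^q
    on the left and c^q/r on the right, with r the conjugate exponent; the difference is c^q/q. *)
Lemma powR_jensen (R : realType) (I : finType) (w a : I -> R) (q : R) : 1 <= q ->
  (forall i, 0 <= w i) -> \sum_i w i = 1 -> (forall i, 0 <= a i) ->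
  (\sum_i w i * a i) `^ q <= \sum_i w i * a i `^ q.
Proof.
move=> q1 w0 w1 a0; set c := \sum_i w i * a i.
have c0 : 0 <= c by apply: sumr_ge0 => i _; rewrite mulr_ge0.
have rhs0 : 0 <= \sum_i w i * a i `^ q.
  by apply: sumr_ge0 => i _; rewrite mulr_ge0 ?powR_ge0.
have [q1'|q1'] := eqVneq q 1.
  rewrite q1' powRr1 // /c; apply: ler_sum => i _; by rewrite powRr1.
have q2 : 1 < q by rewrite lt_neqAle eq_sym q1'.
have qp : 0 < q by lra.
have [cz|cz] := eqVneq c 0; first by rewrite cz powR0 // gt_eqF.
have cp : 0 < c by rewrite lt_neqAle eq_sym cz.
pose r := q / (q - 1).
have rp : 0 < r by rewrite divr_gt0 //; lra.
have qr : q^-1 + r^-1 = 1 by rewrite /r invf_div; field; rewrite gt_eqF.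
have young i : w i * (a i * c `^ (q - 1)) <= w i * a i `^ q / q + w i * c `^ q / r.
  have q10 : q - 1 != 0 by rewrite gt_eqF //; lra.
  have cE : (c `^ (q - 1)) `^ r = c `^ q.
    by rewrite -powRrM; congr powR; rewrite /r; field.
  have := conjugate_powR (a0 i) (powR_ge0 c (q - 1)) qp rp qr; rewrite cE => h.
  have := ler_wpM2l (w0 i) h; lra.
have : \sum_i w i * (a i * c `^ (q - 1)) <= \sum_i (w i * a i `^ q / q + w i * c `^ q / r).
  by apply: ler_sum => i _; apply: young.
rewrite big_split /= -!mulr_suml w1 mul1r.
have -> : \sum_i w i * (a i * c `^ (q - 1)) = c `^ q.
  under eq_bigr do rewrite mulrA.
  rewrite -mulr_suml -/c -{1}(powRr1 c0) -powRD ?cz ?implybT //.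
  by congr powR; ring.
have ri : r^-1 = 1 - q^-1 by lra.
rewrite ri => h.
have : c `^ q / q <= (\sum_i w i * a i `^ q) / q by lra.
by rewrite ler_pM2r // invr_gt0.
Qed.

(** * From l^2 to l^p on the torus *)

Section TorusLp.
Variables (R : realType) (d m : nat).
Local Notation X := {ffun 'I_d -> 'I_m.+1}.
Local Notation V := {ffun X -> R}.
Implicit Types (f : V) (x : X).

Definition ball_weight (K : nat) (j : {ffun 'I_d -> 'I_K.+1} * {ffun 'I_d -> bool}) : R :=
  (if (norm1 j.1 <= K)%N then weight R j.1 / ball_mass R d K K else 0) / 2 ^+ d.

Lemma ball_avgE K f x :
  ball_avg K f x = \sum_(j : {ffun 'I_d -> 'I_K.+1} * {ffun 'I_d -> bool})
    ball_weight j * f (sign_shift x (fun i => j.1 i) j.2).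
Proof.
rewrite ffunE -(pair_bigA _ (fun n e => ball_weight (n, e) * f (sign_shift x (fun i => n i) e))) /=.
apply: eq_bigr => n _; rewrite ffunE /ball_weight /= mulrA mulr_sumr.
by apply: eq_bigr => e _.
Qed.

Lemma ball_weight_ge0 K (j : {ffun 'I_d -> 'I_K.+1} * {ffun 'I_d -> bool}) : 0 <= ball_weight j.
Proof.
rewrite /ball_weight divr_ge0 ?exprn_ge0 //; case: ifP => // _.
by rewrite divr_ge0 ?weight_ge0 ?ball_ge0.
Qed.

Lemma sum_ball_weight K :
  \sum_(j : {ffun 'I_d -> 'I_K.+1} * {ffun 'I_d -> bool}) ball_weight j = 1.
Proof.
rewrite -(pair_bigA _ (fun n e => ball_weight (n, e))) /= /ball_weight /=.
have E (c : R) : \sum_(e : {ffun 'I_d -> bool}) c / 2 ^+ d = c.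
  rewrite sumr_const card_ffun card_bool card_ord -[LHS]mulr_natr natrX divfK //.
  by rewrite expf_neq0 // pnatr_eq0.
under eq_bigr do rewrite E.
rewrite -big_mkcond /= -mulr_suml divff // gt_eqF //; exact: ball_gt0.
Qed.

Lemma ball_avg_powR_le K (q : R) f x : 1 <= q -> (forall x, 0 <= f x) ->
  ball_avg K f x `^ q <= ball_avg K [ffun y => f y `^ q] x.
Proof.
move=> q1 f0; rewrite !ball_avgE.
under [leRHS]eq_bigr do rewrite ffunE.
apply: powR_jensen => //; [exact: ball_weight_ge0 | exact: sum_ball_weight].
Qed.

Lemma ball_avg_lp (p : R) (N : nat) f (c : X -> 'I_N) : (0 < d)%N -> 2 <= p ->
  (forall x, 0 <= f x) ->
  \sum_x ball_avg (2 ^ (c x).+1) f x `^ p <= l2_constant R * \sum_x f x `^ p.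
Proof.
move=> d0 p2 f0.
have sq (a : R) : 0 <= a -> a `^ p = (a `^ (p / 2)) ^+ 2.
  by move=> a0; rewrite -powR_mulrn ?powR_ge0 // -powRrM; congr powR; field.
pose h : V := [ffun y => f y `^ (p / 2)].
have h0 x : 0 <= h x by rewrite ffunE powR_ge0.
have -> : \sum_x f x `^ p = \sum_x h x ^+ 2 by apply: eq_bigr => x _; rewrite sq ?ffunE.
apply: le_trans (ball_avg_l2 d0 c h0); apply: ler_sum => x _.
rewrite sq ?ball_avg_ge0 //; apply: lerXn2r; rewrite ?nnegrE ?powR_ge0 ?ball_avg_ge0 //.
apply: ball_avg_powR_le => //; lra.
Qed.

End TorusLp.

(** * Lattice points as absolute values with signs *)

Section LatticeSum.
Variables (R : realType) (d K : nat).
Local Notation point := {ffun 'I_d -> 'I_K.+1}.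
Implicit Types (n : point) (e : {ffun 'I_d -> bool}).

Definition signed_row n e : 'rV[int]_d := \row_i (if e i then - ((n i)%:Z) else (n i)%:Z).

Lemma sum_signed_coord (z : int) : (`|z| <= K)%N ->
  \sum_(u : 'I_K.+1) \sum_(c : bool) wt R u / 2 * ((if c then - (u%:Z) else u%:Z) == z)%:R = 1.
Proof.
move=> zK; have zK' : (`|z| < K.+1)%N by [].
rewrite (bigD1 (Ordinal zK')) //= [X in _ + X]big1 ?addr0.
  rewrite big_bool /= /wt.
  by case: z zK zK' => [[|k]|k] _ _; rewrite ?eqxx /=; do ?case: eqP => //= _; lra.
move=> u uz; rewrite big_bool /=.
have [h1 h2] : (- (u%:Z) == z) = false /\ (u%:Z == z) = false.
  split; apply/negP => /eqP E; case/eqP: uz; apply: val_inj; rewrite /= -E ?abszN //.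
by rewrite h1 h2 !mulr0 addr0.
Qed.

(** Only n_i = |y_i| contributes. Each zero coordinate admits both signs with weight 1, each other
    one a single sign with weight 2, so every coordinate contributes the factor 1. *)
Lemma sum_signed (y : 'rV[int]_d) : (forall i, (`|y 0%R i| <= K)%N) ->
  \sum_n \sum_e weight R n / 2 ^+ d * (signed_row n e == y)%:R = 1.
Proof.
move=> yK.
transitivity (\prod_(i < d) \sum_(u : 'I_K.+1) \sum_(c : bool)
    wt R u / 2 * ((if c then - (u%:Z) else u%:Z) == y 0 i)%:R); last first.
  by rewrite big1 // => i _; apply: sum_signed_coord.
rewrite bigA_distr_bigA; apply: eq_bigr => n _; rewrite bigA_distr_bigA; apply: eq_bigr => e _.
rewrite !big_split /= prodr_const card_ord exprVn; congr (_ * _).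
have [E|E] := eqVneq (signed_row n e) y.
  by rewrite big1 // => i _; rewrite -E mxE eqxx.
have [i ei] : exists i, signed_row n e 0 i != y 0 i.
  apply/existsP; rewrite -negb_forall; apply: contra E => /forallP h.
  by apply/eqP/rowP => i; apply/eqP/h.
by rewrite (bigD1 i) //=; move: ei; rewrite mxE => /negPf->; rewrite mul0r.
Qed.

Lemma abs_signed n e i : `|signed_row n e 0%R i|%N = n i.
Proof. by rewrite mxE; case: (e i); rewrite ?abszN. Qed.

Lemma lattice_sumE (s : seq 'rV[int]_d) (F : 'rV[int]_d -> R) : uniq s ->
  (forall y, (y \in s) = (\sum_i `|y 0%R i| <= K)%N) ->
  \sum_(y <- s) F y =
  \sum_(n : point | (norm1 n <= K)%N) weight R n * ((2 ^+ d)^-1 * \sum_e F (signed_row n e)).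
Proof.
move=> us ms.
have lenE n e : (\sum_i `|signed_row n e 0%R i| = norm1 n)%N.
  by apply: eq_bigr => i _; rewrite abs_signed.
transitivity (\sum_(y <- s) \sum_n \sum_e weight R n / 2 ^+ d * (signed_row n e == y)%:R * F y).
  rewrite !big_seq; apply: eq_bigr => y ys.
  under eq_bigr do rewrite -mulr_suml.
  rewrite -mulr_suml sum_signed ?mul1r // => i.
  by move: ys; rewrite ms; apply: leq_trans; rewrite (bigD1 i) //= leq_addr.
rewrite exchange_big [RHS]big_mkcond /=; apply: eq_bigr => n _.
rewrite exchange_big /=; case: ifP => nK.
  rewrite mulrA mulr_sumr; apply: eq_bigr => e _.
  have es : signed_row n e \in s by rewrite ms lenE.
  rewrite (bigD1_seq (signed_row n e)) //= eqxx mulr1 big1 ?addr0 // => y ye.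
  by rewrite eq_sym (negPf ye) mulr0 mul0r.
rewrite big1 // => e _; rewrite big_seq big1 // => y ys.
case: eqP => [E|_]; last by rewrite mulr0 mul0r.
by move: ys; rewrite ms -E lenE nK.
Qed.

End LatticeSum.

(** * Transference to the lattice *)

Section Transference.
Variables (R : realType) (d : nat).
Implicit Types (x y z : 'rV[int]_d) (f : 'rV[int]_d -> R).

(** The average [HLavg] in the encoding shared with the torus operator [ball_avg]; [HLavgE]
    identifies the two. *)
Definition lattice_avg (K : nat) f x : R := (ball_mass R d K K)^-1 *
  \sum_(n : {ffun 'I_d -> 'I_K.+1} | (norm1 n <= K)%N)
    weight R n * ((2 ^+ d)^-1 * \sum_e f (x - signed_row n e)).

Section Embedding.
Variable B : nat.
Let m := (2 * B)%N.
Local Notation X := {ffun 'I_d -> 'I_m.+1}.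

(** The window from -B to B becomes a cyclic group of order 2B + 1. The absolute value only converts
    to [nat], so the map is meaningful for z >= -B. *)
Definition wrap (z : int) : 'I_m.+1 := inZp `|z + B%:Z|.
Definition embed x : X := [ffun i => wrap (x 0 i)].
Definition unembed (u : X) : 'rV[int]_d := \row_i ((u i : nat)%:Z - B%:Z).

Lemma wrap_add (z : int) (u : nat) : - B%:Z <= z -> wrap (z + u%:Z) = wrap z + inZp u.
Proof.
move=> zB; rewrite /wrap; apply: val_inj; rewrite /= modnDm; congr (_ %% _)%N.
lia.
Qed.

Lemma embedK x : (forall i, `|x 0 i| <= B%:Z) -> unembed (embed x) = x.
Proof.
move=> xB; apply/rowP => i; rewrite mxE ffunE /=.
have := xB i; rewrite ler_norml => /andP[h1 h2].
rewrite modn_small; last by rewrite /m; lia.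
by rewrite gez0_abs; lia.
Qed.

Lemma unembed_inj : injective unembed.
Proof.
move=> u v /rowP E; apply/ffunP => i; have := E i; rewrite !mxE => h.
by apply: val_inj => /=; lia.
Qed.

(** The margin [K] excludes wrap-around. A true sign means addition in [sign_shift] and a negative
    entry in [signed_row], which agree after the subtraction. *)
Lemma shift_embed x (K : nat) (n : {ffun 'I_d -> 'I_K.+1}) e :
  (forall i, `|x 0 i| + K%:Z <= B%:Z) ->
  sign_shift (embed x) (fun i => n i) e = embed (x - signed_row n e).
Proof.
move=> xB; apply/ffunP => i; rewrite !ffunE !mxE.
have := xB i; have := ltn_ord (n i) => h1 h2.
have h3 : - B%:Z <= x 0 i by lia.
have h4 : - B%:Z <= x 0 i - (n i)%:Z by lia.
case: (e i); first by rewrite opprK wrap_add.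
by rewrite -{1}[x 0 i](subrK (n i)%:Z) wrap_add // addrK.
Qed.

Lemma lattice_avg_embed (K : nat) f x : (forall i, `|x 0 i| + K%:Z <= B%:Z) ->
  lattice_avg K f x = ball_avg K [ffun u => f (unembed u)] (embed x).
Proof.
move=> xB; rewrite /lattice_avg ffunE mulr_sumr big_mkcond; apply: eq_bigr => n _.
case: ifP => nK; last by rewrite mul0r.
rewrite mulrA [_ / _]mulrC ffunE; congr (_ * (_ * _)); apply: eq_bigr => e _.
rewrite ffunE shift_embed // embedK // => i.
have -> : (x - signed_row n e) 0 i = x 0 i - (if e i then - ((n i)%:Z) else (n i)%:Z) by rewrite !mxE.
have := xB i; have := ltn_ord (n i); move: (x 0 i) (nat_of_ord (n i)) => z k.
by case: (e i); lia.
Qed.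

End Embedding.

Lemma lattice_avg_ge0 K f x : (forall z, 0 <= f z) -> 0 <= lattice_avg K f x.
Proof.
move=> f0; rewrite mulr_ge0 ?invr_ge0 ?ball_ge0 // sumr_ge0 // => n _.
by rewrite mulr_ge0 ?weight_ge0 // mulr_ge0 ?invr_ge0 ?exprn_ge0 // sumr_ge0.
Qed.

(** A finite [s] uses boundedly many radii, so a window can contain every ball involved. The
    constant does not depend on the size of the window. *)
Lemma lattice_avg_lp (p J : R) f (s : seq 'rV[int]_d) (c : 'rV[int]_d -> nat) :
  (0 < d)%N -> 2 <= p -> (forall z, 0 <= f z) -> uniq s ->
  (forall t : seq 'rV[int]_d, uniq t -> \sum_(z <- t) f z `^ p <= J) ->
  \sum_(x <- s) lattice_avg (2 ^ (c x).+1) f x `^ p <= l2_constant R * J.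
Proof.
move=> d0 p2 f0 us fJ.
pose N := \max_(x <- s) c x.
pose L := \max_(x <- s) \max_i `|x 0%R i|%N.
pose B := (L + 2 ^ N.+1)%N.
have xB x : x \in s -> forall i, `|x 0 i| + (2 ^ (c x).+1)%:Z <= B%:Z.
  move=> xs i.
  have h1 : (`|x 0%R i| <= L)%N.
    apply: (bigmaxn_sup_seq x) => //.
    exact: (leq_bigmax (F := fun i => `|x 0%R i|%N)).
  have h2 : (2 ^ (c x).+1 <= 2 ^ N.+1)%N.
    by rewrite leq_exp2l // ltnS; exact: (leq_bigmax_seq x xs).
  by rewrite /B; lia.
have sB x : x \in s -> unembed (embed B x) = x.
  by move=> xs; apply: embedK => i; have := xB x xs i; lia.
pose g : {ffun {ffun 'I_d -> 'I_(2 * B).+1} -> R} := [ffun u => f (unembed u)].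
(* Faithful on the image of [s]; elsewhere [inord] may default, but those terms are nonnegative and
   only enlarge the sum. *)
pose c' (u : {ffun 'I_d -> 'I_(2 * B).+1}) : 'I_N.+1 := inord (c (unembed u)).
have g0 u : 0 <= g u by rewrite ffunE.
apply: (@le_trans _ _ (l2_constant R * \sum_u g u `^ p)); last first.
  apply: ler_wpM2l; first by rewrite /l2_constant; lra.
  have := fJ [seq unembed u | u <- enum {ffun 'I_d -> 'I_(2 * B).+1}].
  rewrite map_inj_uniq; last exact: unembed_inj.
  rewrite enum_uniq big_map big_enum => /(_ isT); apply: le_trans.
  by rewrite le_eqVlt; apply/orP; left; apply/eqP/eq_bigr => u _; rewrite ffunE.
apply: le_trans (ball_avg_lp c' d0 p2 g0).
apply: (@le_trans _ _ (\sum_(u <- [seq embed B x | x <- s]) ball_avg (2 ^ (c' u).+1) g u `^ p)).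
  rewrite big_map le_eqVlt; apply/orP; left; apply/eqP.
  rewrite !big_seq; apply: eq_bigr => x xs.
  have -> : c' (embed B x) = c x :> nat.
    by rewrite /c' sB // inordK // ltnS; exact: (leq_bigmax_seq x xs).
  by rewrite (lattice_avg_embed f (xB x xs)).
rewrite big_uniq /=; last first.
  by rewrite map_inj_in_uniq // => x y xs ys E; rewrite -(sB x xs) -(sB y ys) E.
rewrite [leRHS](bigID (mem [seq embed B x | x <- s])) /= lerDl.
by apply: sumr_ge0 => u _; apply: powR_ge0.
Qed.

End Transference.

From mathcomp Require Import finmap.
From mathcomp Require Import all_classical all_reals all_analysis.
Import Order.TTheory GRing.Theory Num.Theory.
Local Open Scope classical_set_scope.
Local Open Scope ring_scope.

(** * The maximal function on the lattice *)

Section HLavgBound.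
Variables (R : realType) (d : nat).
Implicit Types (f : 'rV[int]_d -> R) (x y : 'rV[int]_d).

Lemma mem_lattice_l1ball (K : nat) y :
  (y \in fset_set (lattice_l1ball (K%:R : R))) = (\sum_i `|y 0%R i| <= K)%N.
Proof.
rewrite in_fset_set; last exact: finite_lattice_l1ball.
apply/idP/idP; rewrite inE /lattice_l1ball /l1ball /=.
  under eq_bigr do rewrite mxE -intr_norm -abszE.
  by rewrite -natr_sum ler_nat.
move=> h; under eq_bigr do rewrite mxE -intr_norm -abszE.
by rewrite -natr_sum ler_nat.
Qed.

Lemma HLavgE (K : nat) f x : HLavg (K%:R : R) f x = lattice_avg K f x.
Proof.
rewrite /HLavg /lattice_avg fsbig_finite; last exact: finite_lattice_l1ball.
have us : uniq (fset_set (lattice_l1ball (K%:R : R)) : seq 'rV[int]_d) by exact: fset_uniq.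
have ms := mem_lattice_l1ball K.
rewrite (lattice_sumE (fun y => f (x - y)) us ms); congr (_^-1 * _).
rewrite -sum1_size natr_sum (lattice_sumE (fun=> 1) us ms).
apply: eq_bigr => n _; rewrite sumr_const card_ffun card_bool card_ord natrX.
by rewrite mulVf ?mulr1 // expf_neq0.
Qed.

Lemma norm_lattice_avg_le (K : nat) f x :
  `|lattice_avg K f x| <= lattice_avg K (fun z => `|f z|) x.
Proof.
have b0 := ball_ge0 R d K K.
rewrite /lattice_avg normrM normfV (ger0_norm b0); apply: ler_wpM2l; first by rewrite invr_ge0.
apply: le_trans (ler_norm_sum _ _ _) _; apply: ler_sum => n _.
rewrite normrM ger0_norm ?weight_ge0 //; apply: ler_wpM2l; first exact: weight_ge0.
rewrite normrM ger0_norm ?invr_ge0 ?exprn_ge0 //; apply: ler_wpM2l; first by rewrite invr_ge0 exprn_ge0.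
exact: ler_norm_sum.
Qed.

Variables (p J : R) (f : 'rV[int]_d -> R).
Hypotheses (d0 : (0 < d)%N) (p2 : 2 <= p).
Hypothesis fJ : forall t : seq 'rV[int]_d, uniq t -> \sum_(z <- t) `|f z| `^ p <= J.

Lemma HLavg_lp (s : seq 'rV[int]_d) (c : 'rV[int]_d -> nat) : uniq s ->
  \sum_(x <- s) `|HLavg (2 ^+ (c x).+1 : R) f x| `^ p <= l2_constant R * J.
Proof.
move=> us; apply: le_trans (lattice_avg_lp c d0 p2 (fun z => normr_ge0 (f z)) us fJ).
have p_ge0 : 0 <= p by apply: le_trans p2.
apply: ler_sum => x _; apply: ge0_ler_powR; rewrite ?nnegrE ?lattice_avg_ge0 //.
by rewrite -natrX HLavgE norm_lattice_avg_le.
Qed.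

(** The supremum over infinitely many radii need not be attained, so a radius reaching half of it is
    selected. Finiteness of the supremum comes from [HLavg_lp] at the single point [x]. *)
Lemma HLmax_witness x : exists k : nat,
  (HLmax dyadic f x <= (2 * `|HLavg (2 ^+ k.+1 : R) f x|)%:E)%E.
Proof.
have J0 : 0 <= J by have := @fJ [::] isT; rewrite big_nil.
have CJ : 0 <= l2_constant R * J by rewrite mulr_ge0 // /l2_constant; lra.
have p0 : 0 < p by apply: lt_le_trans p2.
pose b : R := (l2_constant R * J) `^ p^-1.
have bnd k : `|HLavg (2 ^+ k.+1 : R) f x| <= b.
  have := @HLavg_lp [:: x] (fun=> k) isT; rewrite big_seq1 => h.
  have := @ge0_ler_powR _ p^-1 _ _ _ _ _ h; rewrite invr_ge0 (ltW p0) !nnegrE powR_ge0 CJ.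
  by move=> /(_ isT isT isT); rewrite -powRrM mulfV ?gt_eqF // powRr1.
have ub : (HLmax dyadic f x <= b%:E)%E.
  apply: ge_ereal_sup => _ [r [[|k] // _ ->] <-]; by rewrite lee_fin.
have lb k : (`|HLavg (2 ^+ k.+1 : R) f x|%:E <= HLmax dyadic f x)%E.
  by apply: ereal_sup_ubound; exists (2 ^+ k.+1) => //; exists k.+1.
(* If the supremum is 0, half of it is not strictly smaller and any radius serves. *)
have [h0|h0] := leP (HLmax dyadic f x) 0%E.
  by exists 0%N; apply: le_trans h0 _; rewrite lee_fin mulr_ge0.
have fin : HLmax dyadic f x \is a fin_num.
  rewrite ge0_fin_numE ?(ltW h0) //; exact: le_lt_trans ub (ltry _).
have h1 : 0 < fine (HLmax dyadic f x) by rewrite -lte_fin fineK.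
have : ((fine (HLmax dyadic f x) / 2)%:E < HLmax dyadic f x)%E.
  by rewrite -[ltRHS]fineK // lte_fin; lra.
move=> /ereal_sup_gt[_ [r [[|k] // _ ->] <-]]; rewrite lte_fin => h2.
by exists k; rewrite -[leLHS]fineK // lee_fin; lra.
Qed.

Lemma HLmax_lp_sum (s : seq 'rV[int]_d) : uniq s ->
  (\sum_(x <- s) poweR `|HLmax dyadic f x| p <= (2 `^ p * (l2_constant R * J))%:E)%E.
Proof.
move=> us; have [c cE] := choice HLmax_witness.
have p0 : 0 <= p by apply: le_trans p2.
apply: (@le_trans _ _ (\sum_(x <- s) (2 `^ p * `|HLavg (2 ^+ (c x).+1 : R) f x| `^ p)%:E)%E).
  apply: lee_sum => x _; rewrite -powRM // -poweR_EFin.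
  have h0 : (0 <= HLmax dyadic f x)%E.
    apply: (@le_trans _ _ (`|HLavg (2 ^+ 1 : R) f x|%:E)%E); first by rewrite lee_fin.
    by apply: ereal_sup_ubound; exists (2 ^+ 1) => //; exists 1%N.
  by rewrite gee0_abs //; apply: gt0_ler_poweR => //; rewrite in_itv /= ?leey ?andbT //.
rewrite sumEFin lee_fin -mulr_sumr; apply: ler_wpM2l; first exact: powR_ge0.
exact: HLavg_lp.
Qed.

End HLavgBound.

Theorem theorem1p17 (R : realType) :
  exists C : R, 0 < C /\
    forall (d : nat) (p : R), (0 < d)%N -> 2 <= p ->
    forall f : 'rV[int]_d -> R, in_lp p f ->
      (lpnorm p (HLmax dyadic f) <= C%:E * lpnorm p (EFin \o f))%E.
Proof.
have C1 : 1 <= l2_constant R by rewrite /l2_constant; lra.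
exists (2 * l2_constant R); split; first lra.
move=> d p d0 p2 f; rewrite /in_lp /lpnorm.
have p0 : 0 < p by lra.
have pV0 : 0 < p^-1 by rewrite invr_gt0.
set I := \esum_(x in _) poweR `|(EFin \o f) x|%E p => fI.
have I0 : (0 <= I)%E by apply: esum_ge0 => x _; apply: poweR_ge0.
have finI : I \is a fin_num.
  rewrite ge0_fin_numE //; rewrite ltey; apply/eqP => E.
  by move: fI; rewrite E poweRyr ?gt_eqF // ltxx.
set J := fine I; have IJ : I = J%:E by rewrite fineK.
have J0 : 0 <= J by apply: fine_ge0.
have fJ (t : seq 'rV[int]_d) : uniq t -> \sum_(z <- t) `|f z| `^ p <= J.
  move=> ut; rewrite -lee_fin -IJ; apply: esum_ge.
  exists [set` t]; first by split=> //; exact: finite_seq.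
  rewrite -fsbig_seq // -sumEFin; apply: lee_sum => z _.
  by rewrite -poweR_EFin.
have main : (\esum_(x in [set: 'rV[int]_d]) poweR `|HLmax dyadic f x| p <=
    (2 `^ p * (l2_constant R * J))%:E)%E.
  (* The sum over the lattice is a supremum over finite sets, so finitely many points suffice. *)
  apply: ge_ereal_sup => _ [A [finA _] <-]; rewrite fsbig_finite //.
  exact: (HLmax_lp_sum d0 p2 fJ (fset_uniq _)).
apply: (@le_trans _ _ (poweR (2 `^ p * (l2_constant R * J))%:E p^-1)).
  apply: gt0_ler_poweR => //; rewrite ?ltW // in_itv /= leey andbT.
    by apply: esum_ge0 => x _; apply: poweR_ge0.
  by rewrite lee_fin mulr_ge0 ?powR_ge0 // mulr_ge0 //; lra.
rewrite IJ !poweR_EFin -EFinM lee_fin.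
rewrite powRM ?powR_ge0 //; last by rewrite mulr_ge0 //; lra.
rewrite powRM //; last lra.
rewrite -powRrM mulfV ?gt_eqF // powRr1 // -mulrA; apply: ler_wpM2l => //.
apply: ler_wpM2r; first exact: powR_ge0.
(* Uniformity in p: the constant is at least 1 and 1/p <= 1, so its p-th root is at most itself. *)
rewrite -[leRHS]powRr1; last lra.
by apply: ler_powR => //; rewrite invf_le1 //; lra.
Qed.
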